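(* Consider the self-destructive percolation model on the square lattice with parameters $p,\delta\in[0,1]$, and let $f(\rho,s)=f_{p,\delta}(\rho,s)$ denote the probability that there is an occupied horizontal crossing of a given $\rho s\times s$ rectangle ($\rho,s>0$). Then: (1) if $\limsup_{s\to\infty} f(\rho,s)>0$ for some $\rho>0$, then $\limsup_{s\to\infty} f(\rho,s)>0$ for all $\rho>0$; (2) equivalently, if $\limsup_{s\to\infty} f(\rho,s)=0$ for some $\rho>0$, then $\limsup_{s\to\infty} f(\rho,s)=0$ for all $\rho>0$; (3) if $\lim_{s\to\infty} f(\rho,s)=1$ for some $\rho>0$, then $\lim_{s\to\infty} f(\rho,s)=1$ for all $\rho>0$.
   Context: Self-destructive percolation (sdp) on the square lattice $\mathbb{Z}^2$ (nearest-neighbour edges) with parameters $p,\delta\in[0,1]$: Let $X_i$, $i\in\mathbb{Z}^2$, be independent $0$-$1$ valued random variables with $P(X_i=1)=p$, and let $Y_i$, $i\in\mathbb{Z}^2$, be independent $0$-$1$ valued random variables with $P(Y_i=1)=\delta$, the collection $(Y_i)$ being independent of $(X_i)$. Let $X_i^*=1$ if $X_i=1$ and there is no infinite (self-avoiding) $X$-occupied path starting at $i$ (a path in the square lattice all of whose sites $j$ have $X_j=1$), and $X_i^*=0$ otherwise. Put $Z_i = X_i^* \vee Y_i$ ($1$ = occupied, $0$ = vacant). $\mathcal{P}_{p,\delta}$ denotes the distribution of $(Z_i)_{i\in\mathbb{Z}^2}$ on $\{0,1\}^{\mathbb{Z}^2}$; all occupied/vacant statements in the model refer to $Z$. The $\rho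 s\times s$ rectangle is taken to be $[0,\rho s]\times[0,s]$ (width $\rho s$, height $s$). An occupied horizontal crossing of it is a nearest-neighbour path of occupied sites, all lying in $\mathbb{Z}^2\cap([0,\rho s]\times[0,s])$, from the leftmost column $\{x=0\}$ to the rightmost column $\{x=\lfloor \rho s\rfloor\}$ of lattice sites in the rectangle. *)

(* Defs.v *)
From mathcomp Require Import all_boot all_order all_algebra.
From mathcomp Require Import finmap.
From mathcomp Require Import all_classical all_reals all_analysis.

Set Implicit Arguments.
Unset Strict Implicit.
Unset Printing Implicit Defensive.

Import Order.TTheory GRing.Theory Num.Theory.
Import numFieldNormedType.Exports.

Local Open Scope classical_set_scope.
Local Open Scope ring_scope.

Section Independence.
Context (d : measure_display) (T : measurableType d) (R : realType)
  (P : probability T R) (d' : measure_display) (T' : measurableType d').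

Definition independent_RVs (I : choiceType) (X : I -> {RV P >-> T'}) : Prop :=
  forall (J : {fset I}) (A : I -> set T'),
    (forall i, i \in J -> measurable (A i)) ->
    P (\bigcap_(i in [set` J]) (X i @^-1` A i)) =
      (\prod_(i <- J) P (X i @^-1` A i))%E.

Definition sigma_RVs (I : Type) (X : I -> {RV P >-> T'}) : set (set T) :=
  <<s \bigcup_i preimage_set_system setT (X i) measurable >>.

Definition independent_collections (I J : Type)
    (X : I -> {RV P >-> T'}) (Y : J -> {RV P >-> T'}) : Prop :=
  forall A B : set T, sigma_RVs X A -> sigma_RVs Y B ->
    P (A `&` B) = (P A * P B)%E.

End Independence.

Notation site := (int * int)%type.

Definition adj : rel site :=
  fun i j => `|i.1 - j.1| + `|i.2 - j.2| == 1.

(* A configuration in {0,1}^(Z^2); [true] means occupied. *)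
Definition config : Type := site -> bool.

Definition infinite_path_from (x : config) (i : site) : Prop :=
  exists g : nat -> site,
    [/\ g 0%N = i, injective g, forall n, adj (g n) (g n.+1)
      & forall n, x (g n)].

Definition destroy (x : config) : config :=
  fun i => x i && ~~ `[< infinite_path_from x i >].

Definition sdp_config (x y : config) : config :=
  fun i => destroy x i || y i.

Section Crossing.
Context (R : realType).

Definition in_rect (rho s : R) : pred site :=
  fun i => (0 <= (i.1%:~R : R) <= rho * s) && (0 <= (i.2%:~R : R) <= s).

Definition horizontal_crossing (rho s : R) (z : config) : Prop :=
  exists (i : site) (l : seq site),
    [/\ path adj i l,
        all (fun j => in_rect rho s j && z j) (i :: l),
        i.1 = 0
      & (last i l).1 = Num.floor (rho * s)].

Definition crossing_probability (d : measure_display) (T : measurableType d)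
    (P : probability T R) (X Y : site -> {RV P >-> bool}) (rho s : R) : \bar R :=
  P [set w | horizontal_crossing rho s
               (sdp_config (fun i => X i w) (fun i => Y i w))].

End Crossing.

(* Main.v *)
(* For an associated, lattice-symmetric and asymptotically mixing law of configurations there
   is a general Russo-Seymour-Welsh criterion: if the probability of crossing some K n x n
   rectangle lengthwise tends to 0, then so does that of crossing n x K n the short way.
   Indeed a crossing of a strip that does not oscillate can be glued to its reflection into a
   longer crossing, so crossings oscillate at many scales; hence a crossing that is not too
   long contains a much shorter crossing on each side of a square, and by mixing the crossing
   probabilities contract.

   The law of Z satisfies these hypotheses. Positive association: in a finite window whose
   boundary plays the role of infinity, condition on the destroyed set; the rest is a product
   measure to which Harris' inequality applies, and the conditional expectations are monotone
   in the destroyed set. Mixing: apply the criterion first to the vacant sites of X. Either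
   vacant circuits surround every site at infinitely many scales, and nothing is destroyed; or
   vacant crossings are summably rare along scales 4^k, and then any macroscopic cluster is
   glued to a ladder of occupied crossings and is infinite, so destruction is a local event.

   Parts (1) and (2) are the criterion for occupied nearest-neighbour crossings. For part (3),
   by planar duality f -> 1 means that vacant crossings with diagonal steps vanish, and the
   criterion applies to those. *)
Require Import Defs.
From mathcomp Require Import all_boot all_order all_algebra.
From mathcomp Require Import finmap.
From mathcomp Require Import all_classical all_reals all_analysis.
From mathcomp Require Import zify ring lra.

Import Order.TTheory GRing.Theory Num.Theory.
Import numFieldNormedType.Exports.

Local Open Scope classical_set_scope.
Local Open Scope ring_scope.

Set Implicit Arguments.
Unset Strict Implicit.
Unset Printing Implicit Defensive.

(** * Planar topology of lattice walks *)

(** No crossing is explored. Once sites are dependent, conditioning on an extremal crossing leaves a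
    law that is not controlled, so every gluing combines events fixed in advance, through positive
    association alone. The cost is that heights are known only up to a mesh [g], a fixed small
    fraction of the scale, and that the number [J] of cells enters the estimates; it does not depend
    on the scale, so squaring a small probability absorbs it. The length of crossings supplies the
    initial value of the contraction. Passing from side [S] to [S %/ 6] divides the allowed length
    by 72 and squares the probability. At the bottom of this descent a crossing of fewer than one
    step is impossible, while 72 exceeds 6 ^ 2, so that after enough levels the allowance exceeds
    the number of sites of the rectangle and the length restriction becomes void. Using the
    criterion to prove mixing is not circular: it is applied there to the vacant sites of [X], a
    product field whose hypotheses are immediate. *)

Definition step (k : bool) (i j : site) : bool :=
  [&& `|i.1 - j.1| <= 1, `|i.2 - j.2| <= 1 & [|| k, i.1 == j.1 | i.2 == j.2]].

(** Since [step] is reflexive, walks may pause, and concatenation needs no separate case for equal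
    endpoints. The flag [k] admits diagonal steps, so that occupied paths ([false]) and their dual
    vacant paths ([true]) share one theory. *)
Definition walk (k : bool) (S : pred site) (g : nat -> site) (L : nat) :=
  (forall t, (t < L)%N -> step k (g t) (g t.+1)) /\
  (forall t, (t <= L)%N -> S (g t)).

Definition rect (a b c d : int) : pred site :=
  fun i => (a <= i.1 <= b) && (c <= i.2 <= d).

Lemma step_refl k i : step k i i.
Proof. rewrite /step; lia. Qed.

Lemma step_sym k i j : step k i j -> step k j i.
Proof. rewrite /step; lia. Qed.

Lemma step_true k i j : step k i j -> step true i j.
Proof. rewrite /step; lia. Qed.

Lemma walk_sub k S g L s t : walk k S g L -> (s <= t <= L)%N ->
  walk k S (fun r => g (s + r)%N) (t - s).
Proof.
move=> [H1 H2] st; split=> r rt; last by apply: H2; lia.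
by rewrite addnS; apply: H1; lia.
Qed.

Lemma walk_rev k S g L : walk k S g L -> walk k S (fun r => g (L - r)%N) L.
Proof.
move=> [H1 H2]; split=> r rt; last by apply: H2; lia.
apply: step_sym; have -> : (L - r = (L - r.+1).+1)%N by lia.
by apply: H1; lia.
Qed.

Lemma walk_cat k S g h M L : walk k S g M -> walk k S h L -> step k (g M) (h 0%N) ->
  walk k S (fun r => if (r <= M)%N then g r else h (r - M.+1)%N) (M + L).+1.
Proof.
move=> [H1 H2] [H3 H4] Hs; split=> r rt.
  case: (ltngtP r M) => rM.
  - exact: H1.
  - have -> : (r.+1 - M.+1 = (r - M.+1).+1)%N by lia.
    by apply: H3; lia.
  - by rewrite rM subnn.
by case: leqP => rM; [apply: H2 | apply: H4; lia].
Qed.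

Lemma walk_mono k (S S' : pred site) g L : (forall i, S i -> S' i) ->
  walk k S g L -> walk k S' g L.
Proof. by move=> SS [H1 H2]; split=> // t /H2 /SS. Qed.

Lemma walk_weak k (S : pred site) g L : walk k S g L -> walk true S g L.
Proof. by move=> [H1 H2]; split=> // t /H1 /step_true. Qed.

Lemma walk_restr k (S S' : pred site) g L : walk k S g L ->
  (forall t, (t <= L)%N -> S' (g t)) -> walk k S' g L.
Proof. by move=> [H1 _] H; split. Qed.

(* Number, mod 2, of steps of a nearest-neighbour walk that cross the half-line
   going down from the midpoint of [v] and [v + (1, 0)]. *)
Definition below_parity (g : nat -> site) (M : nat) (v : site) : bool :=
  \big[addb/false]_(s < M)
    ((((g s).1 <= v.1) (+) ((g s.+1).1 <= v.1)) && ((g s).2 <= v.2)).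

Lemma big_addb_telescope (f : nat -> bool) M :
  \big[addb/false]_(s < M) (f s (+) f s.+1) = f 0%N (+) f M.
Proof.
elim: M => [|M IH]; first by rewrite big_ord0 addbb.
by rewrite big_ord_recr /= IH; case: (f 0%N); case: (f M); case: (f M.+1).
Qed.

(** When [v] moves to the next column, the two counts differ by the edges of [g] that enter or leave
    the right-hand one of the two columns below both points; nothing else changes because [g] avoids
    [v] and [v']. These edges are increments of the indicator [F], which telescope to the ends of
    [g], and both ends lie outside that column. *)
Lemma below_parity_step (a b : int) g M (v v' : site) :
  walk false predT g M -> (g 0%N).1 <= a -> b < (g M).1 ->
  a <= v.1 <= b -> a <= v'.1 <= b -> step true v v' ->
  (forall s, (s <= M)%N -> g s != v) -> (forall s, (s <= M)%N -> g s != v') ->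
  below_parity g M v = below_parity g M v'.
Proof.
move=> [Hg _] H0 HM.
wlog vv : v v' / v.1 <= v'.1 => [WL|] Hv Hv' Hs nv nv'.
  case: (leP v.1 v'.1) => vv; first exact: WL.
  by apply/esym; apply: WL => //; [lia | apply: step_sym].
pose F (i : site) : bool :=
  [&& i.1 == v'.1, v.1 != v'.1 & i.2 <= Num.min v.2 v'.2].
suff : below_parity g M v (+) below_parity g M v' = false.
  by case: below_parity; case: below_parity.
rewrite /below_parity -big_split /=.
transitivity (\big[addb/false]_(s < M) (F (g s) (+) F (g s.+1))); last first.
  rewrite (big_addb_telescope (fun s => F (g s))) /F minEle.
  by move: (g 0%N) (g M) v v' vv Hv Hv' H0 HM {Hs nv nv' F} =>
    [? ?] [? ?] [? ?] [? ?] /=; case: leP; lia.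
apply: eq_bigr => -[s sM] _ /=.
have := Hg s sM; have := nv s (ltnW sM); have := nv s.+1 sM.
have := nv' s (ltnW sM); have := nv' s.+1 sM.
rewrite {}/F; move: (g s) (g s.+1) v v' vv Hv Hv' Hs {nv nv'} =>
  [x1 y1] [x2 y2] [x3 y3] [x4 y4].
rewrite /step /= !xpair_eqE minEle => vv _ _ Hs n1 n2 n3 n4 Hg12.
have [ex|ex] : x4 = x3 \/ x4 = x3 + 1 by lia.
  have [ey|[ey|ey]] : y4 = y3 \/ y4 = y3 + 1 \/ y4 = y3 - 1 by lia.
  - by rewrite ex ey; lia.
  - by rewrite ex ey eqxx !andbF; move: ex ey n1 n2 n3 n4 Hg12 => -> -> *; lia.
  - by rewrite ex ey eqxx !andbF; move: ex ey n1 n2 n3 n4 Hg12 => -> -> *; lia.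
have [[e1 e2]|[e1 e2]] : (y2 = y1 /\ (x2 = x1 \/ x2 = x1 + 1 \/ x2 = x1 - 1)) \/
    (x2 = x1 /\ (y2 = y1 + 1 \/ y2 = y1 - 1)) by lia.
  case: e2 => [e2|[e2|e2]]; rewrite e1 e2 ex in n1 n2 n3 n4 *; case: (leP y3 y4) => y34; lia.
by case: e2 => [e2|e2]; rewrite e1 e2 ex in n1 n2 n3 n4 *; case: (leP y3 y4) => y34; lia.
Qed.

(** As long as [h] avoids [g], the parity seen from [h t] is constant. It is even at the bottom and
    odd at the top, where it counts all passages of [g] from left to right of [h L]. *)
Lemma meet_core (a b c d : int) g M h L :
  walk false predT g M -> walk true predT h L ->
  (g 0%N).1 <= a -> b < (g M).1 ->
  (forall s, (s <= M)%N -> c <= (g s).2 <= d) ->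
  (forall t, (t <= L)%N -> a <= (h t).1 <= b) ->
  (h 0%N).2 <= c -> d <= (h L).2 ->
  exists s t, [/\ (s <= M)%N, (t <= L)%N & g s = h t].
Proof.
move=> Hg Hh g0 gM gr hc h0 hL; apply: contrapT => H.
have ndisj s t : (s <= M)%N -> (t <= L)%N -> g s != h t.
  by move=> sM tL; apply/eqP => E; apply: H; exists s, t.
have Hpar t : (t <= L)%N -> below_parity g M (h t) = below_parity g M (h 0%N).
  elim: t => // t IH tL; rewrite -IH; last exact: ltnW.
  apply/esym; apply: (@below_parity_step a b) => //.
  - exact/hc/ltnW.
  - exact: hc.
  - exact: Hh.1.
  - by move=> s sM; apply: ndisj => //; apply: ltnW.
  - by move=> s sM; apply: ndisj.
have E0 : below_parity g M (h 0%N) = false.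
  rewrite /below_parity big1 // => -[s sM] _ /=.
  have := Hg.1 s sM; have := ndisj s 0%N (ltnW sM) (leq0n _).
  have := ndisj s.+1 0%N sM (leq0n _); have := gr s (ltnW sM).
  move: (g s) (g s.+1) (h 0%N) h0 => [x1 y1] [x2 y2] [x3 y3].
  rewrite /step /= !xpair_eqE => *; lia.
suff EL : below_parity g M (h L) by move: (Hpar L (leqnn L)); rewrite E0 EL.
rewrite /below_parity.
rewrite (eq_bigr (fun s : 'I_M =>
    ((g s).1 <= (h L).1) (+) ((g s.+1).1 <= (h L).1))); last first.
  by move=> [s sM] _ /=; have := gr s (ltnW sM); lia.
rewrite (big_addb_telescope (fun s => (g s).1 <= (h L).1)).
have := hc L (leqnn L); lia.
Qed.

Lemma meet48 (a b c d : int) g M h L :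
  walk false predT g M -> walk true predT h L ->
  (g 0%N).1 <= a -> b <= (g M).1 ->
  (forall s, (s <= M)%N -> c <= (g s).2 <= d) ->
  (forall t, (t <= L)%N -> a <= (h t).1 <= b) ->
  (h 0%N).2 <= c -> d <= (h L).2 ->
  exists s t, [/\ (s <= M)%N, (t <= L)%N & g s = h t].
Proof.
move=> Hg Hh g0 gM gr hc h0 hL.
(* One more step to the right puts the end of [g] strictly beyond [b]; the added site is outside the
   columns of [h], so the meeting point is on [g] itself. *)
pose e : nat -> site := fun=> ((g M).1 + 1, (g M).2).
have He : walk false predT e 0 by split.
have Hs : step false (g M) (e 0%N) by rewrite /step /=; lia.
have Hge := walk_cat Hg He Hs.
have [s [t [sM tL E]]] : exists s t, [/\ (s <= (M + 0).+1)%N, (t <= L)%N &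
    (if (s <= M)%N then g s else e (s - M.+1)%N) = h t].
  apply: (@meet_core a b c d) => //=.
  - by rewrite addn0 ltnn /e /=; lia.
  - by move=> s _; case: leqP => sM; [exact: gr | rewrite /e /=; exact: gr].
exists s, t; move: E; case: leqP => sM' // E.
by exfalso; have := hc t tL; rewrite -E /e /=; lia.
Qed.

Definition fill (g : nat -> site) (t : nat) : site :=
  if odd t then ((g t./2.+1).1, (g t./2).2) else g t./2.

Lemma walk_fill g M : walk true predT g M -> walk false predT (fill g) M.*2.
Proof.
move=> [Hg _]; split=> // t tM.
have := Hg t./2 ltac:(lia); rewrite /fill /= uphalf_half.
by case: (odd t) => /=; rewrite ?add1n ?add0n /step /=; lia.
Qed.

(** Two walks with diagonal steps may cross without a common site. One of them is made
    nearest-neighbour by inserting corners, so that [meet48] applies, and an inserted corner is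
    within one step of a site of the original walk. *)
Lemma touch k (a b c d : int) g M h L :
  walk k predT g M -> walk k predT h L ->
  (g 0%N).1 <= a -> b <= (g M).1 ->
  (forall s, (s <= M)%N -> c <= (g s).2 <= d) ->
  (forall t, (t <= L)%N -> a <= (h t).1 <= b) ->
  (h 0%N).2 <= c -> d <= (h L).2 ->
  exists s t, [/\ (s <= M)%N, (t <= L)%N & step k (g s) (h t)].
Proof.
case: k => Hg Hh g0 gM gr hc h0 hL; last first.
  have [s [t [? ? E]]] := meet48 Hg (walk_weak Hh) g0 gM gr hc h0 hL.
  by exists s, t; split=> //; rewrite E; exact: step_refl.
have f0 : (fill g 0%N).1 <= a by [].
have fM : b <= (fill g M.*2).1 by rewrite /fill odd_double doubleK.
have fr s : (s <= M.*2)%N -> c <= (fill g s).2 <= d.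
  by move=> sM; rewrite /fill; case: odd; apply: gr; lia.
have [s [t [sM tL E]]] := meet48 (walk_fill Hg) Hh f0 fM fr hc h0 hL.
exists s./2, t; split=> //; first by lia.
rewrite -E /fill; case: ifP => os; last exact: step_refl.
have := Hg.1 s./2 ltac:(lia); rewrite /step /=; lia.
Qed.

Lemma int_ivt_first (f : nat -> int) (s t : nat) (d : int) : (s <= t)%N ->
  (forall r, (s <= r < t)%N -> `|f r.+1 - f r| <= 1) -> f s <= d -> d <= f t ->
  exists r, [/\ (s <= r <= t)%N, f r = d & forall q, (s <= q < r)%N -> f q < d].
Proof.
move=> st Hf fs ft.
have exP : exists r, (s <= r)%N && (d <= f r) by exists t; rewrite st.
case: (ex_minnP exP) => r /andP [sr dr] rmin.
have rt : (r <= t)%N by apply: rmin; rewrite st.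
have Hlt q : (s <= q < r)%N -> f q < d.
  move=> /andP [sq qr]; rewrite ltNge; apply/negP => dq.
  by have := rmin q; rewrite sq dq leqNgt qr => /(_ isT).
exists r; split=> //; first by rewrite sr.
case: (ltnP s r) => sr'; last first.
  have E : s = r by lia.
  by rewrite E in fs; lia.
have := Hlt r.-1 ltac:(lia); have := Hf r.-1 ltac:(lia).
by rewrite prednK; lia.
Qed.

(** The end is the first visit to [d]; the start is the last earlier visit to [c], found as a first
    visit in reversed time. *)
Lemma int_sub_cross (f : nat -> int) (s t : nat) (c d : int) : (s <= t)%N ->
  (forall r, (s <= r < t)%N -> `|f r.+1 - f r| <= 1) ->
  f s <= c -> c <= d -> d <= f t ->
  exists s' t', [/\ (s <= s' <= t')%N, (t' <= t)%N, f s' = c, f t' = d &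
    forall r, (s' <= r <= t')%N -> c <= f r <= d].
Proof.
move=> st Hf fs cd ft.
have fsd : f s <= d by lia.
have [t' [t's ft' Ht']] := int_ivt_first st Hf fsd ft.
pose f' r := - f (t' - r)%N.
have [|r rt|||r [rt fr Hr]] := @int_ivt_first f' 0 (t' - s) (- c).
- by [].
- rewrite /f'; have := Hf (t' - r.+1)%N ltac:(lia).
  by rewrite (_ : (t' - r = (t' - r.+1).+1)%N); lia.
- by rewrite /f' subn0; lia.
- by rewrite /f' subKn; lia.
rewrite /f' in fr.
exists (t' - r)%N, t'; split; [lia | lia | lia | exact: ft' |].
move=> q qt; apply/andP; split.
  case: (ltnP (t' - r) q) => qr; last first.
    have -> : q = (t' - r)%N by lia.
    by lia.
  have := Hr (t' - q)%N ltac:(lia); rewrite /f' subKn; lia.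
case: (ltnP q t') => qt'; first by have := Ht' q ltac:(lia); lia.
by rewrite (_ : q = t'); lia.
Qed.

(** * Connections and crossings of rectangles *)

Definition conn (k : bool) (S : pred site) (i j : site) : Prop :=
  exists g L, [/\ walk k S g L, g 0%N = i & g L = j].

Lemma conn_refl k (S : pred site) i : S i -> conn k S i i.
Proof. by move=> Si; exists (fun=> i), 0%N; split. Qed.

Lemma conn_sym k S i j : conn k S i j -> conn k S j i.
Proof.
move=> [g [L [H <- <-]]]; exists (fun r => g (L - r)%N), L; split.
- exact: walk_rev.
- by rewrite subn0.
- by rewrite subnn.
Qed.

Lemma conn_step k S i j i' j' : conn k S i j -> conn k S i' j' -> step k j i' ->
  conn k S i j'.
Proof.
move=> [g [M [Hg <- <-]]] [h [L [Hh <- <-]]] Hs.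
exists (fun r => if (r <= M)%N then g r else h (r - M.+1)%N), (M + L).+1.
split=> //; first exact: walk_cat.
by rewrite ifF; [congr h; lia | lia].
Qed.

Lemma conn_trans k S i j l : conn k S i j -> conn k S j l -> conn k S i l.
Proof. by move=> Hi Hj; apply: (conn_step Hi Hj); exact: step_refl. Qed.

Lemma conn_in k S i j : conn k S i j -> S i /\ S j.
Proof. by move=> [g [L [[_ H] <- <-]]]; split; apply: H. Qed.

Lemma conn_mono k (S S' : pred site) i j : (forall i, S i -> S' i) ->
  conn k S i j -> conn k S' i j.
Proof. by move=> SS [g [L [H ? ?]]]; exists g, L; split=> //; apply: walk_mono H. Qed.

Lemma walk_conn k S g L s t : walk k S g L -> (s <= L)%N -> (t <= L)%N ->
  conn k S (g s) (g t).
Proof.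
move=> H; wlog st : s t / (s <= t)%N => [WL sL tL|sL tL].
  by case: (leqP s t) => st; [exact: WL | apply/conn_sym/WL => //; exact: ltnW].
exists (fun r => g (s + r)%N), (t - s)%N; split.
- by apply: walk_sub H _; rewrite st.
- by rewrite addn0.
- by rewrite subnKC.
Qed.

(** The bound is on steps and strict: [Some 1] leaves only walks at a single site. *)
Definition short (ell : option nat) (L : nat) : bool :=
  if ell is Some l then (L < l)%N else true.

Definition hcross k ell (a b c d : int) (z : config) : Prop :=
  exists g L, [/\ walk k (fun i => rect a b c d i && z i) g L,
    short ell L, (g 0%N).1 = a & (g L).1 = b].

Definition vcross k ell (a b c d : int) (z : config) : Prop :=
  exists g L, [/\ walk k (fun i => rect a b c d i && z i) g L,
    short ell L, (g 0%N).2 = c & (g L).2 = d].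

Definition tr (i : site) : site := (i.2, i.1).

Lemma step_tr k i j : step k i j -> step k (tr i) (tr j).
Proof. rewrite /step /tr /=; lia. Qed.

Lemma hcross_tr k ell a b c d z :
  hcross k ell a b c d (fun i => z (tr i)) <-> vcross k ell c d a b z.
Proof.
have E (S S' : pred site) g L : (forall i, S i = S' (tr i)) -> walk k S g L ->
    walk k S' (fun t => tr (g t)) L.
  move=> SS [H1 H2]; split=> t tL; first exact/step_tr/H1.
  by rewrite -SS; apply: H2.
split=> -[g [L [Hg sL g0 gL]]]; exists (fun t => tr (g t)), L; split=> //;
  by apply: E Hg => -[x y]; rewrite /rect /tr /=; lia.
Qed.

Lemma step_rows k i j : step k i j -> `|j.2 - i.2| <= 1.
Proof. rewrite /step; lia. Qed.

Lemma step_cols k i j : step k i j -> `|j.1 - i.1| <= 1.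
Proof. rewrite /step; lia. Qed.

Lemma walk_vcross k ell (S : pred site) a b c d (z : config) g L s t :
  walk k S g L -> (s <= L)%N -> (t <= L)%N ->
  (forall i, S i -> (a <= i.1 <= b) && z i) ->
  (g s).2 <= c -> c <= d -> d <= (g t).2 -> short ell (maxn s t - minn s t) ->
  vcross k ell a b c d z.
Proof.
wlog st : g s t / (s <= t)%N => [WL|] Hw sL tL HS gs cd gt sh.
  case: (leqP s t) => st; first exact: (WL g s t).
  apply: (WL (fun r => g (L - r)%N) (L - s)%N (L - t)%N) => //.
  - by lia.
  - exact: walk_rev.
  - by lia.
  - by lia.
  - by rewrite subKn.
  - by rewrite subKn.
  - by move: sh; rewrite (_ : (maxn s t - minn s t =
      maxn (L - s) (L - t) - minn (L - s) (L - t))%N); last by lia.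
have [r rt|//|//|//|s' [t' [H1 H2 E1 E2 H3]]] :=
  @int_sub_cross (fun r => (g r).2) s t c d st.
  by apply: step_rows (Hw.1 r _); lia.
exists (fun r => g (s' + r)%N), (t' - s')%N; split.
- split=> r rt; first by rewrite addnS; apply: Hw.1; lia.
  have := H3 (s' + r)%N ltac:(lia); have := HS _ (Hw.2 (s' + r)%N ltac:(lia)).
  by rewrite /rect => /andP [-> ->] ->.
- by case: ell sh => //= l; lia.
- by rewrite addn0.
- by rewrite subnKC; lia.
Qed.

Lemma conn_vcross k (S : pred site) a b c d (z : config) i j :
  conn k S i j -> (forall i, S i -> (a <= i.1 <= b) && z i) ->
  i.2 <= c -> c <= d -> d <= j.2 -> vcross k None a b c d z.
Proof.
move=> [g [L [H <- <-]]] HS ic cd dj.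
by apply: (walk_vcross H (leq0n L) (leqnn L) HS).
Qed.

Lemma walk_hcross k ell (S : pred site) a b c d (z : config) g L s t :
  walk k S g L -> (s <= L)%N -> (t <= L)%N ->
  (forall i, S i -> (c <= i.2 <= d) && z i) ->
  (g s).1 <= a -> a <= b -> b <= (g t).1 -> short ell (maxn s t - minn s t) ->
  hcross k ell a b c d z.
Proof.
move=> Hw sL tL HS gs ab gt sh.
have Hw' : walk k (fun i => S (tr i)) (fun r => tr (g r)) L.
  by split=> r rL; [exact/step_tr/Hw.1 | case: (g r) (Hw.2 r rL)].
have := @walk_vcross k ell _ c d a b (fun i => z (tr i)) _ L s t Hw' sL tL.
rewrite -hcross_tr; set w := fun i => _; rewrite (_ : w = z); last first.
  by apply/funext => -[].
by apply=> // i /HS.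
Qed.

Lemma conn_hcross k (S : pred site) a b c d (z : config) i j :
  conn k S i j -> (forall i, S i -> (c <= i.2 <= d) && z i) ->
  i.1 <= a -> a <= b -> b <= j.1 -> hcross k None a b c d z.
Proof.
move=> [g [L [H <- <-]]] HS ic cd dj.
by apply: (walk_hcross H (leq0n L) (leqnn L) HS).
Qed.

Lemma hcross_conn k ell a b c d z : hcross k ell a b c d z ->
  exists i j, [/\ conn k (fun i => rect a b c d i && z i) i j, i.1 = a & j.1 = b].
Proof. by move=> [g [L [H _ g0 gL]]]; exists (g 0%N), (g L); split=> //; exists g, L. Qed.

Lemma vcross_conn k ell a b c d z : vcross k ell a b c d z ->
  exists i j, [/\ conn k (fun i => rect a b c d i && z i) i j, i.2 = c & j.2 = d].
Proof. by move=> [g [L [H _ g0 gL]]]; exists (g 0%N), (g L); split=> //; exists g, L. Qed.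

Lemma walk_touch k a b c d a' b' c' d' (z z' : pred site) g M h L :
  walk k (fun i => rect a b c d i && z i) g M -> (g 0%N).1 = a -> (g M).1 = b ->
  walk k (fun i => rect a' b' c' d' i && z' i) h L -> (h 0%N).2 = c' -> (h L).2 = d' ->
  a <= a' -> b' <= b -> c' <= c -> d <= d' ->
  exists s t, [/\ (s <= M)%N, (t <= L)%N & step k (g s) (h t)].
Proof.
move=> Hg g0 gM Hh h0 hL aa bb cc dd.
apply: (@touch k a' b' c d g M h L (walk_mono (fun _ _ => isT) Hg)
  (walk_mono (fun _ _ => isT) Hh)).
- by rewrite g0.
- by rewrite gM.
- by move=> s /Hg.2; rewrite /rect; lia.
- by move=> s /Hh.2; rewrite /rect; lia.
- by rewrite h0.
- by rewrite hL.
Qed.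

Lemma cross_disjoint a b c d z ell ell' :
  hcross false ell a b c d z -> vcross true ell' a b c d (fun i => ~~ z i) -> False.
Proof.
move=> [g [M [Hg _ g0 gM]]] [h [L [Hh _ h0 hL]]].
have [| | | |||s [t [sM tL st]]] := @meet48 a b c d g M h L
  (walk_mono (fun _ _ => isT) Hg) (walk_mono (fun _ _ => isT) Hh).
- by rewrite g0.
- by rewrite gM.
- by move=> s /Hg.2; rewrite /rect; lia.
- by move=> s /Hh.2; rewrite /rect; lia.
- by rewrite h0.
- by rewrite hL.
have := Hg.2 s sM; have := Hh.2 t tL; rewrite st.
by move=> /andP [_ /negbTE ->]; rewrite andbF.
Qed.

(* Labels of sites: (occupied?, connected?), where an occupied site is tested for a
   connection to the left side and a vacant one for a connection to the bottom. They are
   placed on a circle in the order (1,1), (0,1), (1,0), (0,0); [turn] is the signed jump. *)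
Definition turn (p q : bool * bool) : int :=
  match p, q with
  | (true, true), (false, true) | (false, true), (true, false)
  | (true, false), (false, false) | (false, false), (true, true) => 1
  | (false, true), (true, true) | (true, false), (false, true)
  | (false, false), (true, false) | (true, true), (false, false) => -1
  | _, _ => 0
  end.

Definition compat (p q : bool * bool) := (p.1 == q.1) ==> (p.2 == q.2).

(** Four alternately occupied and vacant corners could carry all four labels in cyclic order and
    make a full turn; the two hypotheses on diagonals exclude this, which is why vacant paths need
    diagonal steps. *)
Lemma turn_square (p q r s : bool * bool) :
  compat p q -> compat q r -> compat s r -> compat p s ->
  (~~ p.1 && ~~ r.1 ==> (p.2 == r.2)) -> (~~ q.1 && ~~ s.1 ==> (q.2 == s.2)) ->
  turn p q + turn q r = turn p s + turn s r.
Proof. by move: p q r s => [[] []] [[] []] [[] []] [[] []]. Qed.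

(** Where one label is missing, the circle opens into a segment and turns become increments of the
    integer coordinate [lift]. *)
Lemma turn_sum (lift : bool * bool -> int) (bad : bool * bool) (f : nat -> bool * bool) m :
  (forall p q, p != bad -> q != bad -> compat p q -> turn p q = lift q - lift p) ->
  (forall x, (x <= m)%N -> f x != bad) ->
  (forall x, (x < m)%N -> compat (f x) (f x.+1)) ->
  \sum_(x < m) turn (f x) (f x.+1) = lift (f m) - lift (f 0%N).
Proof.
move=> Hl; elim: m => [|m IH] Hb Hc; first by rewrite big_ord0 subrr.
rewrite big_ord_recr /= IH => [|x xm|x xm]; [|by apply: Hb; lia|by apply: Hc; lia].
rewrite Hl ?Hb ?Hc //; lia.
Qed.

(** Adding [turn_square] over all unit squares shows that the total turn along the boundary is zero.
    But each side misses one label, and the four lifts used in the proof agree at three corners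
    while differing by 4 at the corner [(0, 0)]. *)
Lemma no_full_turn (f : nat -> nat -> bool * bool) m n :
  (forall x y, (x < m)%N -> (y <= n)%N -> compat (f x y) (f x.+1 y)) ->
  (forall x y, (x <= m)%N -> (y < n)%N -> compat (f x y) (f x y.+1)) ->
  (forall x y, (x < m)%N -> (y < n)%N ->
    (~~ (f x y).1 && ~~ (f x.+1 y.+1).1 ==> ((f x y).2 == (f x.+1 y.+1).2)) /\
    (~~ (f x.+1 y).1 && ~~ (f x y.+1).1 ==> ((f x.+1 y).2 == (f x y.+1).2))) ->
  (forall y, (y <= n)%N -> f 0%N y != (true, false)) ->
  (forall x, (x <= m)%N -> f x 0%N != (false, false)) ->
  (forall y, (y <= n)%N -> f m y != (true, true)) ->
  (forall x, (x <= m)%N -> f x n != (false, true)) -> False.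
Proof.
move=> Hh Hv Hd left bot right top.
pose hs y := \sum_(x < m) turn (f x y) (f x.+1 y).
pose vs x := \sum_(y < n) turn (f x y) (f x y.+1).
have row y : (y < n)%N ->
    hs y + turn (f m y) (f m y.+1) = hs y.+1 + turn (f 0%N y) (f 0%N y.+1).
  move=> yn; suff H m' : (m' <= m)%N ->
      \sum_(x < m') turn (f x y) (f x.+1 y) + turn (f m' y) (f m' y.+1) =
      \sum_(x < m') turn (f x y.+1) (f x.+1 y.+1) + turn (f 0%N y) (f 0%N y.+1).
    exact: H.
  elim: m' => [|m' IH] mm; first by rewrite !big_ord0.
  rewrite !big_ord_recr /=; have := IH (ltnW mm).
  have [D1 D2] := Hd m' y mm yn.
  have := turn_square (Hh m' y mm (ltnW yn)) (Hv m'.+1 y mm yn) (Hh m' y.+1 mm yn)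
    (Hv m' y (ltnW mm) yn) D1 D2.
  by move=> E1 E2; rewrite -addrA E1 addrA E2 addrAC.
have tot : hs 0%N + vs m = hs n + vs 0%N.
  suff H n' : (n' <= n)%N ->
      hs 0%N + \sum_(y < n') turn (f m y) (f m y.+1) =
      hs n' + \sum_(y < n') turn (f 0%N y) (f 0%N y.+1).
    exact: H.
  elim: n' => [|n' IH] nn; first by rewrite !big_ord0.
  by rewrite !big_ord_recr /=; have := IH (ltnW nn); have := row n' nn => E1 E2;
  rewrite addrA E2 addrAC E1 addrAC addrA.
have Hb : hs 0%N = _ := turn_sum
  (lift := fun p => match p with (true, true) => 0 | (false, true) => 1 | _ => 2 end)
  _ bot (fun x xm => Hh x 0%N xm (leq0n n)).
have Hr : vs m = _ := turn_sum
  (lift := fun p => match p with (false, true) => 1 | (true, false) => 2 | _ => 3 end)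
  _ right (fun x xm => Hv m x (leqnn m) xm).
have Ht : hs n = _ := turn_sum
  (lift := fun p => match p with (true, false) => 2 | (false, false) => 3 | _ => 4 end)
  _ top (fun x xm => Hh x n xm (leqnn n)).
have Hl : vs 0%N = _ := turn_sum
  (lift := fun p => match p with (false, false) => 3 | (true, true) => 4 | _ => 5 end)
  _ left (fun x xm => Hv 0%N x (leq0n m) xm).
move: tot; rewrite Hb; last by move=> [[] []] [[] []].
rewrite Hr; last by move=> [[] []] [[] []].
rewrite Ht; last by move=> [[] []] [[] []].
rewrite Hl; last by move=> [[] []] [[] []].
have := left 0%N (leq0n n); have := left n (leqnn n).
have := right 0%N (leq0n n); have := right n (leqnn n).
have := top 0%N (leq0n m); have := top m (leqnn m).
have := bot 0%N (leq0n m); have := bot m (leqnn m).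
by case: (f 0%N 0%N) => [[] []]; case: (f m 0%N) => [[] []];
   case: (f 0%N n) => [[] []]; case: (f m n) => [[] []].
Qed.

(** If both crossings fail, each side misses a label: on the left every occupied site is connected
    to the left and on the right none is, and likewise for vacant sites at the bottom and the
    top. *)
Lemma cross_dual (a b c d : int) z : a <= b -> c <= d ->
  hcross false None a b c d z \/ vcross true None a b c d (fun i => ~~ z i).
Proof.
move=> ab cd; apply: contrapT => H.
have nh : ~ hcross false None a b c d z by move=> ?; apply: H; left.
have nv : ~ vcross true None a b c d (fun i => ~~ z i) by move=> ?; apply: H; right.
pose So i := rect a b c d i && z i.
pose Sv i := rect a b c d i && ~~ z i.
pose L i := `[< exists2 j, conn false So i j & j.1 = a >].
pose B i := `[< exists2 j, conn true Sv i j & j.2 = c >].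
pose lab i := (z i, if z i then L i else B i).
have Lstep i j : So i -> So j -> step false i j -> L i = L j.
  wlog suff : i j / So i -> So j -> step false i j -> L i -> L j.
    move=> W Si Sj ij; apply/idP/idP; first exact: W.
    by apply: W => //; apply: step_sym.
  move=> Si Sj ij /asboolP [l il la]; apply/asboolP; exists l => //.
  by apply: conn_step (conn_refl false Sj) il (step_sym ij).
have Bstep i j : Sv i -> Sv j -> step true i j -> B i = B j.
  wlog suff : i j / Sv i -> Sv j -> step true i j -> B i -> B j.
    move=> W Si Sj ij; apply/idP/idP; first exact: W.
    by apply: W => //; apply: step_sym.
  move=> Si Sj ij /asboolP [l il la]; apply/asboolP; exists l => //.
  by apply: conn_step (conn_refl true Sj) il (step_sym ij).
have comp i j : rect a b c d i -> rect a b c d j -> step false i j ->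
    compat (lab i) (lab j).
  move=> ri rj ij; rewrite /compat /lab /=; apply/implyP => /eqP E; rewrite -E.
  case: ifP => zi; first by rewrite (Lstep i j) // /So ?ri ?rj -?E zi.
  by rewrite (Bstep i j) // /Sv ?ri ?rj -?E ?zi //; apply: step_true ij.
pose f (x y : nat) := lab (a + x%:Z, c + y%:Z).
pose m := `|b - a|%N; pose n := `|d - c|%N.
have rec x y : (x <= m)%N -> (y <= n)%N -> rect a b c d (a + x%:Z, c + y%:Z).
  by rewrite /rect /m /n /=; lia.
apply: (@no_full_turn f m n).
- move=> x y xm yn; apply: comp; [by apply: rec; lia| by apply: rec; lia|].
  by rewrite /step /=; lia.
- move=> x y xm yn; apply: comp; [by apply: rec; lia| by apply: rec; lia|].
  by rewrite /step /=; lia.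
- have diag i j : rect a b c d i -> rect a b c d j -> step true i j ->
      ~~ (lab i).1 && ~~ (lab j).1 ==> ((lab i).2 == (lab j).2).
    move=> ri rj ij; apply/implyP => /andP [/= zi zj].
    by rewrite (negbTE zi) (negbTE zj) (Bstep i j) // /Sv ?ri ?rj.
  move=> x y xm yn; split; (apply: diag; [apply: rec; lia | apply: rec; lia |]);
    by rewrite /step /=; lia.
- move=> y yn; rewrite /f /lab xpair_eqE negb_and; case: ifP => //= zi.
  rewrite eqbF_neg negbK; apply/asboolP.
  exists (a + 0%:Z, c + y%:Z); last by rewrite /= addr0.
  by apply: conn_refl; rewrite /So rec //= zi.
- move=> x xm; rewrite /f /lab xpair_eqE negb_and; case: ifP => //= zi.
  rewrite eqbF_neg negbK; apply/asboolP.
  exists (a + x%:Z, c + 0%:Z); last by rewrite /= addr0.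
  by apply: conn_refl; rewrite /Sv rec //= zi.
- move=> y yn; rewrite /f /lab xpair_eqE negb_and; case: ifP => //= zi.
  apply/negP => /eqP /asboolP [j cj ja]; apply: nh.
  apply: (conn_hcross (conn_sym cj)) => //=.
  + by move=> i; rewrite /So /rect => /andP [/andP [_ ->] ->].
  + by rewrite ja.
  + by rewrite /m; lia.
- move=> x xm; rewrite /f /lab xpair_eqE negb_and; case: ifP => //= zi.
  apply/negP => /eqP /asboolP [j cj ja]; apply: nv.
  apply: (conn_vcross (conn_sym cj)) => //=.
  + by move=> i; rewrite /Sv /rect => /andP [/andP [-> _] ->].
  + by rewrite ja.
  + by rewrite /n; lia.
Qed.

(** * Laws on configurations *)

Definition depends_on (D : pred site) (E : config -> Prop) : Prop :=
  forall z z', (forall i, D i -> z i = z' i) -> E z -> E z'.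

Definition box (N : nat) : pred site := rect (- N%:Z) N%:Z (- N%:Z) N%:Z.

Definition local (E : config -> Prop) : Prop := exists N, depends_on (box N) E.

Definition increasing (E : config -> Prop) : Prop :=
  forall z z' : config, (forall i, z i -> z' i) -> E z -> E z'.

Lemma depends_mono (D D' : pred site) E : (forall i, D i -> D' i) ->
  depends_on D E -> depends_on D' E.
Proof. by move=> DD H z z' zz; apply: H => i /DD /zz. Qed.

Lemma rect_box a b c d : exists N, forall i, rect a b c d i -> box N i.
Proof.
exists (`|a| + `|b| + `|c| + `|d|)%N => i; rewrite /rect /box /rect; lia.
Qed.

Lemma local_rect a b c d E : depends_on (rect a b c d) E -> local E.
Proof. by have [N H] := rect_box a b c d => HE; exists N; apply: depends_mono HE. Qed.

Lemma depends_or D E F : depends_on D E -> depends_on D F ->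
  depends_on D (fun z => E z \/ F z).
Proof. by move=> HE HF z z' zz [/HE|/HF] H; [left|right]; apply: H. Qed.

Lemma depends_and D E F : depends_on D E -> depends_on D F ->
  depends_on D (fun z => E z /\ F z).
Proof. by move=> HE HF z z' zz [/HE H1 /HF H2]; split; [apply: H1 | apply: H2]. Qed.

Lemma depends_not D E : depends_on D E -> depends_on D (fun z => ~ E z).
Proof. by move=> HE z z' zz nE /HE H; apply/nE/H => i /zz. Qed.

Lemma local2 E F : local E -> local F -> exists N,
  depends_on (box N) E /\ depends_on (box N) F.
Proof.
move=> [N HN] [M HM]; exists (maxn N M).
by split; [apply: depends_mono HN | apply: depends_mono HM] => i; rewrite /box /rect; lia.
Qed.

Lemma local_or E F : local E -> local F -> local (fun z => E z \/ F z).
Proof. by move=> HE HF; have [N [? ?]] := local2 HE HF; exists N; apply: depends_or. Qed.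

Lemma local_and E F : local E -> local F -> local (fun z => E z /\ F z).
Proof. by move=> HE HF; have [N [? ?]] := local2 HE HF; exists N; apply: depends_and. Qed.

Lemma local_not E : local E -> local (fun z => ~ E z).
Proof. by move=> [N HE]; exists N; apply: depends_not. Qed.

Lemma local_const (Q : Prop) : local (fun=> Q).
Proof. by exists 0%N. Qed.

Lemma local_ex m (E : nat -> config -> Prop) : (forall i, (i < m)%N -> local (E i)) ->
  local (fun z => exists2 i, (i < m)%N & E i z).
Proof.
elim: m => [|m IH] H.
  rewrite (_ : (fun z => _) = fun=> False); first exact: local_const.
  by apply/funext => z; apply/propext; split=> // -[].
rewrite (_ : (fun z => _) = fun z => (exists2 i, (i < m)%N & E i z) \/ E m z).
  by apply: local_or; [apply: IH => i im; apply: H; lia | apply: H].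
apply/funext => z; apply/propext; split.
  move=> [i im Ei]; case: (ltngtP i m) => im'; [left; by exists i | lia |].
  by right; rewrite -im'.
by move=> [[i im Ei]|Em]; [exists i => //; lia | exists m].
Qed.

Lemma local_map (f : site -> site) E :
  (forall N, exists M, forall i, box N i -> box M (f i)) -> local E ->
  local (fun z => E (fun i => z (f i))).
Proof.
move=> Hf [N HN]; have [M HM] := Hf N; exists M => z z' zz; apply: HN => i Ni.
by apply/zz/HM.
Qed.

Definition translate (v : site) (i : site) : site := (i.1 + v.1, i.2 + v.2).
Definition flip (i : site) : site := (i.1, - i.2).

Lemma local_flip E : local E -> local (fun z => E (fun i => z (flip i))).
Proof. by apply: local_map => N; exists N => i; rewrite /box /rect /flip /=; lia. Qed.

Lemma step_translate k v i j : step k i j -> step k (translate v i) (translate v j).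
Proof. rewrite /step /translate /=; lia. Qed.

Lemma depends_hcross k ell a b c d : depends_on (rect a b c d) (hcross k ell a b c d).
Proof.
move=> z z' zz [g [L [[H1 H2] ? ? ?]]]; exists g, L; split=> //; split=> // t /H2.
by case/andP=> r zt; rewrite r /= -zz.
Qed.

Lemma depends_vcross k ell a b c d : depends_on (rect a b c d) (vcross k ell a b c d).
Proof.
move=> z z' zz [g [L [[H1 H2] ? ? ?]]]; exists g, L; split=> //; split=> // t /H2.
by case/andP=> r zt; rewrite r /= -zz.
Qed.

Lemma local_hcross k ell a b c d : local (hcross k ell a b c d).
Proof. exact: local_rect (@depends_hcross k ell a b c d). Qed.

Lemma local_vcross k ell a b c d : local (vcross k ell a b c d).
Proof. exact: local_rect (@depends_vcross k ell a b c d). Qed.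

Lemma increasing_hcross k ell a b c d : increasing (hcross k ell a b c d).
Proof.
move=> z z' zz [g [L [H ? ? ?]]]; exists g, L; split=> //.
by apply: walk_mono H => i /andP [-> /zz].
Qed.

Lemma increasing_vcross k ell a b c d : increasing (vcross k ell a b c d).
Proof.
move=> z z' zz [g [L [H ? ? ?]]]; exists g, L; split=> //.
by apply: walk_mono H => i /andP [-> /zz].
Qed.

Lemma increasing_and E F : increasing E -> increasing F ->
  increasing (fun z => E z /\ F z).
Proof. by move=> HE HF z z' zz [/(HE _ _ zz) ? /(HF _ _ zz)]. Qed.

Lemma hcross_translate k ell a b c d v z :
  hcross k ell a b c d (fun i => z (translate v i)) <->
  hcross k ell (a + v.1) (b + v.1) (c + v.2) (d + v.2) z.
Proof.
split=> -[g [L [[H1 H2] sL g0 gL]]].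
  exists (fun t => translate v (g t)), L; split; [|by []|by rewrite /= g0|by rewrite /= gL].
  split=> t tL; first exact/step_translate/H1.
  by have := H2 t tL; rewrite /rect /translate /=; lia.
have sK i : translate v (translate (- v.1, - v.2) i) = i.
  by case: i => x y; rewrite /translate /= !addrNK.
exists (fun t => translate (- v.1, - v.2) (g t)), L.
split; [|by []|by rewrite /= g0 addrK|by rewrite /= gL addrK].
split=> t tL; first exact/step_translate/H1.
by rewrite -/(translate v _) sK; have := H2 t tL; rewrite /rect /translate /=; lia.
Qed.

(* [law_mix] is a one-sided form of asymptotic independence: boxes of side [K n] at
   distance at least [2 n]. *)
Record rsw_law (R : realType) (mu : (config -> Prop) -> R) : Prop := RswLaw {
  law0 : mu (fun=> False) <= 0;
  law_ge0 : forall E, local E -> 0 <= mu E;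
  law_le1 : forall E, local E -> mu E <= 1;
  law_mono : forall E F, local E -> local F -> (forall z, E z -> F z) -> mu E <= mu F;
  law_or : forall E F, local E -> local F -> mu (fun z => E z \/ F z) <= mu E + mu F;
  law_fkg : forall E F, local E -> local F -> increasing E -> increasing F ->
    mu E * mu F <= mu (fun z => E z /\ F z);
  law_translate : forall v E, local E -> mu (fun z => E (fun i => z (translate v i))) = mu E;
  law_flip : forall E, local E -> mu (fun z => E (fun i => z (flip i))) = mu E;
  law_tr : forall E, local E -> mu (fun z => E (fun i => z (tr i))) = mu E;
  law_mix : forall (K : nat) (eps : R), 0 < eps ->
    exists n0 : nat, forall n : nat, (n0 <= n)%N -> forall (x y x' y' : int) E F,
      depends_on (rect x (x + (K * n)%N%:Z) y (y + (K * n)%N%:Z)) E ->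
      depends_on (rect x' (x' + (K * n)%N%:Z) y' (y' + (K * n)%N%:Z)) F ->
      x + (K * n)%N%:Z + (2 * n)%N%:Z <= x' ->
      mu (fun z => E z /\ F z) <= mu E * mu F + eps }.

Section Law.
Variables (R : realType) (mu : (config -> Prop) -> R) (lawmu : rsw_law mu) (k : bool).

Lemma mu_hcross ell a b c d :
  mu (hcross k ell a b c d) = mu (hcross k ell 0 (b - a) 0 (d - c)).
Proof.
rewrite -(law_translate lawmu (a, c) (local_hcross _ _ 0 (b - a) 0 (d - c))).
by congr mu; apply/funext => z; apply/propext; rewrite hcross_translate /= !add0r !subrK.
Qed.

Lemma mu_vcross ell a b c d : mu (vcross k ell a b c d) = mu (hcross k ell c d a b).
Proof.
rewrite -(law_tr lawmu (local_hcross _ _ c d a b)).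
by congr mu; apply/funext => z; apply/propext; rewrite hcross_tr.
Qed.

Definition hprob ell (m n : nat) : R := mu (hcross k ell 0 m%:Z 0 n%:Z).

Lemma mu_hprob ell a b c d m n : b = a + m%:Z -> d = c + n%:Z ->
  mu (hcross k ell a b c d) = hprob ell m n.
Proof. by move=> -> ->; rewrite mu_hcross /hprob (addrC a) (addrC c) !addrK. Qed.

Lemma mu_vprob ell a b c d m n : b = a + m%:Z -> d = c + n%:Z ->
  mu (vcross k ell a b c d) = hprob ell n m.
Proof. by move=> ? ?; rewrite mu_vcross; apply: mu_hprob. Qed.

Lemma hprob_ge0 ell m n : 0 <= hprob ell m n.
Proof. exact/(law_ge0 lawmu)/local_hcross. Qed.

Lemma hprob_le1 ell m n : hprob ell m n <= 1.
Proof. exact/(law_le1 lawmu)/local_hcross. Qed.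

Lemma hcross_sub a b c d b' c' d' z : b <= b' -> a <= b -> c' <= c -> d <= d' ->
  hcross k None a b' c d z -> hcross k None a b c' d' z.
Proof.
move=> bb ab cc dd /hcross_conn [i [j [ij ia jb]]].
apply: (conn_hcross ij) => //; rewrite ?ia ?jb //.
by move=> l /andP [rl ->]; rewrite andbT; move: rl; rewrite /rect; lia.
Qed.

Lemma hprob_mono m n m' n' : (m <= m')%N -> (n' <= n)%N ->
  hprob None m' n' <= hprob None m n.
Proof.
move=> mm nn; apply: (law_mono lawmu); try exact: local_hcross.
by move=> z; apply: hcross_sub; lia.
Qed.

Lemma mu_ex m (E : nat -> config -> Prop) c : (forall i, (i < m)%N -> local (E i)) ->
  (forall i, (i < m)%N -> mu (E i) <= c) ->
  mu (fun z => exists2 i, (i < m)%N & E i z) <= m%:R * c.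
Proof.
elim: m => [|m IH] H Hc.
  rewrite mul0r (_ : (fun z => _) = fun=> False); first exact: law0 lawmu.
  by apply/funext => z; apply/propext; split=> // -[].
rewrite (_ : (fun z => _) = fun z => (exists2 i, (i < m)%N & E i z) \/ E m z); last first.
  apply/funext => z; apply/propext; split.
    move=> [i im Ei]; case: (ltngtP i m) => im'; [left; by exists i | lia |].
    by right; rewrite -im'.
  by move=> [[i im Ei]|Em]; [exists i => //; lia | exists m].
apply: le_trans (law_or lawmu _ _) _.
- by apply: local_ex => i im; apply: H; lia.
- exact: H.
rewrite -addn1 natrD mulrDl mul1r; apply: lerD; last exact: Hc.
by apply: IH => i im; [apply: H | apply: Hc]; lia.
Qed.

End Law.

(** * The Russo-Seymour-Welsh criterion *)

Lemma hglue k a b c d a' b' a'' b'' z :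
  hcross k None a b c d z -> vcross k None a' b' c d z -> hcross k None a'' b'' c d z ->
  a <= a' -> b' <= b -> a'' <= a' -> b' <= b'' -> a <= b'' -> hcross k None a b'' c d z.
Proof.
move=> [g [M [Hg _ g0 gM]]] [h [L [Hh _ h0 hL]]] [f [N [Hf _ f0 fN]]] aa bb aa' bb' ab.
have [s [t [sM tL st]]] := walk_touch Hg g0 gM Hh h0 hL aa bb (lexx _) (lexx _).
have [s' [t' [sM' tL' st']]] := walk_touch Hf f0 fN Hh h0 hL aa' bb' (lexx _) (lexx _).
pose S i := (c <= i.2 <= d) && z i.
have HS x y i : rect x y c d i && z i -> S i.
  by rewrite /S /rect => /andP [/andP [_ ->] ->].
have c1 := walk_conn (walk_mono (@HS _ _) Hg) (leq0n M) sM.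
have c2 := walk_conn (walk_mono (@HS _ _) Hh) tL tL'.
have c3 := walk_conn (walk_mono (@HS _ _) Hf) sM' (leqnn N).
apply: (conn_hcross (conn_step (conn_step c1 c2 st) c3 (step_sym st'))) => //.
- by rewrite g0.
- by rewrite fN.
Qed.

(* [g] starts below [h] on the left side, [h] crosses the strip, and [g] rises above [h]:
   extending both to the left of the strip forces them to meet. *)
Lemma above_touch k (a b c : int) g L h M :
  walk k predT g L -> walk k predT h M ->
  (g 0%N).1 = a -> (h 0%N).1 = a -> (h M).1 = b ->
  (forall t, (t <= L)%N -> a <= (g t).1 <= b) ->
  (forall t, (t <= M)%N -> [/\ a <= (h t).1, c <= (h t).2 & (h t).2 <= (g L).2]) ->
  (g 0%N).2 + 2 <= (h 0%N).2 ->
  exists s t, [/\ (s <= L)%N, (t <= M)%N & step k (g s) (h t)].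
Proof.
move=> Hg Hh g0 h0 hM gc hc gh.
have [y Ey] : exists y, (g 0%N).2 = y by eexists.
have [y' Ey'] : exists y', (h 0%N).2 = y' by eexists.
rewrite Ey Ey' in gh.
pose c' := Num.min c y; pose m := `|y - c'|%N.
have Ec' : c' + m%:Z = y /\ c' <= c.
  by rewrite /m /c' minEle; case: leP => ?; lia.
(* [G] reaches [h] from the left along the row [y']; [D] reaches [g] from below along the column
   [a - 2], then along the row [y]. The gap of 2 between the rows keeps the added pieces apart, and
   a contact of an added piece with the other walk passes to the first site of the walk it
   extends. *)
pose G t : site := if (t < 2)%N then (a - 2 + t%:Z, y') else h (t - 2)%N.
pose D t : site := if (t <= m)%N then (a - 2, c' + t%:Z) else
  if t == m.+1 then (a - 1, y) else g (t - m.+2)%N.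
have HG : walk k predT G M.+2.
  split=> // t tM; rewrite /G; case: t tM => [|[|t]] tM /=.
  - by rewrite /step /=; lia.
  - by rewrite subnn /step /=; lia.
  - by rewrite !subSS !subn0; apply: Hh.1.
have HD : walk k predT D (m.+2 + L).
  split=> // t tL; rewrite /D; case: (ltngtP t m) => tm.
  - by rewrite /step /=; lia.
  - rewrite eqSS (gtn_eqF tm); case: eqP => [->|tm'].
      by rewrite subnn /step /=; lia.
    rewrite (_ : (t.+1 - m.+2 = (t - m.+2).+1)%N); last by lia.
    by apply: Hg.1; lia.
  - by rewrite tm eqxx /step /=; lia.
have [| | | | | |s [t [sM tL st]]] := @touch k (a - 2) b c' (g L).2 G M.+2 D _ HG HD.
- by rewrite /G /=; lia.
- by rewrite /G /= !subSS subn0 hM.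
- move=> s sM; rewrite /G; case: ifP => s2 /=.
    by have [_ ? ?] := hc 0%N (leq0n M); lia.
  by have [_ ? ?] := hc (s - 2)%N ltac:(lia); lia.
- move=> t tL; rewrite /D; case: ifP => t1 /=; first by have := gc 0%N (leq0n L); lia.
  by case: ifP => t2 /=; [have := gc 0%N (leq0n L) | have := gc (t - m.+2)%N ltac:(lia)]; lia.
- by rewrite /D /= addr0.
- by rewrite /D ifF; [rewrite ifF; [rewrite addKn | lia] | lia].
have hs : (2 <= s)%N -> G s = h (s - 2)%N by move=> s2; rewrite /G ltnNge s2.
have Dt : (m.+2 <= t)%N -> D t = g (t - m.+2)%N.
  by move=> ?; rewrite /D ifF; [rewrite ifF // | ]; lia.
case: (leqP 2 s) => s2.
  have [hx hy hz] := hc (s - 2)%N ltac:(lia).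
  case: (leqP m.+2 t) => t2.
    exists (t - m.+2)%N, (s - 2)%N; split; [by lia | by lia |].
    by apply: step_sym; rewrite -hs // -Dt.
  exists 0%N, (s - 2)%N; split => //; first by lia.
  move: st; rewrite hs // /D; case: ifP => t1; first by rewrite /step /=; lia.
  by rewrite ifT; [rewrite /step /=; lia | lia].
case: (leqP m.+2 t) => t2.
  exists (t - m.+2)%N, 0%N; split => //; first by lia.
  have := gc (t - m.+2)%N ltac:(lia).
  by move: st; rewrite Dt // /G s2 /step /=; lia.
exfalso; move: st; rewrite /G s2 /D; case: ifP => t1; first by rewrite /step /=; lia.
by rewrite ifT; [rewrite /step /=; lia | lia].
Qed.

Definition refl (r : int) (i : site) : site := (i.1, r - i.2).

Lemma step_refl_row k r i j : step k i j -> step k (refl r i) (refl r j).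
Proof. rewrite /step /refl /=; lia. Qed.

Lemma reflK r i : refl r (refl r i) = i.
Proof. by case: i => x y; rewrite /refl /= subKr. Qed.

Definition upcross k (a b y1 y2 bot B top : int) (z : config) : Prop :=
  exists g L s, [/\ walk k (fun i => rect a b bot B i && z i) g L,
    (g 0%N).1 = a /\ y1 <= (g 0%N).2 <= y2, (g L).1 = b, (s <= L)%N & top <= (g s).2].

Lemma depends_upcross k a b y1 y2 bot B top :
  depends_on (rect a b bot B) (upcross k a b y1 y2 bot B top).
Proof.
move=> z z' zz [g [L [s [[H1 H2] ? ? ? ?]]]]; exists g, L, s; split=> //; split=> // t /H2.
by case/andP=> r zt; rewrite r /= -zz.
Qed.

Lemma increasing_upcross k a b y1 y2 bot B top :
  increasing (upcross k a b y1 y2 bot B top).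
Proof.
move=> z z' zz [g [L [s [H ? ? ? ?]]]]; exists g, L, s; split=> //.
by apply: walk_mono H => i /andP [-> /zz].
Qed.

(** The reflected crossing starts above the first one and stays below [r - bot], hence below [top],
    a height that the first one reaches. So the two touch, and their union climbs from [r - top] to
    [top]. *)
Lemma upcross_refl k a b y1 y2 bot B top r d z : y2 *+ 2 + 2 <= r ->
  r < bot + top -> r - top <= d -> d <= top ->
  upcross k a b y1 y2 bot B top z ->
  upcross k a b y1 y2 bot B top (fun i => z (refl r i)) ->
  vcross k None a b (r - top) d z.
Proof.
move=> yr rbt rd dt [g [L [s [Hg [g0 gy] gL sL gs]]]] [h [M [t [Hh [h0 hy] hM tM ht]]]].
pose f t := refl r (h t).
have Hf : walk k (fun i => rect a b (r - B) (r - bot) i && z i) f M.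
  split=> q qM; first exact/step_refl_row/Hh.1.
  have := Hh.2 q qM; rewrite /f /rect => /andP [H ->]; rewrite andbT.
  by move: H; rewrite /refl /=; lia.
have Hg' : walk k (fun i => rect a b bot B i && z i) g s.
  by split=> q qs; [apply: Hg.1; lia | apply: Hg.2; lia].
have [q qs|q qM||p [q [ps qM pq]]] := @above_touch k a b (r - B) g s f M
  (walk_mono (fun _ _ => isT) Hg') (walk_mono (fun _ _ => isT) Hf) g0 h0 hM.
- by have := Hg'.2 q qs; rewrite /rect; lia.
- by have := Hf.2 q qM; rewrite /rect; split; lia.
- by rewrite /f /refl /=; lia.
pose S i := (a <= i.1 <= b) && z i.
have HS x y i : rect a b x y i && z i -> S i.
  by rewrite /S /rect => /andP [/andP [-> _] ->].
have c1 := walk_conn (walk_mono (@HS _ _) Hg') (leqnn s) ps.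
have c2 := walk_conn (walk_mono (@HS _ _) Hf) qM tM.
apply: (conn_vcross (conn_sym (conn_step c1 c2 pq))) => //; last by lia.
by rewrite /f /refl /=; lia.
Qed.

Lemma int_argmax (f : nat -> int) (L : nat) :
  exists2 s, (s <= L)%N & forall r, (r <= L)%N -> f r <= f s.
Proof.
elim: L => [|L [s sL Hs]]; first by exists 0%N => // r; rewrite leqn0 => /eqP ->.
case: (leP (f s) (f L.+1)) => H.
  exists L.+1 => // r; rewrite leq_eqVlt => /orP [/eqP -> //|rL].
  by apply: le_trans H; apply: Hs.
exists s; first by lia.
by move=> r; rewrite leq_eqVlt => /orP [/eqP -> |rL]; [exact: ltW | exact: Hs].
Qed.

Lemma cell_exists (x : int) (g : nat) : 0 <= x -> (0 < g)%N ->
  exists j, (j * g)%N%:Z <= x < (j * g)%N%:Z + g%:Z.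
Proof.
move=> x0 g0; exists (`|x| %/ g)%N.
have := divn_eq `|x| g; have := ltn_pmod `|x| g0; lia.
Qed.

(** * Extreme heights of crossings of a strip *)

Section Tame.
Variables (k : bool) (a : int) (g J B : nat).

(** Heights are rounded to cells of size [g]: the start lies in cell [i1], and [i2], [i3] stand for
    the cells of the minimum and the maximum. The inequalities are what [upcross_refl] needs for the
    reflection [r = 2 * (i1 * g + g)] to produce a vertical crossing of height [t + g]. *)
Definition drift (t : nat) (z : config) (i1 i2 i3 : nat) : Prop :=
  [/\ (2 * (i1 * g) + 2 * g < i3 * g + i2 * g)%N,
      (t + g + 2 * (i1 * g + g) <= 2 * (i3 * g))%N &
      upcross k a (a + t%:Z) (i1 * g)%N%:Z ((i1 * g)%N%:Z + g%:Z - 1) (i2 * g)%N%:Z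
        B%:Z (i3 * g)%N%:Z z].

Definition drifts (t : nat) (z : config) : Prop :=
  exists2 i1, (i1 < J)%N & exists2 i2, (i2 < J)%N & exists2 i3, (i3 < J)%N &
    drift t z i1 i2 i3.

(** The behaviours that become improbable with long crossings: too tall for the width, too flat,
    drifting upwards or downwards. *)
Definition wild (t : nat) (z : config) : Prop :=
  (exists2 j, (j < J)%N & vcross k None a (a + t%:Z) (j * g)%N%:Z
    ((j * g)%N%:Z + (t + g)%N%:Z) z) \/
  ((exists2 j, (j < J)%N & hcross k None a (a + t%:Z) (j * g)%N%:Z
    ((j * g)%N%:Z + (t - g)%N%:Z) z) \/
  (drifts t z \/ drifts t (fun i => z (refl B%:Z i)))).

Hypotheses (g_gt0 : (0 < g)%N) (BJ : (B + 2 * g <= J * g)%N).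

Let lt_cells j : (j * g < J * g)%N -> (j < J)%N.
Proof. by rewrite ltn_mul2r => /andP []. Qed.

(** A larger range would contain a vertical crossing of height [t + g], a smaller one would fit in
    height [t - g]; the second [g] is lost in rounding to cells. *)
Lemma tame_range t z f L s1 s2 : (g <= t)%N -> ~ wild t z ->
  walk k (fun i => rect a (a + t%:Z) 0 B%:Z i && z i) f L ->
  (f 0%N).1 = a -> (f L).1 = a + t%:Z -> (s1 <= L)%N -> (s2 <= L)%N ->
  (forall r, (r <= L)%N -> (f r).2 <= (f s1).2) ->
  (forall r, (r <= L)%N -> (f s2).2 <= (f r).2) ->
  t%:Z - 2 * g%:Z < (f s1).2 - (f s2).2 < t%:Z + 2 * g%:Z.
Proof.
move=> gt tame Hf f0 fL s1L s2L top bot.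
have row r : (r <= L)%N -> 0 <= (f r).2 <= B%:Z.
  by move=> /Hf.2 /andP [/andP [_ ->]].
have r1 := row _ s1L; have r2 := row _ s2L; have tb := top _ s2L.
apply/andP; split; rewrite ltNge; apply/negP => H; apply: tame.
  right; left; have [|j jb] := @cell_exists (f s2).2 g _ g_gt0; first by lia.
  exists j; first by apply: lt_cells; lia.
  exists f, L; split=> //; split=> [|r rL]; first exact: Hf.1.
  have := top r rL; have := bot r rL; have := Hf.2 r rL.
  by move=> /andP [ri ->]; rewrite andbT; move: ri; rewrite /rect; lia.
left; have [|j jb] := @cell_exists ((f s2).2 + g%:Z - 1) g _ g_gt0; first by lia.
exists j; first by apply: lt_cells; lia.
apply: (walk_vcross (s := s2) (t := s1) Hf) => //; try lia.
by move=> i /andP [/andP [-> _] ->].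
Qed.

Lemma tame_mid t z f L s1 s2 : ~ drifts t z ->
  walk k (fun i => rect a (a + t%:Z) 0 B%:Z i && z i) f L ->
  (f 0%N).1 = a -> (f L).1 = a + t%:Z -> (s1 <= L)%N -> (s2 <= L)%N ->
  (forall r, (r <= L)%N -> (f s2).2 <= (f r).2) ->
  t%:Z - 2 * g%:Z < (f s1).2 - (f s2).2 ->
  (f s1).2 + (f s2).2 <= 2 * (f 0%N).2 + 8 * g%:Z.
Proof.
move=> tame Hf f0 fL s1L s2L bot rng.
have row r : (r <= L)%N -> 0 <= (f r).2 <= B%:Z.
  by move=> /Hf.2 /andP [/andP [_ ->]].
have r1 := row _ s1L; have r2 := row _ s2L; have r0 := row _ (leq0n L).
rewrite leNgt; apply/negP => H; apply: tame.
have [|i1 H1] := @cell_exists (f 0%N).2 g _ g_gt0; first by lia.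
have [|i2 H2] := @cell_exists (f s2).2 g _ g_gt0; first by lia.
have [|i3 H3] := @cell_exists (f s1).2 g _ g_gt0; first by lia.
exists i1; first by apply: lt_cells; lia.
exists i2; first by apply: lt_cells; lia.
exists i3; first by apply: lt_cells; lia.
split; [lia | lia |].
exists f, L, s1; split=> //; try lia.
split=> [|r rL]; first exact: Hf.1.
have := bot r rL; have := Hf.2 r rL.
by move=> /andP [ri ->]; rewrite andbT; move: ri; rewrite /rect; lia.
Qed.

(** The drift bound, for the crossing and for its reflection, ties the middle of the range to the
    starting height; together with the size of the range this locates both extremes up to
    [5 * g]. *)
Lemma tame_crossing t z f L : (2 * g <= t)%N -> ~ wild t z ->
  walk k (fun i => rect a (a + t%:Z) 0 B%:Z i && z i) f L ->
  (f 0%N).1 = a -> (f L).1 = a + t%:Z ->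
  exists s1 s2, [/\ (s1 <= L)%N, (s2 <= L)%N,
    forall r, (r <= L)%N -> (f s2).2 <= (f r).2 <= (f s1).2,
    `|2 * (f s1).2 - 2 * (f 0%N).2 - t%:Z| <= 10 * g%:Z &
    `|2 * (f s2).2 - 2 * (f 0%N).2 + t%:Z| <= 10 * g%:Z].
Proof.
move=> gt tame Hf f0 fL.
have [s1 s1L top] := int_argmax (fun r => (f r).2) L.
have [s2 s2L bot] := int_argmax (fun r => - (f r).2) L.
have {}bot r : (r <= L)%N -> (f s2).2 <= (f r).2 by move=> /bot; lia.
have gt' : (g <= t)%N by lia.
have rng := tame_range gt' tame Hf f0 fL s1L s2L top bot.
have rng1 : t%:Z - 2 * g%:Z < (f s1).2 - (f s2).2 by lia.
have td : ~ drifts t z by move=> H; apply: tame; right; right; left.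
have td' : ~ drifts t (fun i => z (refl B%:Z i)).
  by move=> H; apply: tame; right; right; right.
have m1 := tame_mid td Hf f0 fL s1L s2L bot rng1.
have Hf' : walk k (fun i => rect a (a + t%:Z) 0 B%:Z i && z (refl B%:Z i))
    (fun r => refl B%:Z (f r)) L.
  split=> r rL; first exact/step_refl_row/Hf.1.
  have := Hf.2 r rL; rewrite reflK => /andP [ri ->]; rewrite andbT.
  by move: ri; rewrite /rect /refl /=; lia.
have m2 : (B%:Z - (f s2).2) + (B%:Z - (f s1).2) <= 2 * (B%:Z - (f 0%N).2) + 8 * g%:Z.
  apply: (tame_mid td' Hf' f0 fL s2L s1L) => [r rL|] /=; last by lia.
  by have := top r rL; lia.
exists s1, s2; split=> //.
- by move=> r rL; rewrite top // bot.
- by lia.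
- by lia.
Qed.

End Tame.

(** For [i <= 72] these increase by [21 * g] up to [2 * n], and an increment of [21 * g] exceeds
    twice the error [10 * g] of [tame_crossing]. As [48 * 63 = 2 * 72 * 21], a mesh with
    [48 * 63 * g <= n] keeps all of them at least [3 * n / 2]. *)
Definition width (n g i : nat) : nat := (2 * n - (72 - i) * (21 * g))%N.

(* Enlarging the strip by [21 g] raises the maximum and lowers the minimum of the path,
   so between two consecutive widths the path makes a vertical crossing. *)
Lemma oscillation k a n g J B l z f L :
  (0 < g)%N -> ((48 * 63) * g <= n)%N -> (B + 2 * g <= J * g)%N ->
  (forall i, (i <= 72)%N -> ~ wild k a g J B (width n g i) z) ->
  walk k (fun i => rect a (a + (2 * n)%N%:Z) 0 B%:Z i && z i) f L ->
  (f 0%N).1 = a -> (f L).1 = a + (2 * n)%N%:Z -> (L < 72 * l)%N ->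
  exists2 j, (j < J)%N &
    vcross k (Some l) a (a + (2 * n)%N%:Z) (j * g)%N%:Z ((j * g)%N%:Z + n%:Z) z.
Proof.
move=> g0 gn BJ tame Hf f0 fL Ll.
have HT i : exists T, (i <= 72)%N -> [/\ (T <= L)%N, (f T).1 = a + (width n g i)%:Z &
    forall q, (q < T)%N -> (f q).1 < a + (width n g i)%:Z].
  case: (leqP i 72) => i72; last by exists 0%N.
  have [|r rL|||T [TL ET HT]] :=
    @int_ivt_first (fun r => (f r).1) 0 L (a + (width n g i)%:Z); rewrite ?f0 ?fL //.
  - by apply: step_cols (Hf.1 r _); lia.
  - by rewrite /width; lia.
  - by rewrite /width; lia.
  - by exists T => _; split; [lia | exact: ET | move=> q qT; apply: HT; lia].
have {HT} [T HT] := boolp.choice HT.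
have wS i : (i < 72)%N -> (width n g i.+1)%:Z = (width n g i)%:Z + 21 * g%:Z.
  move=> i72; have := leq_mul (leq_subr i 72) (leqnn (21 * g)).
  rewrite /width (_ : (72 - i = (72 - i.+1).+1)%N); last by lia.
  by rewrite mulSn; lia.
have wn i : (i <= 72)%N -> 3 * n%:Z <= 2 * (width n g i)%:Z.
  by move=> i72; have := leq_mul (leq_subr i 72) (leqnn (21 * g)); rewrite /width; lia.
have TT i : (i < 72)%N -> (T i < T i.+1)%N.
  move=> i72; have [_ E1 H1] := HT i (ltnW i72); have [_ E2 H2] := HT i.+1 i72.
  have := wS i i72; rewrite ltnNge => ?; apply/negP; rewrite leq_eqVlt.
  by case/orP => [/eqP H|/H1]; [rewrite H in E2 |]; lia.
(* There are 72 intervals between successive hitting times and fewer than [72 * l] steps, so one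
   interval lasts at most [l]. *)
have [i i72 Ti] : exists2 i, (i < 72)%N & (T i.+1 <= T i + l)%N.
  apply: contrapT => H.
  have Tl i : (i <= 72)%N -> (i * l <= T i)%N.
    elim: i => // i IH i72; have := IH (ltnW i72).
    case: (leqP (T i.+1) (T i + l)) => Ti; last by lia.
    by case: H; exists i.
  have := Tl 72 (leqnn _); have [] := HT 72 (leqnn _); lia.
have sub j : (j <= 72)%N ->
    walk k (fun i => rect a (a + (width n g j)%:Z) 0 B%:Z i && z i) f (T j).
  move=> j72; have [TL E H] := HT j j72; split=> t tT; first by apply: Hf.1; lia.
  have := Hf.2 t ltac:(lia) => /andP [r ->]; rewrite andbT.
  move: tT; rewrite leq_eqVlt => /orP [/eqP tT|/H tT]; first by move: r; rewrite tT /rect; lia.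
  by move: r; rewrite /rect; lia.
have cr j : (j <= 72)%N -> exists s1 s2, [/\ (s1 <= T j)%N, (s2 <= T j)%N,
    forall r, (r <= T j)%N -> (f s2).2 <= (f r).2 <= (f s1).2,
    `|2 * (f s1).2 - 2 * (f 0%N).2 - (width n g j)%:Z| <= 10 * g%:Z &
    `|2 * (f s2).2 - 2 * (f 0%N).2 + (width n g j)%:Z| <= 10 * g%:Z].
  move=> j72; have [_ E _] := HT j j72.
  apply: (tame_crossing g0 BJ _ (tame j j72) (sub j j72) f0 E).
  by have := wn j j72; lia.
have [s1 [s2 [s1T s2T H12 m1 m2]]] := cr i (ltnW i72).
have [t1 [t2 [t1T t2T _ n1 n2]]] := cr i.+1 i72.
have wi := wS i i72; have wni := wn i.+1 i72.
have [TL _ _] := HT i.+1 i72.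
(* Twice the new maximum exceeds twice the old one by at least [21 * g - 20 * g], so it is attained
   after [T i]; the minimum is treated alike. *)
have lt1 : (T i < t1)%N by rewrite ltnNge; apply/negP => /H12; lia.
have lt2 : (T i < t2)%N by rewrite ltnNge; apply/negP => /H12; lia.
have row r : (r <= L)%N -> 0 <= (f r).2 <= B%:Z.
  by move=> /Hf.2 /andP [/andP [_ ->]].
have r1 := row t1 ltac:(lia); have r2 := row t2 ltac:(lia).
have [|j jb] := @cell_exists ((f t2).2 + g%:Z - 1) g _ g0; first by lia.
exists j.
  have : (j * g < J * g)%N by lia.
  by rewrite ltn_mul2r => /andP [].
apply: (walk_vcross (s := t2) (t := t1) Hf) => //=; try lia.
by move=> q /andP [/andP [-> _] ->].
Qed.

(** A shortest crossing repeats no site, since a loop could be cut out, so its number of sites is at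
    most that of the rectangle. *)
Lemma hcross_short k (m n : nat) z : hcross k None 0 m%:Z 0 n%:Z z ->
  hcross k (Some (m.+1 * n.+1)%N) 0 m%:Z 0 n%:Z z.
Proof.
pose S i := rect 0 m%:Z 0 n%:Z i && z i.
move=> [g [L [Hg _ g0 gL]]].
have exL : exists L, `[< exists g, [/\ walk k S g L, (g 0%N).1 = 0 & (g L).1 = m%:Z] >].
  by exists L; apply/asboolP; exists g.
case: (ex_minnP exL) => {g Hg g0 gL L} L /asboolP [g [Hg g0 gL]] Lmin.
exists g, L; split=> //=.
have inj s t : (s < t)%N -> (t <= L)%N -> g s != g t.
  move=> st tL; apply/eqP => E.
  have : (L <= s + (L - t))%N; last by lia.
  apply: Lmin; apply/asboolP.
  exists (fun r => if (r <= s)%N then g r else g (r - s + t)%N); split=> //.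
    split=> r rL; last by case: leqP => rs; apply: Hg.2; lia.
    case: (ltngtP r s) => rs.
    - by apply: Hg.1; lia.
    - rewrite (_ : (r.+1 - s + t = (r - s + t).+1)%N); last by lia.
      by apply: Hg.1; lia.
    - by rewrite rs E subSnn add1n; apply: Hg.1; lia.
  case: leqP => H; last by rewrite (_ : (s + (L - t) - s + t = L)%N) //; lia.
  have Et : t = L by lia.
  by rewrite Et subnn addn0 E Et.
have Hin (r : 'I_L.+1) : (`|(g r).1| < m.+1)%N /\ (`|(g r).2| < n.+1)%N.
  have := Hg.2 r (ltn_ord r).
  by rewrite /S /rect; lia.
pose F (r : 'I_L.+1) : 'I_m.+1 * 'I_n.+1 := (Ordinal (Hin r).1, Ordinal (Hin r).2).
have Finj : injective F.
  move=> r r' /(congr1 (fun p => (val p.1, val p.2))) [E1 E2].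
  have E : g r = g r'.
    have := Hg.2 r (ltn_ord r).
    have := Hg.2 r' (ltn_ord r').
    rewrite /S /rect; move: (g r) (g r') E1 E2 => [x y] [x' y'] /= E1 E2 H1 H2.
    by congr pair; lia.
  apply/val_inj/eqP; case: (ltngtP (val r) (val r')) => // H.
  - by have := inj _ _ H (ltn_ord r'); rewrite E eqxx.
  - by have := inj _ _ H (ltn_ord r); rewrite E eqxx.
by have := leq_card F Finj; rewrite card_prod !card_ord.
Qed.

Definition tends0 (R : realType) (u : nat -> R) : Prop :=
  forall eps, 0 < eps -> exists n0, forall n, (n0 <= n)%N -> u n <= eps.

(** * Probability of long crossings and of wild behaviour *)

Section RSW.
Variables (R : realType) (mu : (config -> Prop) -> R) (lawmu : rsw_law mu) (k : bool).

Let hp (m n : nat) : R := hprob mu k None m n.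

(** Every added link costs two factors: one long crossing, and one vertical crossing of the square
    where it overlaps the chain, which is at least as likely as a long crossing. *)
Lemma hprob_chain n e i :
  hp (n + e) n ^+ (2 * i).+1 <= hp (i.+1 * e + n) n.
Proof.
elim: i => [|i IH]; first by rewrite expr1 mul1n addnC.
have -> : ((2 * i.+1).+1 = (2 * i).+1 + 2)%N by lia.
have c0 := hprob_ge0 lawmu k None (n + e) n.
rewrite exprD; apply: le_trans (_ : hp (i.+1 * e + n) n * hp (n + e) n ^+ 2 <= _).
  by apply: ler_wpM2r => //; exact: exprn_ge0.
pose H1 := hcross k None 0 (i.+1 * e + n)%N%:Z 0 n%:Z.
pose H2 := vcross k None (i.+1 * e)%N%:Z ((i.+1 * e)%N%:Z + n%:Z) 0 n%:Z.
pose H3 := hcross k None (i.+1 * e)%N%:Z ((i.+1 * e)%N%:Z + (n + e)%N%:Z) 0 n%:Z.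
have m2 : mu H2 = hp n n by apply: (mu_vprob lawmu) => //; rewrite add0r.
have m3 : mu H3 = hp (n + e) n by apply: (mu_hprob lawmu) => //; rewrite add0r.
have m23 : mu H2 * mu H3 <= mu (fun z => H2 z /\ H3 z).
  apply: (law_fkg lawmu); [exact: local_vcross | exact: local_hcross |
    exact: increasing_vcross | exact: increasing_hcross].
apply: le_trans (_ : mu H1 * mu (fun z => H2 z /\ H3 z) <= _).
  apply: ler_wpM2l; first exact: hprob_ge0.
  apply: le_trans m23; rewrite m2 m3 expr2; apply: ler_wpM2r => //.
  by apply: hprob_mono => //; lia.
apply: le_trans (law_fkg lawmu _ _ _ _) _.
- exact: local_hcross.
- by apply: local_and; [exact: local_vcross | exact: local_hcross].
- exact: increasing_hcross.
- by apply: increasing_and; [exact: increasing_vcross | exact: increasing_hcross].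
apply: (law_mono lawmu).
- apply: local_and; first exact: local_hcross.
  by apply: local_and; [exact: local_vcross | exact: local_hcross].
- exact: local_hcross.
move=> z [h1 [h2 h3]].
have -> : (i.+2 * e + n)%N%:Z = (i.+1 * e)%N%:Z + (n + e)%N%:Z by lia.
by apply: hglue h1 h2 h3 _ _ _ _ _; lia.
Qed.

Lemma long_ratio (j : nat) : (0 < j)%N ->
  (exists2 K, (0 < K)%N & tends0 (fun n => hp (K * n) n)) ->
  tends0 (fun n => hp (n + n %/ j) n).
Proof.
move=> j0 [K K0 HK] eps eps0.
(* For [j <= n] one has [n <= 2 * j * (n %/ j)], so this many links of excess [n %/ j] cover the
   length [K * n]. *)
pose i := (2 * j * K)%N.
have [n0 H0] := HK (eps ^+ (2 * i).+1) (exprn_gt0 _ eps0).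
exists (maxn n0 j) => n nn.
have c0 := hprob_ge0 lawmu k None (n + n %/ j) n.
rewrite leNgt; apply/negP => lt.
have : eps ^+ (2 * i).+1 < hp (n + n %/ j) n ^+ (2 * i).+1.
  by rewrite ltrXn2r //; apply: ltW.
apply/negP; rewrite -leNgt; apply: le_trans (hprob_chain _ _ _) _.
apply: le_trans (H0 n _); last by lia.
apply: hprob_mono => //.
have nj : (n < (n %/ j).+1 * j)%N by exact: ltn_ceil.
have n1 : (1 <= n %/ j)%N by rewrite divn_gt0 //; lia.
have n2 : (n <= 2 * j * (n %/ j))%N.
  have := leq_mul (leqnn j) n1; nia.
have := leq_mul (leqnn K) n2; rewrite /i; nia.
Qed.

Lemma long_unif (j : nat) (eps : R) : (0 < j)%N ->
  (exists2 K, (0 < K)%N & tends0 (fun n => hp (K * n) n)) -> 0 < eps ->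
  exists n0, forall n m, (n0 <= n)%N -> (n <= m <= 2 * n)%N ->
    hp (m + n %/ j) m <= eps.
Proof.
move=> j0 HK eps0; have [//|n0 H0] := @long_ratio (2 * j) _ HK _ eps0; first by lia.
exists n0 => n m nn mn; apply: le_trans (H0 m _); last by lia.
apply: hprob_mono => //; rewrite leq_add2l.
by rewrite -(@divnMl 2 n j) //; apply: leq_div2r; lia.
Qed.

Lemma law_refl r E : local E -> mu (fun z => E (fun i => z (refl r i))) = mu E.
Proof.
move=> lE; rewrite -(law_flip lawmu lE).
rewrite -(law_translate lawmu (0, r) (local_flip lE)); congr mu; apply/funext => z.
by congr E; apply/funext => i; rewrite /refl /translate /flip /= addr0 addrC.
Qed.

Lemma local_refl r E : local E -> local (fun z => E (fun i => z (refl r i))).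
Proof.
by apply: local_map => N; exists (N + `|r|)%N => i; rewrite /box /rect /refl /=; lia.
Qed.

Section Wild.
Variables (a : int) (g J B t : nat) (d : R).
Hypotheses (g0 : (0 < g)%N) (gt : (g <= t)%N) (d0 : 0 <= d <= 1)
  (hp1 : hp (t + g) t <= d ^+ 2) (hp2 : hp t (t - g) <= d).

Lemma local_drift i1 i2 i3 : local (fun z => drift k a g B t z i1 i2 i3).
Proof.
apply: (@local_rect a (a + t%:Z) (i2 * g)%N%:Z B%:Z) => z z' zz [? ? H]; split=> //.
exact: depends_upcross zz H.
Qed.

Lemma local_drifts : local (fun z => drifts k a g J B t z).
Proof.
apply: local_ex => i1 _; apply: local_ex => i2 _; apply: local_ex => i3 _.
exact: local_drift.
Qed.

(** The event and its reflection have equal probability, and together they force a vertical crossing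
    of height [t + g] in width [t]. This is why the bound on long crossings is assumed with
    [d ^+ 2]. *)
Lemma mu_drift i1 i2 i3 : mu (fun z => drift k a g B t z i1 i2 i3) <= d.
Proof.
case/andP: d0 => d00 d1.
case: (boolP ((2 * (i1 * g) + 2 * g < i3 * g + i2 * g) &&
  (t + g + 2 * (i1 * g + g) <= 2 * (i3 * g)))%N) => [/andP [c1 c2]|nc]; last first.
  rewrite (_ : (fun z => _) = fun=> False); first exact: le_trans (law0 lawmu) _.
  by apply/funext => z; apply/propext; split=> // -[c1 c2 _]; move: nc; rewrite c1 c2.
set U := upcross k a (a + t%:Z) (i1 * g)%N%:Z ((i1 * g)%N%:Z + g%:Z - 1) (i2 * g)%N%:Z
  B%:Z (i3 * g)%N%:Z.
have lU : local U by exact: local_rect (@depends_upcross _ _ _ _ _ _ _ _).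
have iU : increasing U by exact: increasing_upcross.
pose r := 2 * (i1 * g)%N%:Z + 2 * g%:Z.
apply: le_trans (_ : mu U <= d); last first.
  rewrite -(@ler_pXn2r _ 2) ?nnegrE //; last exact: (law_ge0 lawmu).
  apply: le_trans hp1; rewrite expr2 -{2}(law_refl r lU).
  apply: le_trans (law_fkg lawmu lU (local_refl r lU) iU _) _.
    by move=> z z' zz; apply: iU => i /zz.
  have <- : mu (vcross k None a (a + t%:Z) (r - (i3 * g)%N%:Z)
      (r - (i3 * g)%N%:Z + (t + g)%N%:Z)) = hp (t + g) t by exact: mu_vprob.
  apply: (law_mono lawmu); [exact: local_and (local_refl _ _) | exact: local_vcross|].
  by move=> z [h1 h2]; apply: upcross_refl h1 h2; rewrite /r; lia.
apply: (law_mono lawmu) => //; first exact: local_drift.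
by move=> z [].
Qed.

Lemma mu_drifts : mu (fun z => drifts k a g J B t z) <= J%:R ^+ 3 * d.
Proof.
rewrite !exprS expr0 mulr1 -!mulrA.
apply: (mu_ex lawmu) => i1 _.
  by apply: local_ex => i2 _; apply: local_ex => i3 _; exact: local_drift.
apply: (mu_ex lawmu) => i2 _; first by apply: local_ex => i3 _; exact: local_drift.
apply: (mu_ex lawmu) => i3 _; [exact: local_drift | exact: mu_drift].
Qed.

Lemma local_wild : local (fun z => wild k a g J B t z).
Proof.
apply: local_or; first by apply: local_ex => j _; exact: local_vcross.
apply: local_or; first by apply: local_ex => j _; exact: local_hcross.
by apply: local_or; [exact: local_drifts | apply: local_refl; exact: local_drifts].
Qed.

Lemma mu_wild : mu (fun z => wild k a g J B t z) <= (2 * J%:R + 2 * J%:R ^+ 3) * d.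
Proof.
case/andP: d0 => d00 d1.
have l1 : local (fun z => exists2 j, (j < J)%N & vcross k None a (a + t%:Z) (j * g)%N%:Z
    ((j * g)%N%:Z + (t + g)%N%:Z) z) by apply: local_ex => j _; exact: local_vcross.
have l2 : local (fun z => exists2 j, (j < J)%N & hcross k None a (a + t%:Z) (j * g)%N%:Z
    ((j * g)%N%:Z + (t - g)%N%:Z) z) by apply: local_ex => j _; exact: local_hcross.
have l3 := local_drifts; have l4 := local_refl B%:Z l3.
have m1 := law_or lawmu l1 (local_or l2 (local_or l3 l4)).
have m2 := law_or lawmu l2 (local_or l3 l4).
have m3 := law_or lawmu l3 l4.
have e1 : mu (fun z => exists2 j, (j < J)%N & vcross k None a (a + t%:Z) (j * g)%N%:Z
    ((j * g)%N%:Z + (t + g)%N%:Z) z) <= J%:R * d.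
  apply: (mu_ex lawmu) => j _; first exact: local_vcross.
  have -> := @mu_vprob _ _ lawmu k None a (a + t%:Z) (j * g)%N%:Z
    ((j * g)%N%:Z + (t + g)%N%:Z) t (t + g) erefl erefl.
  by apply: le_trans hp1 _; rewrite expr2; apply: ler_piMl.
have e2 : mu (fun z => exists2 j, (j < J)%N & hcross k None a (a + t%:Z) (j * g)%N%:Z
    ((j * g)%N%:Z + (t - g)%N%:Z) z) <= J%:R * d.
  apply: (mu_ex lawmu) => j _; first exact: local_hcross.
  by have -> := @mu_hprob _ _ lawmu k None a (a + t%:Z) (j * g)%N%:Z
    ((j * g)%N%:Z + (t - g)%N%:Z) t (t - g) erefl erefl.
have e3 := mu_drifts.
have e4 : mu (fun z => drifts k a g J B t (fun i => z (refl B%:Z i))) <= J%:R ^+ 3 * d.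
  by rewrite (law_refl B%:Z l3).
have -> : (2 * J%:R + 2 * J%:R ^+ 3) * d =
    J%:R * d + (J%:R * d + (J%:R ^+ 3 * d + J%:R ^+ 3 * d)) by ring.
apply: le_trans m1 (lerD e1 _); apply: le_trans m2 (lerD e2 _).
exact: le_trans m3 (lerD e3 e4).
Qed.

End Wild.
End RSW.

(** Here [S %/ 6 %/ (48 * 63)] is the mesh at scale [S]: the number of cells needed for the height
    [2 * S] does not depend on [S]. *)
Lemma cell_count : exists J : nat, forall S : nat, (6 * (48 * 63) <= S)%N ->
  (2 * S + 2 * (S %/ 6 %/ (48 * 63)) <= J * (S %/ 6 %/ (48 * 63)))%N /\ (0 < S %/ 6 %/ (48 * 63))%N.
Proof. by exists (24 * (48 * 63) + 24)%N => S HS; split; lia. Qed.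

Lemma hcross_strip k ell (a b : int) (m n : nat) z : 0 <= a -> a <= b -> b <= m%:Z ->
  hcross k ell 0 m%:Z 0 n%:Z z -> hcross k ell a b 0 n%:Z z.
Proof.
move=> a0 ab bm [g [L [Hg sL g0 gL]]].
have [r rL||//||s [t [/andP [_ st] tL ga gb Hab]]] :=
  @int_sub_cross (fun r => (g r).1) 0 L a b (leq0n L).
- by apply: step_cols (Hg.1 r _).
- by rewrite g0.
- by rewrite gL.
exists (fun r => g (s + r)%N), (t - s)%N; split.
- apply: (@walk_restr k _ (fun i => rect a b 0 n%:Z i && z i)).
    by apply: walk_sub Hg _; lia.
  move=> r rt; have := Hg.2 (s + r)%N ltac:(lia) => /andP [ri ->]; rewrite andbT.
  by have := Hab (s + r)%N ltac:(lia); move: ri; rewrite /rect; lia.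
- by case: ell sL => //= l; lia.
- by rewrite addn0.
- by rewrite subnKC.
Qed.

(** * Contraction of crossing probabilities over scales *)

Section Main.
Variables (R : realType) (mu : (config -> Prop) -> R) (lawmu : rsw_law mu) (k : bool).

Let hp (m n : nat) : R := hprob mu k None m n.
Let u ell (n : nat) : R := hprob mu k ell n (2 * n).

Hypothesis long0 : exists2 K, (0 < K)%N & tends0 (fun n => hp (K * n) n).

(** With [n = S %/ 6], two strips of width [2 * n] at the left and right ends are at distance at
    least [2 * n]. Unless something wild happens, the crossing makes in each of them a vertical
    crossing of height [n] and length below [l], at one of [J] heights, and mixing bounds the joint
    probability by a square. *)
Lemma recursion : exists2 J : nat, (0 < J)%N & forall eps : R, 0 < eps ->
  exists n0, forall S l, (n0 <= S)%N ->
    u (Some (72 * l)%N) S <= (J%:R * u (Some l) (S %/ 6)) ^+ 2 + eps.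
Proof.
have [J HJ] := cell_count; exists J.
  by have [] := HJ (6 * (48 * 63))%N (leqnn _); case: J {HJ} => [|//]; lia.
move=> eps eps0.
pose C : R := 73%:R * (2 * J%:R + 2 * J%:R ^+ 3).
have C0 : 0 <= C.
  by rewrite /C mulr_ge0 ?addr_ge0 ?mulr_ge0 ?exprn_ge0 ?ler0n.
pose d := Num.min 1 (eps / 4 / (C + 1)).
have d0 : 0 < d.
  by rewrite /d lt_min ltr01 /= divr_gt0 ?divr_gt0 ?ltr0n //; lra.
have d1 : d <= 1 by rewrite /d ge_min lexx.
have Cd : C * d <= eps / 4.
  have : d <= eps / 4 / (C + 1) by rewrite /d ge_min lexx orbT.
  rewrite ler_pdivlMr; last by lra.
  by rewrite mulrC mulrDl mul1r; lra.
have [n1 Hn1] := @long_unif _ _ lawmu k (48 * 63)%N (d ^+ 2) isT long0 (exprn_gt0 _ d0).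
have eps2 : 0 < eps / 2 by rewrite divr_gt0 ?ltr0n.
(* Boxes of side [(J + 20) * n] have room for a strip of width [2 * n] and for heights up to
   [J * g + n]; they extend away from each other, so the gap between the strips is the gap between
   the boxes. *)
have [n2 Hn2] := law_mix lawmu (J + 20) eps2.
exists (6 * (n1 + n2 + (48 * 63)))%N => S l HS.
have [HJ1 g0] := HJ S ltac:(lia).
set n := (S %/ 6)%N in HJ1 g0 *; set g := (n %/ (48 * 63))%N in HJ1 g0.
have En : (6 * n <= S < 6 * n + 6)%N by rewrite /n; lia.
have Eg : ((48 * 63) * g <= n)%N by rewrite /g; lia.
have nS : (2 * n <= S)%N by lia.
have n2n : (n1 <= n)%N /\ (n2 <= n)%N by lia.
have long_n m : (n <= m <= 2 * n)%N -> hp (m + g) m <= d ^+ 2 by apply: Hn1; case: n2n.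
clearbody g; clearbody n.
pose B := (2 * S)%N.
pose w i := width n g i.
have wi i : (i < 73)%N -> (3 * n <= 2 * w i)%N /\ (w i <= 2 * n)%N.
  by move=> i72; have := leq_mul (leq_subr i 72) (leqnn (21 * g)); rewrite /w /width;
    split; [lia | exact: leq_subr].
pose W a z := exists2 i, (i < 73)%N & wild k a g J B (w i) z.
have lW a : local (W a) by apply: local_ex => i _; exact: local_wild.
have mW a : mu (W a) <= eps / 4.
  apply: le_trans Cd; rewrite /C -mulrA; apply: (mu_ex lawmu) => i i72.
    exact: local_wild.
  have [w1 w2] := wi i i72.
  have h1 : hp (w i + g) (w i) <= d ^+ 2 by apply: long_n; lia.
  have h2 : hp (w i) (w i - g) <= d.
    have := long_n (w i - g)%N ltac:(lia).
    rewrite subnK; last by lia.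
    by move/le_trans; apply; rewrite expr2 ler_piMl // ltW.
  by apply: (mu_wild lawmu) h1 h2; [exact: g0 | lia | rewrite (ltW d0) d1].
pose V a z := exists2 j, (j < J)%N &
  vcross k (Some l) a (a + (2 * n)%N%:Z) (j * g)%N%:Z ((j * g)%N%:Z + n%:Z) z.
have lV a : local (V a) by apply: local_ex => j _; exact: local_vcross.
have mV a : mu (V a) <= J%:R * u (Some l) n.
  apply: (mu_ex lawmu) => j _; first exact: local_vcross.
  by rewrite (@mu_vprob _ _ lawmu k _ a (a + (2 * n)%N%:Z) (j * g)%N%:Z
    ((j * g)%N%:Z + n%:Z) (2 * n) n erefl erefl).
have u0 : 0 <= u (Some l) n by exact: hprob_ge0.
pose c := S%:Z - (2 * n)%N%:Z.
have dV a x : x <= a -> a + (2 * n)%N%:Z <= x + ((J + 20) * n)%N%:Z ->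
    depends_on (rect x (x + ((J + 20) * n)%N%:Z) 0 (0 + ((J + 20) * n)%N%:Z)) (V a).
  move=> xa ax z z' zz [j jJ Hj]; exists j => //; apply: depends_vcross Hj => i ri.
  apply: zz; move: ri; rewrite /rect.
  have : (j * g <= J * n)%N by apply: leq_mul; [exact: ltnW | lia].
  by rewrite mulnDl; lia.
have mix : mu (fun z => V 0 z /\ V c z) <= (J%:R * u (Some l) n) ^+ 2 + eps / 2.
  apply: le_trans (Hn2 n n2n.2 ((2 * n)%N%:Z - ((J + 20) * n)%N%:Z) 0 c 0 _ _ _ _ _) _.
  - by apply: dV; rewrite mulnDl; lia.
  - by apply: dV; rewrite ?mulnDl; lia.
  - by rewrite /c; lia.
  rewrite lerD2r expr2; apply: ler_pM => //; exact: (law_ge0 lawmu).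
have sub z : hcross k (Some (72 * l)%N) 0 S%:Z 0 (2 * S)%N%:Z z ->
    (V 0 z /\ V c z) \/ (W 0 z \/ W c z).
  move=> Hz.
  case: (pselect (W 0 z)) => [|nW0]; first by right; left.
  case: (pselect (W c z)) => [|nWc]; first by right; right.
  left; split.
  - have [||| f [L [Hf sL f0 fL]]] :=
      @hcross_strip k _ 0 (0 + (2 * n)%N%:Z) S (2 * S) z _ _ _ Hz; [by [] | by rewrite add0r | by rewrite add0r lez_nat |].
    apply: (oscillation g0 Eg HJ1 _ Hf f0 fL sL) => i i72 Hw.
    by apply: nW0; exists i.
  - have [||| f [L [Hf sL f0 fL]]] :=
      @hcross_strip k _ c (c + (2 * n)%N%:Z) S (2 * S) z _ _ _ Hz;
      [by rewrite subr_ge0 lez_nat | by rewrite lerDl | by rewrite subrK |].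
    apply: (oscillation g0 Eg HJ1 _ Hf f0 fL sL) => i i72 Hw.
    by apply: nWc; exists i.
have lVV : local (fun z => V 0 z /\ V c z) by exact: local_and.
have lWW : local (fun z => W 0 z \/ W c z) by exact: local_or.
apply: le_trans (law_mono lawmu (local_hcross _ _ _ _ _ _) (local_or lVV lWW) sub) _.
apply: le_trans (law_or lawmu lVV lWW) _.
have := law_or lawmu (lW 0) (lW c); have := mW 0; have := mW c; have := mix.
by lra.
Qed.

Lemma square_cross0 : tends0 (u None).
Proof.
have [J J0 HJ] := recursion.
(* For [q <= 1 / (2 * J ^ 2)] the bound [q] reproduces itself with error [q / 2]. At [i = 0] it
   holds because a walk of fewer than one step does not cross. *)
have small (q : R) : 0 < q -> q <= (2 * J%:R ^+ 2)^-1 -> exists2 n1, (0 < n1)%N &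
    forall i S, (6 ^ i * n1 <= S)%N -> u (Some (72 ^ i)%N) S <= q.
  move=> q0 qJ; have [n0 Hn0] := HJ (q / 2) ltac:(by rewrite divr_gt0 ?ltr0n).
  exists n0.+1 => //; elim=> [|i IH] S HS.
    rewrite /u /hprob (_ : hcross _ _ _ _ _ _ = fun=> False).
      exact: le_trans (law0 lawmu) (ltW q0).
    apply/funext => z; apply/propext; split=> // -[g [L [_ /= sL g0 gL]]].
    have L0 : L = 0%N by lia.
    by rewrite L0 g0 in gL; lia.
  rewrite expnS; apply: le_trans (Hn0 _ _ _) _.
    by apply: leq_trans HS; apply: leq_trans (leqnSn n0) (leq_pmull _ _); rewrite expn_gt0.
  have ule : u (Some (72 ^ i)%N) (S %/ 6) <= q.
    by apply: IH; rewrite leq_divRL //; apply: leq_trans HS; rewrite expnS; lia.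
  have u0 : 0 <= u (Some (72 ^ i)%N) (S %/ 6) by exact: hprob_ge0.
  have Jq : J%:R ^+ 2 * q <= 2^-1.
    have : q * (2 * J%:R ^+ 2) <= 1.
      by rewrite -ler_pdivlMr ?div1r // mulr_gt0 ?exprn_gt0 ?ltr0n.
    by rewrite (_ : q * (2 * J%:R ^+ 2) = 2 * (J%:R ^+ 2 * q)); [lra | ring].
  have : (J%:R * u (Some (72 ^ i)%N) (S %/ 6)) ^+ 2 <= J%:R ^+ 2 * q * q.
    rewrite exprMn -mulrA; apply: ler_wpM2l; first by rewrite exprn_ge0 ?ler0n.
    by rewrite expr2; apply: ler_pM.
  have : J%:R ^+ 2 * q * q <= 2^-1 * q by apply: ler_wpM2r => //; exact: ltW.
  by lra.
move=> eps eps0.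
pose q := Num.min eps (2 * J%:R ^+ 2)^-1.
have q0 : 0 < q by rewrite lt_min eps0 invr_gt0 mulr_gt0 ?exprn_gt0 ?ltr0n.
have [n1 n10 Hn1] := small q q0 ltac:(by rewrite ge_min lexx orbT).
(* The rectangle has at most [6 * S ^ 2] sites and [S < 6 ^ i.+1 * n1], hence at most
   [216 * n1 ^ 2 * 36 ^ i] of them. This is at most [72 ^ i] as soon as [I <= 2 ^ i]. *)
pose I := (216 * n1 ^ 2)%N.
exists (6 ^ I * n1)%N => S HS.
have exi : exists i, (S < 6 ^ i.+1 * n1)%N.
  exists S; apply: leq_trans (_ : 6 ^ S.+1 <= _)%N; last exact: leq_pmulr.
  by apply: ltn_trans (@ltn_expl 6 S isT) _; rewrite ltn_exp2l.
case: (ex_minnP exi) => i iS imin.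
have iS' : (6 ^ i * n1 <= S)%N.
  case: i imin iS => [|i] imin iS.
    by apply: leq_trans HS; rewrite leq_mul2r leq_exp2l // orbT.
  by rewrite leqNgt; apply/negP => /imin; rewrite ltnn.
have Ii : (I <= i)%N.
  rewrite leqNgt; apply/negP => iI.
  have : (6 ^ i.+1 * n1 <= 6 ^ I * n1)%N by rewrite leq_mul2r leq_exp2l // iI orbT.
  lia.
apply: le_trans (_ : q <= eps); last by rewrite ge_min lexx.
apply: le_trans (Hn1 i S iS').
apply: (law_mono lawmu); try exact: local_hcross.
move=> z /hcross_short [g [L [Hg /= sL g0 gL]]]; exists g, L; split=> //=.
apply: leq_trans sL _.
have Hi : (I <= 2 ^ i)%N by apply: leq_trans Ii _; exact/ltnW/(@ltn_expl 2).
have S1 : (1 <= S)%N by apply: leq_trans HS; rewrite muln_gt0 expn_gt0.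
apply: leq_trans (_ : 6 * S ^ 2 <= _)%N; first by rewrite expnS expn1; nia.
have SS : (S ^ 2 <= (6 ^ i.+1 * n1) ^ 2)%N by rewrite leq_sqr ltnW.
apply: leq_trans (_ : 2 ^ i * (36 ^ i) <= _)%N; last by rewrite -expnMn.
have -> : (36 ^ i = (6 ^ i) ^ 2)%N by rewrite -expnM mulnC expnM.
apply: leq_trans (_ : I * (6 ^ i) ^ 2 <= _)%N; last by rewrite leq_mul2r Hi orbT.
move: SS; rewrite (expnS 6 i) !expnMn (_ : 6 ^ 2 = 36)%N // /I; lia.
Qed.

(** Measured from its lowest point, a crossing either fits in one of [K.+1] windows of height
    [2 * n], or makes a vertical crossing of an [n] by [n] square; each of these events has
    probability at most [u None n]. *)
Theorem rsw (K : nat) : tends0 (fun n => hp n (K * n)).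
Proof.
move=> eps eps0.
have [n0 Hn0] := square_cross0 (divr_gt0 eps0 (ltr0Sn _ (2 * K + 1))).
exists n0.+1 => n nn.
have {Hn0} un := Hn0 n (ltnW nn).
pose E1 z := exists2 j, (j < K.+1)%N &
  hcross k None 0 n%:Z (j * n)%N%:Z ((j * n)%N%:Z + (2 * n)%N%:Z) z.
pose E2 z := exists2 j, (j < K.+1)%N &
  vcross k None 0 n%:Z (j.+1 * n)%N%:Z ((j.+1 * n)%N%:Z + n%:Z) z.
have l1 : local E1 by apply: local_ex => j _; exact: local_hcross.
have l2 : local E2 by apply: local_ex => j _; exact: local_vcross.
have m1 : mu E1 <= K.+1%:R * u None n.
  apply: (mu_ex lawmu) => j _; first exact: local_hcross.
  by rewrite (@mu_hprob _ _ lawmu k _ _ _ _ _ n (2 * n)) // add0r.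
have m2 : mu E2 <= K.+1%:R * u None n.
  apply: (mu_ex lawmu) => j _; first exact: local_vcross.
  rewrite (@mu_vprob _ _ lawmu k _ _ _ _ _ n n) // ?add0r //.
  by apply: hprob_mono => //; lia.
have sub z : hcross k None 0 n%:Z 0 (K * n)%N%:Z z -> E1 z \/ E2 z.
  move=> [g [L [Hg _ g0 gL]]].
  have [s1 s1L top] := int_argmax (fun r => (g r).2) L.
  have [s2 s2L bot] := int_argmax (fun r => - (g r).2) L.
  have := Hg.2 s2 s2L => /andP [/andP [_ r2] _].
  have [|j jb] := @cell_exists (g s2).2 n _ (leq_ltn_trans (leq0n _) nn); first by lia.
  have jK : (j < K.+1)%N.
    have : (j * n <= K * n)%N by lia.
    by rewrite leq_mul2r ltnS => /orP [/eqP n00|//]; rewrite n00 in nn.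
  case: (leP (g s1).2 ((j * n)%N%:Z + (2 * n)%N%:Z)) => H.
    left; exists j => //; exists g, L; split=> //; split=> [|r rL]; first exact: Hg.1.
    have := top r rL; have := bot r rL; have := Hg.2 r rL.
    by move=> /andP [ri ->]; rewrite andbT; move: ri; rewrite /rect; lia.
  right; exists j => //; apply: (walk_vcross (s := s2) (t := s1) Hg) => //; try lia.
  by move=> i /andP [/andP [-> _] ->].
apply: le_trans (law_mono lawmu (local_hcross _ _ _ _ _ _) (local_or l1 l2) sub) _.
apply: le_trans (law_or lawmu l1 l2) _.
apply: le_trans (lerD m1 m2) _; rewrite -mulrDl -natrD.
rewrite (_ : (K.+1 + K.+1 = (2 * K + 1).+1)%N); last by lia.
by rewrite mulrC -ler_pdivlMr ?ltr0n.
Qed.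

End Main.

(** * Positive association in finite volume *)

Section Mean.
Variables (R : realType) (I : eqType) (q : I -> R).
Hypothesis q01 : forall i, 0 <= q i <= 1.

Definition upd (v : I -> bool) (j : I) (b : bool) : I -> bool :=
  fun i => if i == j then b else v i.

(** Expectation when the coordinates in [J] are drawn independently and the others are read from
    [v]; the recursive form permits induction on coordinates. *)
Fixpoint mean (J : seq I) (F : (I -> bool) -> R) (v : I -> bool) : R :=
  if J is j :: J' then
    q j * mean J' F (upd v j true) + (1 - q j) * mean J' F (upd v j false)
  else F v.

Definition only_on (A : pred I) (T : Type) (F : (I -> bool) -> T) : Prop :=
  forall v v', (forall i, A i -> v i = v' i) -> F v = F v'.

Lemma meanZ J c F v : mean J (fun v => c * F v) v = c * mean J F v.
Proof. by elim: J v => //= j J IH v; rewrite !IH; ring. Qed.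

Lemma mean_sum (K : finType) J (F : K -> (I -> bool) -> R) v :
  mean J (fun v => \sum_S F S v) v = \sum_S mean J (F S) v.
Proof.
elim: J v => //= j J IH v; rewrite !IH !mulr_sumr -big_split /=.
by apply: eq_bigr.
Qed.

Lemma ler_mean J F G v : (forall v, F v <= G v) -> mean J F v <= mean J G v.
Proof.
move=> FG; elim: J v => //= j J IH v; have := q01 j => /andP [q0 q1].
by apply: lerD; apply: ler_wpM2l => //; lra.
Qed.

Lemma mean_only J (A : pred I) F v v' : only_on A F ->
  (forall i, A i -> i \notin J -> v i = v' i) -> mean J F v = mean J F v'.
Proof.
move=> HF; elim: J v v' => [|j J IH] v v' H /=; first by apply: HF => i Ai; apply: H.
congr (_ * _ + _ * _); apply: IH => i Ai iJ; rewrite /upd; case: eqP => // /eqP ij;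
  by apply: H => //; rewrite inE negb_or ij.
Qed.

Lemma mean_upd J (A : pred I) F v j b : only_on A F -> ~~ A j ->
  mean J F (upd v j b) = mean J F v.
Proof.
move=> HF nA; apply: (mean_only (A := A)) => // i Ai _; rewrite /upd; case: eqP => // ij.
by rewrite -ij Ai in nA.
Qed.

Lemma mean_prod J (A B : pred I) F G v : only_on A F -> only_on B G ->
  (forall i, ~~ (A i && B i)) ->
  mean J (fun v => F v * G v) v = mean J F v * mean J G v.
Proof.
move=> HF HG AB; elim: J v => //= j J IH v; rewrite !IH.
have := AB j; rewrite negb_and => /orP [nA|nB].
  by rewrite !(mean_upd _ _ _ HF nA); ring.
by rewrite !(mean_upd _ _ _ HG nB); ring.
Qed.

Definition mono (F : (I -> bool) -> R) : Prop :=
  forall v v' : I -> bool, (forall i, v i -> v' i) -> F v <= F v'.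

Lemma mono_mean J F : mono F -> mono (mean J F).
Proof.
move=> HF; elim: J => //= j J IH v v' vv; have := q01 j => /andP [q0 q1].
apply: lerD; apply: ler_wpM2l => //; try lra; apply: IH => i;
  by rewrite /upd; case: eqP => // _; apply: vv.
Qed.

(** Averaging over one more coordinate leaves the excess [q * (1 - q) * (a1 - a0) * (b1 - b0)],
    nonnegative because partial means remain monotone. *)
Lemma harris J F G v : mono F -> mono G ->
  mean J F v * mean J G v <= mean J (fun v => F v * G v) v.
Proof.
move=> HF HG; elim: J v => //= j J IH v; have := q01 j => /andP [q0 q1].
have le01 i : upd v j false i -> upd v j true i by rewrite /upd; case: eqP.
have a01 := mono_mean J HF le01; have b01 := mono_mean J HG le01.
move: a01 b01 (IH (upd v j true)) (IH (upd v j false)).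
move: (mean J F (upd v j true)) (mean J F (upd v j false)) => a1 a0.
move: (mean J G (upd v j true)) (mean J G (upd v j false)) => b1 b0.
move: (mean J _ (upd v j true)) (mean J _ (upd v j false)) => c1 c0 a01 b01 h1 h2.
apply: le_trans (_ : q j * (a1 * b1) + (1 - q j) * (a0 * b0) <= _); last first.
  by apply: lerD; apply: ler_wpM2l => //; lra.
rewrite -subr_ge0.
rewrite (_ : _ - _ = q j * (1 - q j) * ((a1 - a0) * (b1 - b0))); last by ring.
by apply: mulr_ge0; apply: mulr_ge0; lra.
Qed.

Lemma harris_anti J F G v : mono (fun v => - F v) -> mono (fun v => - G v) ->
  mean J F v * mean J G v <= mean J (fun v => F v * G v) v.
Proof.
move=> HF HG; have := @harris J _ _ v HF HG.
have E (H : (I -> bool) -> R) : mean J (fun v => - H v) v = - mean J H v.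
  rewrite -mulN1r -meanZ; congr mean; apply/funext => w; by rewrite mulN1r.
rewrite !E mulrNN => /le_trans; apply; apply: ler_mean => w; by rewrite mulrNN.
Qed.

End Mean.

(* [D] is a finite window and [T] its boundary: the sites that are joined to [T] inside [D]
   are the ones that the finite-volume model destroys. *)
Definition killed (D T : pred site) (x : config) (i : site) : Prop :=
  exists2 j, conn false (fun l => D l && x l) i j & T j.

(** The index [(false, i)] carries the variable [X] at [i], and [(true, i)] carries [Y]. *)
Definition sdp_fin (D T : pred site) (v : bool * site -> bool) : config :=
  fun i => (v (false, i) && ~~ `[< killed D T (fun l => v (false, l)) i >]) || v (true, i).

Section FiniteFKG.
Variables (R : realType) (q : bool * site -> R) (D T : pred site) (L : seq site).
Hypotheses (q01 : forall i, 0 <= q i <= 1) (DL : forall i, D i = (i \in L))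
  (TD : forall i, T i -> D i).

Let kill (v : bool * site -> bool) (i : site) : bool :=
  `[< killed D T (fun l => v (false, l)) i >].

(* Sites whose state does not influence the destroyed set [S]. *)
Let safe (S : pred site) (i : site) : bool :=
  [&& ~~ T i, ~~ S i & ~~ `[< exists2 j, step false i j & S j >]].

Let sdp_out (S : pred site) (v : bool * site -> bool) : config :=
  fun i => (v (false, i) && safe S i) || v (true, i).

Let killD v i : kill v i -> D i /\ v (false, i).
Proof. by move=> /asboolP [j /conn_in [/andP [-> ->] _] _]. Qed.

Let kill_step (v : bool * site -> bool) i j : D i -> v (false, i) -> kill v j -> step false i j -> kill v i.
Proof.
move=> Di vi /asboolP [l jl Tl] ij; apply/asboolP; exists l => //.
by apply: conn_step (conn_refl false _) jl ij; rewrite Di vi.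
Qed.

Let kill_T (v : bool * site -> bool) i : T i -> v (false, i) -> kill v i.
Proof.
by move=> Ti vi; apply/asboolP; exists i => //; apply: conn_refl; rewrite TD.
Qed.

(** The destroyed set can be explored from [T] by looking only at [T], at the set itself and at its
    neighbours. For the second inclusion a connecting walk is followed back from [T]: each site met
    is in [T] or next to a destroyed site, hence unsafe, so both configurations agree there. *)
Let kill_local (v v' : bool * site -> bool) : (forall i, D i -> ~~ safe (kill v) i -> v (false, i) = v' (false, i)) ->
  kill v = kill v'.
Proof.
move=> vv; apply/funext => i; apply/idP/idP.
  move=> /asboolP [j [g [M [Hg g0 gM]]] Tj]; apply/asboolP; exists j => //.
  exists g, M; split=> //; split=> [|t tM]; first exact: Hg.1.
  have /andP [Dt vt] := Hg.2 t tM; rewrite Dt -vv //.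
  rewrite /safe !negb_and !negbK; apply/or3P/Or32; apply/asboolP; exists j => //.
  by rewrite -gM; apply: walk_conn Hg _ _.
move=> /asboolP [j [g [M [Hg g0 gM]]] Tj].
suff H t : (t <= M)%N -> kill v (g (M - t)%N) by rewrite -g0 -(subnn M); apply: H.
elim: t => [|t IH] tM.
  rewrite subn0 gM; apply: kill_T => //; have := Hg.2 M (leqnn M).
  by rewrite gM => /andP [Dj vj]; rewrite vv // /safe Tj.
have /andP [Dt vt] := Hg.2 (M - t.+1)%N (leq_subr _ _).
have st : step false (g (M - t.+1)%N) (g (M - t)%N).
  by rewrite (_ : (M - t = (M - t.+1).+1)%N); [apply: Hg.1; lia | lia].
apply: (kill_step _ _ (IH (ltnW tM)) st) => //.
rewrite vv // /safe !negb_and !negbK; apply/or3P/Or33; apply/asboolP.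
by exists (g (M - t)%N); [exact: st | exact: IH (ltnW tM)].
Qed.

(** An unsafe site that is not destroyed must have [X] vacant, since otherwise it would be
    destroyed. Given the destroyed set, only [X] on safe sites and [Y] matter. *)
Let sdp_finE v i : D i -> sdp_fin D T v i = sdp_out (kill v) v i.
Proof.
move=> Di; rewrite /sdp_fin /sdp_out -/(kill v i); congr orb.
case vi : (v (false, i)) => //=; rewrite /safe.
case ki : (kill v i); first by rewrite andbF.
rewrite andTb; apply/esym/andP; split; apply/negP.
  by move=> Ti; have := kill_T Ti vi; rewrite ki.
by move=> /asboolP [j ij kj]; have := kill_step Di vi kj ij; rewrite ki.
Qed.

Let tup (v : bool * site -> bool) : (size L).-tuple bool := map_tuple (kill v) (in_tuple L).
Let pr (t : (size L).-tuple bool) : pred site := fun i => nth false t (index i L).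

Let prK v : pr (tup v) = kill v.
Proof.
apply/funext => i; rewrite /pr /=; case: (boolP (i \in L)) => iL.
  by rewrite (nth_map i) ?nth_index // index_mem.
rewrite nth_default; last by rewrite size_map leqNgt index_mem.
by apply/esym/negP => /killD []; rewrite DL (negbTE iL).
Qed.

Variables (J : seq (bool * site)) (v0 : bool * site -> bool).

Let psi (phi : config -> R) (S : pred site) : R := mean q J (fun v => phi (sdp_out S v)) v0.

Definition seen (phi : config -> R) : Prop :=
  forall z z' : config, (forall i, D i -> z i = z' i) -> phi z = phi z'.

(** Total expectation over the values [t] of the destroyed set, encoded as tuples to have a finite
    sum. That it equals [t] is decided by [X] off the safe sites, while [sdp_out] reads the
    complementary variables; by independence [psi] is the conditional expectation. *)
Let mean_kill phi : seen phi ->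
  mean q J (fun v => phi (sdp_fin D T v)) v0 = mean q J (fun v => psi phi (kill v)) v0.
Proof.
move=> Hphi.
have part (F : pred site -> (bool * site -> bool) -> R) v :
    F (kill v) v = \sum_t (tup v == t)%:R * F (pr t) v.
  rewrite (bigD1 (tup v)) //= eqxx mul1r prK big1 ?addr0 // => t.
  by rewrite eq_sym => /negbTE ->; rewrite mul0r.
transitivity (\sum_t mean q J (fun v => (tup v == t)%:R * phi (sdp_out (pr t) v)) v0).
  rewrite -mean_sum; congr mean; apply/funext => v.
  rewrite -(part (fun S v => phi (sdp_out S v))); apply: Hphi => i Di; exact: sdp_finE.
transitivity (\sum_t mean q J (fun v => (tup v == t)%:R * psi phi (pr t)) v0); last first.
  rewrite -mean_sum; congr mean; apply/funext => v.
  by rewrite -(part (fun S _ => psi phi S)).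
apply: eq_bigr => t _; rewrite -[RHS]mulr1.
pose A : pred (bool * site) := fun i => ~~ i.1 && ~~ (D i.2 && safe (pr t) i.2).
rewrite (_ : mean q J (fun v => (tup v == t)%:R * psi phi (pr t)) v0 * 1 =
  mean q J (fun v => (tup v == t)%:R) v0 * psi phi (pr t)); last first.
  rewrite mulr1 [RHS]mulrC -meanZ; congr mean; apply/funext => v; exact: mulrC.
apply: (@mean_prod _ _ q J A (fun i => ~~ A i)).
- move=> v v' vv; suff -> : (tup v == t) = (tup v' == t) by [].
  have H w w' : (forall i, A i -> w i = w' i) -> tup w = t -> tup w' = t.
    move=> ww wt; rewrite -wt; apply/esym; apply: val_inj => /=; congr map.
    apply: kill_local => i Di ns; apply: ww; rewrite /A /= -wt prK.
    by rewrite negb_and ns orbT.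
  apply/eqP/eqP; first exact: H.
  by apply: H => i Ai; rewrite vv.
- move=> v v' vv; apply: Hphi => i Di; rewrite /sdp_out.
  rewrite [v (true, i)]vv; last by rewrite /A.
  case sf : (safe (pr t) i); last by rewrite !andbF.
  by rewrite [v (false, i)]vv // /A /= Di sf.
- by move=> i; rewrite andbN.
Qed.

Lemma fkg_fin (phi chi : config -> R) : seen phi -> seen chi ->
  (forall z, 0 <= phi z) -> (forall z, 0 <= chi z) ->
  (forall z z' : config, (forall i, z i -> z' i) -> phi z <= phi z') ->
  (forall z z' : config, (forall i, z i -> z' i) -> chi z <= chi z') ->
  mean q J (fun v => phi (sdp_fin D T v)) v0 * mean q J (fun v => chi (sdp_fin D T v)) v0 <=
  mean q J (fun v => phi (sdp_fin D T v) * chi (sdp_fin D T v)) v0.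
Proof.
move=> sphi schi phi0 chi0 mphi mchi.
have spc : seen (fun z => phi z * chi z).
  by move=> z z' zz; rewrite (sphi _ _ zz) (schi _ _ zz).
rewrite (mean_kill sphi) (mean_kill schi) (mean_kill spc).
have mono_out (f : config -> R) S :
    (forall z z' : config, (forall i, z i -> z' i) -> f z <= f z') ->
    mono (fun v => f (sdp_out S v)).
  move=> mf v v' vv; apply: mf => i; rewrite /sdp_out.
  by case/orP => [/andP [/vv -> ->]|/vv ->] //; rewrite orbT.
have kill_mono (v v' : bool * site -> bool) : (forall i, v i -> v' i) -> forall i, kill v i -> kill v' i.
  move=> vv i /asboolP [j ij Tj]; apply/asboolP; exists j => //.
  by apply: conn_mono ij => l /andP [-> /vv].
have anti (f : config -> R) :
    (forall z z' : config, (forall i, z i -> z' i) -> f z <= f z') ->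
    mono (fun v => - psi f (kill v)).
  move=> mf v v' vv; rewrite lerN2; apply: ler_mean => // w; apply: mf => i.
  rewrite /sdp_out => /orP [/andP [-> /and3P [nT nS /asboolP nN]]|->]; last by rewrite orbT.
  rewrite /safe nT /=; have km := kill_mono _ _ vv.
  rewrite (contra (km i) nS) /=; apply/orP; left; apply/asboolP => -[j ij kj].
  by apply: nN; exists j => //; apply: km.
(* A larger destroyed set leaves fewer safe sites, so both conditional expectations decrease in the
   configuration. Harris is used for these, and then for the product measure left when the destroyed
   set is fixed. *)
apply: le_trans (harris_anti q01 _ _ (anti _ mphi) (anti _ mchi)) _.
apply: ler_mean => // v; rewrite /psi; apply: harris => //; exact: mono_out.
Qed.

End FiniteFKG.

(** * Bernoulli fields *)

Section Probability.
Context (d : measure_display) (T : measurableType d) (R : realType) (P : probability T R).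

Definition pr (A : T -> Prop) : R := fine (P A).

Definition event (A : T -> Prop) : Prop := measurable (A : set T).

Lemma prE A : event A -> P A = (pr A)%:E.
Proof. by move=> mA; rewrite /pr fineK // fin_num_measure. Qed.

Lemma eq_pr (A B : T -> Prop) : (forall w, A w <-> B w) -> pr A = pr B.
Proof. by move=> AB; congr pr; apply/funext => w; apply/propext. Qed.

Lemma eq_event (A B : T -> Prop) : (forall w, A w <-> B w) -> event A -> event B.
Proof. by move=> AB; rewrite (_ : B = A) //; apply/funext => w; apply/propext; split=> /AB. Qed.

Lemma event_not A : event A -> event (fun w => ~ A w).
Proof. exact: measurableC. Qed.

Lemma event_and A B : event A -> event B -> event (fun w => A w /\ B w).
Proof. exact: measurableI. Qed.

Lemma event_or A B : event A -> event B -> event (fun w => A w \/ B w).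
Proof. exact: measurableU. Qed.

Lemma event_const (Q : Prop) : event (fun=> Q).
Proof.
case: (pselect Q) => q.
  apply: (eq_event (A := setT)); [by split | exact: measurableT].
by apply: (eq_event (A := set0)); [split | exact: measurable0].
Qed.

Lemma event_all (A : nat -> T -> Prop) : (forall n, event (A n)) ->
  event (fun w => forall n, A n w).
Proof.
move=> H; apply: (eq_event (A := \bigcap_n A n)%classic); last exact: bigcapT_measurable.
by move=> w; split=> [h n|h n _]; apply: h.
Qed.

Lemma event_has (J : eqType) (L : seq J) (A : J -> T -> Prop) :
  (forall i, i \in L -> event (A i)) -> event (fun w => exists2 i, i \in L & A i w).
Proof.
elim: L => [|j L IH] H.
  apply: eq_event (event_const False) => w; by split=> // -[].
apply: (eq_event (A := fun w => A j w \/ exists2 i, i \in L & A i w)) => [w|].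
  split=> [[h|[i iL h]]|[i]].
  - by exists j; rewrite // mem_head.
  - by exists i; rewrite // inE iL orbT.
  - by rewrite inE => /orP [/eqP ->|iL h]; [left | right; exists i].
apply: event_or; first exact/H/mem_head.
by apply: IH => i iL; apply: H; rewrite inE iL orbT.
Qed.

Lemma pr_ge0 A : 0 <= pr A.
Proof. exact/fine_ge0/measure_ge0. Qed.

Lemma pr_le1 A : event A -> pr A <= 1.
Proof. by move=> mA; rewrite -lee_fin -prE //; apply: probability_le1. Qed.

Lemma pr_mono A B : event A -> event B -> (forall w, A w -> B w) -> pr A <= pr B.
Proof. by move=> mA mB AB; rewrite -lee_fin -!prE //; apply: le_measure; rewrite ?inE. Qed.

Lemma pr_or A B : event A -> event B -> pr (fun w => A w \/ B w) <= pr A + pr B.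
Proof.
move=> mA mB; rewrite -lee_fin EFinD -!prE //; last exact: event_or.
exact: measureU2.
Qed.

Lemma pr_split A B : event A -> event B ->
  pr A = pr (fun w => A w /\ B w) + pr (fun w => A w /\ ~ B w).
Proof.
move=> mA mB; apply/EFin_inj; rewrite EFinD -!prE //; first last.
- exact: event_and.
- exact/event_and/event_not.
by rewrite addeC; apply: measureDI.
Qed.

Lemma prT : pr (fun=> True) = 1.
Proof. by rewrite /pr (_ : (fun=> True) = setT) ?probability_setT. Qed.

Lemma pr0 : pr (fun=> False) = 0.
Proof. by rewrite /pr (_ : (fun=> False) = set0) ?measure0. Qed.

Lemma pr_not A : event A -> pr (fun w => ~ A w) = 1 - pr A.
Proof.
move=> mA; have := pr_split (event_const True) mA; rewrite prT => ->.
rewrite (eq_pr (A := fun w => True /\ A w) (B := A)) => [|w]; last by tauto.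
by rewrite (addrC (pr A)) addrK; apply: eq_pr => w; tauto.
Qed.

Lemma pr_has (J : eqType) (L : seq J) (A : J -> T -> Prop) c :
  (forall i, i \in L -> event (A i)) -> (forall i, i \in L -> pr (A i) <= c) ->
  pr (fun w => exists2 i, i \in L & A i w) <= (size L)%:R * c.
Proof.
elim: L => [|j L IH] H Hc.
  by rewrite mul0r (_ : pr _ = 0) // -pr0; apply: eq_pr => w; split=> // -[].
have mL i : i \in L -> event (A i) by move=> iL; apply: H; rewrite inE iL orbT.
rewrite (eq_pr (B := fun w => A j w \/ exists2 i, i \in L & A i w)); last first.
  move=> w; split=> [[i]|[h|[i iL h]]].
  - by rewrite inE => /orP [/eqP ->|iL h]; [left | right; exists i].
  - by exists j; rewrite // mem_head.
  - by exists i; rewrite // inE iL orbT.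
apply: le_trans (pr_or _ _) _; [exact/H/mem_head | exact: event_has |].
rewrite /= -add1n natrD mulrDl mul1r; apply: lerD; first exact/Hc/mem_head.
by apply: IH => // i iL; apply: Hc; rewrite inE iL orbT.
Qed.

Lemma pr_close A B C eps : event A -> event B -> event C -> pr C <= eps ->
  (forall w, ~ C w -> (A w <-> B w)) -> `|pr A - pr B| <= eps.
Proof.
move=> mA mB mC Ce AB; rewrite ler_norml lerBlDr lerNl opprB lerBlDr; apply/andP; split.
  apply: le_trans (pr_mono mB (event_or mC mA) _) _.
    by move=> w Bw; case: (pselect (C w)) => Cw; [left | right; apply/AB].
  by apply: le_trans (pr_or mC mA) _; apply: lerD.
apply: le_trans (pr_mono mA (event_or mC mB) _) _.
  by move=> w Bw; case: (pselect (C w)) => Cw; [left | right; apply/AB].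
by apply: le_trans (pr_or mC mB) _; apply: lerD.
Qed.

Lemma pr_tends0 (A : nat -> T -> Prop) : (forall n, event (A n)) ->
  (forall n w, A n.+1 w -> A n w) -> (forall w, exists n, ~ A n w) ->
  tends0 (fun n => pr (A n)).
Proof.
move=> mA dA eA eps e0.
have niA : nonincreasing_seq (A : nat -> set T).
  move=> m n mn; apply/subsetPset => w.
  elim: n mn => [|n IH]; first by rewrite leqn0 => /eqP ->.
  by rewrite leq_eqVlt => /orP [/eqP -> //|mn] /dA; apply: IH.
have I0 : (\bigcap_n A n = set0)%classic.
  rewrite -subset0 => w h; have [n nA] := eA w; exact/nA/h.
have := @nonincreasing_cvg_mu _ _ _ P A.
rewrite I0 measure0 => /(_ _ mA measurable0 niA) H.
have {}H : (fine (P (A n)) @[n --> \oo] --> (0 : R))%classic.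
  apply: fine_cvg; apply: H; exact: le_lt_trans (probability_le1 P (mA 0%N)) (ltry 1).
have /cvgr0Pnorm_le/(_ _ e0) [n0 _ Hn0] := H.
by exists n0 => n n0n; apply: le_trans (ler_norm _) (Hn0 n n0n).
Qed.

End Probability.

Definition indic (R : realType) (E : Prop) : R := (`[< E >])%:R.

Lemma mean_fix (R : realType) (I : eqType) (q : I -> R) (L : seq I) F (v : I -> bool) j b :
  j \notin L -> mean q L F (upd v j b) = mean q L (fun v => F (upd v j b)) v.
Proof.
elim: L v => //= i L IH v; rewrite inE negb_or => /andP [ij jL].
suff U c : upd (upd v j b) i c = upd (upd v i c) j b by rewrite !U !IH.
apply/funext => l; rewrite /upd; case: (l =P i) => [->|//].
by rewrite eq_sym (negbTE ij).
Qed.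

Section Bernoulli.
Context (d : measure_display) (T : measurableType d) (R : realType) (P : probability T R).

Lemma event_only (I : eqType) (V : T -> I -> bool) (L : seq I) (E : (I -> bool) -> Prop) :
  (forall i b, event (fun w => V w i = b)) -> only_on (fun i => i \in L) E ->
  event (fun w => E (V w)).
Proof.
move=> mV; elim: L E => [|j L IH] E HE.
  apply: eq_event (event_const T (E xpred0)) => w.
  by rewrite (HE (V w) xpred0).
have E' b : only_on (fun i => i \in L) (fun v => E (upd v j b)).
  move=> v v' vv; apply: HE => i; rewrite inE /upd; case: eqP => //= _; exact: vv.
apply: (eq_event (A := fun w => (V w j = true /\ E (upd (V w) j true)) \/
                                (V w j = false /\ E (upd (V w) j false)))) => [w|].
  have U : upd (V w) j (V w j) = V w.
    by apply/funext => i; rewrite /upd; case: eqP => // ->.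
  case: (V w j) U => -> ; split.
  - by case=> [[_ //]|[//]].
  - by left.
  - by case=> [[//]|[_ //]].
  - by right.
by apply: event_or; apply: event_and => //; apply: (IH (fun v => E (upd v j _))).
Qed.

Record bernoulli (I : eqType) (q : I -> R) (V : T -> I -> bool) : Prop := Bernoulli {
  bern_event : forall i b, event (fun w => V w i = b);
  bern_cyl : forall (L : seq I) (a : I -> bool), uniq L ->
    pr P (fun w => forall j, j \in L -> V w j = a j) =
      \prod_(j <- L) (if a j then q j else 1 - q j) }.

Section Mean.
Variables (I : eqType) (q : I -> R) (V : T -> I -> bool) (bV : bernoulli q V).

Lemma pr_mean (L : seq I) (E : (I -> bool) -> Prop) v0 : uniq L ->
  only_on (fun i => i \in L) E ->
  pr P (fun w => E (V w)) = mean q L (fun v => indic R (E v)) v0.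
Proof.
move=> uL HE.
(* The induction moves coordinates out of [L], so it has to carry the list [K] of those already
   fixed. *)
suff H (K : seq I) (a : I -> bool) : uniq (L ++ K) ->
    pr P (fun w => (forall j, j \in K -> V w j = a j) /\ E (V w)) =
    \prod_(j <- K) (if a j then q j else 1 - q j) * mean q L (fun v => indic R (E v)) v0.
  have := H [::] xpred0; rewrite cats0 big_nil mul1r => <- //.
  by apply: eq_pr => w; split=> // -[].
elim: L E {uL} HE K a v0 => [|j L IH] E HE K a v0 /=.
  move=> uK; rewrite -(bern_cyl bV a uK) /indic; case: asboolP => Ev.
    rewrite mulr1; apply: eq_pr => w; split=> [[]//|h]; split=> //.
    by rewrite (HE _ v0).
  rewrite mulr0 -(pr0 P); apply: eq_pr => w; split=> // -[_].
  by rewrite (HE _ v0).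
move=> /andP [jLK uLK].
have jL : j \notin L by apply: contra jLK; rewrite mem_cat => ->.
have mE : event (fun w => E (V w)) by exact: event_only (bern_event bV) HE.
have mK : event (fun w => forall j, j \in K -> V w j = a j).
  apply: (event_only (E := fun v => forall j, j \in K -> v j = a j) (L := K)) (bern_event bV) _.
  by move=> v v' vv; apply/propext; split=> h i iK; rewrite -h // vv.
have part b : pr P (fun w => (forall i, i \in K -> V w i = a i) /\ E (V w) /\ V w j = b) =
    (\prod_(i <- K) (if a i then q i else 1 - q i)) *
    ((if b then q j else 1 - q j) * mean q L (fun v => indic R (E (upd v j b))) v0).
  have jK : j \notin K by apply: contra jLK; rewrite mem_cat => ->; rewrite orbT.
  have uK : uniq (L ++ j :: K) by rewrite uniq_catC /= mem_cat orbC -mem_cat jLK uniq_catC.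
  have HE' : only_on (fun i => i \in L) (fun v => E (upd v j b)).
    move=> v v' vv; apply: HE => i; rewrite inE /upd; case: eqP => //= _; exact: vv.
  have := IH _ HE' (j :: K) (upd a j b) v0 uK; rewrite big_cons.
  rewrite (_ : upd a j b j = b); last by rewrite /upd eqxx.
  have -> : \prod_(i <- K) (if upd a j b i then q i else 1 - q i) =
      \prod_(i <- K) (if a i then q i else 1 - q i).
    rewrite !big_seq; apply: eq_bigr => i iK; rewrite /upd; case: eqP => // ij.
    by rewrite -ij iK in jK.
  move=> e; rewrite mulrA [X in X * _]mulrC -e; apply: eq_pr => w; split.
    move=> [Vw [Ew Vj]]; split=> [i|].
      rewrite inE /upd; case: eqP => [-> //|_ /=]; exact: Vw.
    by rewrite (_ : upd _ _ _ = V w) //; apply/funext => i; rewrite /upd; case: eqP => // ->.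
  move=> [Vw Ew]; have Vj : V w j = b by rewrite Vw ?mem_head // /upd eqxx.
  have U : upd (V w) j b = V w by apply/funext => i; rewrite /upd; case: eqP => // ->.
  rewrite U in Ew; split=> [i iK|//].
  rewrite Vw ?inE ?iK ?orbT // /upd.
  by case: eqP => // ij; rewrite -ij iK in jK.
apply: etrans (pr_split P (event_and mK mE) (bern_event bV j true)) _.
rewrite mulrDr; congr (_ + _).
  rewrite mean_fix // -(part true); apply: eq_pr => w; tauto.
rewrite mean_fix // -(part false); apply: eq_pr => w; case: (V w j); split; try tauto; intuition.
Qed.

End Mean.

Lemma pr_transfer (I : eqType) (q : I -> R) (V V' : T -> I -> bool) (L : seq I)
  (E : (I -> bool) -> Prop) : bernoulli q V -> bernoulli q V' ->
  only_on (fun i => i \in L) E ->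
  pr P (fun w => E (V w)) = pr P (fun w => E (V' w)).
Proof.
move=> bV bV' HE; have HE' : only_on (fun i => i \in undup L) E.
  by move=> v v' vv; apply: HE => i iL; apply: vv; rewrite mem_undup.
by rewrite (pr_mean bV xpred0 (undup_uniq L) HE') (pr_mean bV' xpred0 (undup_uniq L) HE').
Qed.

Lemma pr_indep (I : eqType) (q : I -> R) (V : T -> I -> bool) (L : seq I) (A B : pred I)
  (E F : (I -> bool) -> Prop) : bernoulli q V ->
  (forall i, A i || B i -> i \in L) -> (forall i, ~~ (A i && B i)) ->
  only_on A E -> only_on B F ->
  pr P (fun w => E (V w) /\ F (V w)) = pr P (fun w => E (V w)) * pr P (fun w => F (V w)).
Proof.
move=> bV ABL AB HE HF; have uL := undup_uniq L.
have HE' : only_on (fun i => i \in undup L) E.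
  by move=> v v' vv; apply: HE => i Ai; apply: vv; rewrite mem_undup ABL // Ai.
have HF' : only_on (fun i => i \in undup L) F.
  by move=> v v' vv; apply: HF => i Bi; apply: vv; rewrite mem_undup ABL // Bi orbT.
rewrite (pr_mean bV xpred0 uL HE') (pr_mean bV xpred0 uL HF').
rewrite (pr_mean (E := fun v => E v /\ F v) bV xpred0 uL); last first.
  by move=> v v' vv; rewrite (HE' _ _ vv) (HF' _ _ vv).
rewrite -(@mean_prod _ _ q (undup L) A B) //.
- by congr mean; apply/funext => v; rewrite /indic asbool_and -mulnb natrM.
- by move=> v v' vv; rewrite /indic (HE _ _ vv).
- by move=> v v' vv; rewrite /indic (HF _ _ vv).
Qed.

Lemma bernoulli_map (I : eqType) (q q' : I -> R) (V : T -> I -> bool) (g : I -> I) :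
  injective g -> (forall i, q (g i) = q' i) -> bernoulli q V ->
  bernoulli q' (fun w i => V w (g i)).
Proof.
move=> gI qg bV; split=> [i b|L a uL]; first exact: (bern_event bV).
pose a' x := `[< exists2 i, g i = x & a i >].
have a'g i : a' (g i) = a i.
  by apply/asboolP/idP => [[j /gI ->]|ai] //; exists i.
have ugL : uniq (map g L) by rewrite map_inj_uniq.
have := bern_cyl bV a' ugL; rewrite big_map => E.
transitivity (\prod_(j <- L) (if a' (g j) then q (g j) else 1 - q (g j))); last first.
  by apply: eq_bigr => i _; rewrite a'g qg.
rewrite -E; apply: eq_pr => w; split=> [h j /mapP [i iL ->]|h i iL].
  by rewrite a'g; apply: h.
by rewrite -a'g; apply: h; apply: map_f.
Qed.

End Bernoulli.

(** * Self-destructive percolation and its finite-volume approximations *)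

Lemma rect_seq a b c d : exists L : seq site, forall i, rect a b c d i = (i \in L).
Proof.
have [N HN] := rect_box a b c d.
pose r := [seq k%:Z - N%:Z | k <- iota 0 (N + N).+1].
have rP (u : int) : (- N%:Z <= u <= N%:Z) -> u \in r.
  move=> h; apply/mapP; exists (absz (u + N%:Z)); last by lia.
  by rewrite mem_iota; lia.
clearbody r; exists [seq i <- [seq (u, v) | u <- r, v <- r] | rect a b c d i] => i.
rewrite mem_filter; case: (boolP (rect a b c d i)) => //= /HN.
case: i => u v; rewrite /box /rect /= => h; apply/esym.
by apply: (allpairs_f pair); apply: rP; lia.
Qed.

Definition window (a b c d : int) : pred site := rect (a - 1) (b + 1) (c - 1) (d + 1).
Definition rim (a b c d : int) : pred site := fun i => window a b c d i && ~~ rect a b c d i.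

(** The connection is not confined to [G], which makes the predicate decreasing in [G]; cutting a
    walk at its first exit recovers the destruction in a finite window. *)
Definition reach (G : pred site) (x : config) (i : site) : Prop :=
  exists2 j, conn false x i j & ~~ G j.

Lemma rect_window a b c d i : rect a b c d i -> window a b c d i.
Proof. rewrite /window /rect; lia. Qed.

Lemma reach_mono (G G' : pred site) x i : (forall j, G j -> G' j) -> reach G' x i -> reach G x i.
Proof. by move=> GG [j ij nG]; exists j => //; apply: contra nG; apply: GG. Qed.

Lemma killed_reach a b c d x i : rect a b c d i ->
  killed (window a b c d) (rim a b c d) x i <-> reach (rect a b c d) x i.
Proof.
move=> ri; split=> [[j ij /andP [_ nj]]|[j [g [L [Hg g0 gL]]] nj]].
  by exists j => //; apply: conn_mono ij => l /andP [].
have ex : exists t, (t <= L)%N && ~~ rect a b c d (g t) by exists L; rewrite leqnn gL.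
have [t /andP [tL nt] tmin] := ex_minnP ex.
have inr s : (s < t)%N -> rect a b c d (g s).
  move=> st; apply: contraT => ns; have := tmin s.
  by rewrite ns (leq_trans (ltnW st) tL) => /(_ isT); lia.
have wt : window a b c d (g t).
  case Et : t => [|s]; first by rewrite g0 rect_window.
  have := inr s; rewrite Et ltnSn => /(_ isT).
  by have := Hg.1 s; rewrite -Et => /(_ tL); rewrite Et /step /window /rect; lia.
exists (g t); last by rewrite /rim wt nt.
exists g, t; split=> //; split=> [s st|s]; first by apply: Hg.1; apply: leq_trans st tL.
rewrite leq_eqVlt => /orP [/eqP ->|st]; first by rewrite wt Hg.2.
by rewrite rect_window ?inr // Hg.2 // (leq_trans (ltnW st)).
Qed.

Lemma adj_step i j : adj i j -> step false i j.
Proof. rewrite /adj /step; lia. Qed.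

Lemma step_adj i j : step false i j -> i = j \/ adj i j.
Proof.
case: i j => [u v] [u' v']; rewrite /step /adj /= => h.
have H : (u = u' /\ v = v') \/ `|u - u'| + `|v - v'| == 1 by lia.
by case: H => [[-> ->]|]; [left | right].
Qed.

(* The one-step form of König's lemma: each vertex has only four neighbours. *)
Lemma reach_next (x : config) i : (forall N, reach (box N) x i) ->
  exists j, [/\ adj i j, x i & forall N, reach (box N) (fun l => x l && (l != i)) j].
Proof.
move=> H; have xi : x i by have [j /conn_in []] := H 0%N.
pose x' : config := fun l => x l && (l != i).
pose nb : seq site := [:: (i.1 + 1, i.2); (i.1 - 1, i.2); (i.1, i.2 + 1); (i.1, i.2 - 1)].
apply: contrapT => nex.
have bad j : j \in nb -> exists N, ~ reach (box N) x' j.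
  move=> jn; apply: contrapT => nj; apply: nex; exists j; split=> //.
    by move: jn; rewrite !inE /adj => /or4P [] /eqP -> /=; lia.
  by move=> N; apply: contrapT => nN; apply: nj; exists N.
have [N HN] : exists N, forall j, j \in nb -> ~ reach (box N) x' j.
  elim: nb bad => [|j s IH] bad; first by exists 0%N.
  have [|N HN] := IH _; first by move=> l ls; apply: bad; rewrite inE ls orbT.
  have [M HM] := bad j (mem_head _ _); exists (maxn N M) => l.
  rewrite inE => /orP [/eqP ->|ls].
    by apply: contra_not HM; apply: reach_mono => p; rewrite /box /rect; lia.
  by apply: contra_not (HN l ls); apply: reach_mono => p; rewrite /box /rect; lia.
have [M HM] := rect_box i.1 i.1 i.2 i.2.
have [j [g [L [Hg g0 gL]]] nj] := H (maxn N M).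
pose p t := (t <= L)%N && (g t == i).
have exp : exists t, p t by exists 0%N; rewrite /p g0 eqxx.
have pL t : p t -> (t <= L)%N by case/andP.
(* After its last visit to [i] the walk stays in [x'], and it starts there from a neighbour of
   [i]. *)
have [t /andP [tL /eqP gt] tmax] := ex_maxnP exp pL.
have {}tL : (t < L)%N.
  rewrite ltn_neqAle tL andbT; apply: contraNneq nj => tl; rewrite -gL -tl gt.
  by have := HM i; rewrite /box /rect; lia.
have after s : (t < s <= L)%N -> g s != i.
  move=> /andP [ts sL]; apply/negP => gs; have := tmax s; rewrite /p sL gs => /(_ isT); lia.
have ad : adj i (g t.+1).
  have := Hg.1 t tL; rewrite gt => /step_adj [e|//].
  by have := after t.+1; rewrite ltnSn tL => /(_ isT); rewrite -e eqxx.
apply: (HN (g t.+1)).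
  rewrite !inE; case: (g t.+1) ad => u v; case: (i) => u' v'; rewrite /adj !xpair_eqE /=; lia.
exists j; last first.
  by apply: contra nj; rewrite /box /rect; lia.
exists (fun s => g (t.+1 + s)%N), (L - t.+1)%N; split; last 2 first.
- by rewrite addn0.
- by rewrite subnKC.
split=> s sL; first by rewrite addnS; apply: Hg.1; lia.
by rewrite /x' after ?andbT; [apply: Hg.2 |]; lia.
Qed.

(** [reach_next] is iterated with each visited site deleted from the configuration, which makes the
    limiting path self-avoiding. Conversely, a self-avoiding infinite path cannot remain in a finite
    box. *)
Lemma infinite_reach (x : config) i :
  infinite_path_from x i <-> forall N, reach (box N) x i.
Proof.
split=> [[g [g0 gI gA gx]] N|H].
  have [L HL] := rect_seq (- N%:Z) N%:Z (- N%:Z) N%:Z.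
  have [t nt] : exists t, ~~ box N (g t).
    apply: contrapT => nex.
    have sub : {subset map g (iota 0 (size L).+1) <= L}.
      move=> _ /mapP [t _ ->]; rewrite -HL -/(box N (g t)).
      by apply: contraT => nt; case: nex; exists t.
    have u : uniq (map g (iota 0 (size L).+1)) by rewrite map_inj_uniq // iota_uniq.
    by have := uniq_leq_size u sub; rewrite size_map size_iota ltnn.
  exists (g t) => //; exists g, t; split=> //; split=> s _; last exact: gx.
  exact: adj_step.
pose good (s : config * site) := forall N, reach (box N) s.1 s.2.
have nxt (s : config * site) : exists s' : config * site, good s ->
    [/\ good s', adj s.2 s'.2, s.1 s.2 & s'.1 = (fun l => s.1 l && (l != s.2))].
  case: (pselect (good s)) => [gs|]; last by exists s.
  have [j [ij xi rj]] := reach_next gs.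
  by exists (fun l => s.1 l && (l != s.2), j).
have [f Hf] := choice nxt.
pose S n := iter n f (x, i).
have Sg n : good (S n).
  by elim: n => [|n IH] //=; have [] := Hf _ IH.
have St n := Hf _ (Sg n).
have dec n : forall m l, (S (n + m)%N).1 l -> (S n).1 l.
  elim=> [|m IH] l; first by rewrite addn0.
  by rewrite addnS; have [_ _ _] := St (n + m)%N; rewrite -/(S (n + m).+1) => -> /andP [/IH].
have dif n m : (n < m)%N -> (S m).2 <> (S n).2.
  move=> nm e; have [_ _ h _] := St m.
  have := @dec n.+1 (m - n.+1)%N (S m).2; rewrite subnKC // => /(_ h).
  by have [_ _ _] := St n; rewrite -/(S n.+1) => ->; rewrite e eqxx andbF.
exists (fun n => (S n).2); split=> //.
- by move=> m n e; case: (ltngtP m n) => // /dif; [move=> /(_ (esym e)) | move=> /(_ e)].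
- by move=> n; have [_ h _ _] := St n.
by move=> n; have [_ _ h _] := St n; apply: (@dec 0%N n).
Qed.

Definition sdp (v : bool * site -> bool) : config :=
  sdp_config (fun i => v (false, i)) (fun i => v (true, i)).

Definition sdp_rect (a b c d : int) (v : bool * site -> bool) : config :=
  sdp_fin (window a b c d) (rim a b c d) v.

Lemma sdp_rectE a b c d v i : rect a b c d i ->
  sdp_rect a b c d v i =
  (v (false, i) && ~~ `[< reach (rect a b c d) (fun l => v (false, l)) i >]) || v (true, i).
Proof.
move=> ri; rewrite /sdp_rect /sdp_fin; congr (_ && ~~ _ || _).
by apply: asbool_equiv_eq; apply: killed_reach.
Qed.

Lemma killed_only a b c d i : only_on (fun j => ~~ j.1 && window a b c d j.2)
  (fun v : bool * site -> bool =>
     killed (window a b c d) (rim a b c d) (fun l => v (false, l)) i).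
Proof.
move=> v v' vv; rewrite /killed.
rewrite (_ : (fun l => _ && v (false, l)) = (fun l => window a b c d l && v' (false, l))) //.
by apply/funext => l; case wl : (window a b c d l) => //=; rewrite vv.
Qed.

Lemma reach_only a b c d i : rect a b c d i ->
  only_on (fun j => ~~ j.1 && window a b c d j.2)
  (fun v : bool * site -> bool => reach (rect a b c d) (fun l => v (false, l)) i).
Proof.
move=> ri v v' vv; apply/propext; rewrite -!killed_reach //.
by rewrite (killed_only _ vv).
Qed.

Lemma sdp_rect_only a b c d i : window a b c d i ->
  only_on (fun j => window a b c d j.2) (fun v => sdp_rect a b c d v i).
Proof.
move=> wi v v' vv; rewrite /sdp_rect /sdp_fin !(vv (_, i)) //.
congr (_ && ~~ `[< _ >] || _).
by rewrite (@killed_only a b c d i v v') // => j /andP [_ wj]; apply: vv.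
Qed.

Lemma depends_sdp_rect a b c d E : depends_on (rect a b c d) E ->
  only_on (fun j => window a b c d j.2) (fun v => E (sdp_rect a b c d v)).
Proof.
move=> HE v v' vv; apply/propext.
have e i : rect a b c d i -> sdp_rect a b c d v i = sdp_rect a b c d v' i.
  by move=> ri; apply: (sdp_rect_only (rect_window ri)).
by split; apply: HE => i ri; rewrite e.
Qed.

Definition both (L : seq site) : seq (bool * site) := [seq (b, i) | b <- [:: false; true], i <- L].

Lemma mem_both L j : (j \in both L) = (j.2 \in L).
Proof.
case: j => b i; apply/allpairsP/idP => [[[b' i'] /= [_ iL [_ ->]]] //|iL].
by exists (b, i); split=> //; case: (b).
Qed.

Lemma only_seq (D : pred site) (L : seq site) (A : Type) (F : (bool * site -> bool) -> A) :
  (forall i, D i = (i \in L)) -> only_on (fun j => D j.2) F -> only_on (fun j => j \in both L) F.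
Proof. by move=> DL HF v v' vv; apply: HF => j Dj; apply: vv; rewrite mem_both -DL. Qed.

Lemma boxE N : box N = rect (- N%:Z) N%:Z (- N%:Z) N%:Z. Proof. by []. Qed.

Lemma box_mono N M i : (N <= M)%N -> box N i -> box M i.
Proof. rewrite /box /rect; lia. Qed.

Section Sdp.
Context (d : measure_display) (T : measurableType d) (R : realType) (P : probability T R).
Variables (q : bool * site -> R) (V : T -> bool * site -> bool) (bV : bernoulli P q V).
Hypothesis q01 : forall j, 0 <= q j <= 1.

Let occ w : config := fun i => V w (false, i).

Lemma event_rect a b c e (F : (bool * site -> bool) -> Prop) :
  only_on (fun j => rect a b c e j.2) F -> event (fun w => F (V w)).
Proof.
move=> HF; have [L HL] := rect_seq a b c e.
exact: event_only (bern_event bV) (only_seq HL HF).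
Qed.

Lemma event_reach N i : event (fun w => reach (box N) (occ w) i).
Proof.
case: (boolP (box N i)) => Ni.
  apply: (@event_rect (- N%:Z - 1) (N%:Z + 1) (- N%:Z - 1) (N%:Z + 1)
    (fun v => reach (box N) (fun l => v (false, l)) i)).
  by move=> v v' vv; apply: (reach_only Ni) => j /andP [_]; apply: vv.
apply: eq_event (bern_event bV (false, i) true) => w; split=> [xi|[j /conn_in [xi _] _] //].
by exists i => //; apply: conn_refl.
Qed.

Lemma event_inf i : event (fun w => infinite_path_from (occ w) i).
Proof.
apply: eq_event (event_all (event_reach ^~ i)) => w; exact: iff_sym (infinite_reach _ _).
Qed.

Lemma event_sdp i b : event (fun w => sdp (V w) i = b).
Proof.
have H : event (fun w => (V w (false, i) = true /\ ~ infinite_path_from (occ w) i) \/ V w (true, i) = true).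
  apply: event_or; last exact: bern_event bV _ _.
  by apply: event_and; [exact: bern_event bV _ _ | exact/event_not/event_inf].
have E w : sdp (V w) i <-> (V w (false, i) = true /\ ~ infinite_path_from (occ w) i) \/ V w (true, i) = true.
  rewrite /sdp /sdp_config /destroy; split.
    by case/orP => [/andP [-> /asboolP h]|->]; [left | right].
  by case=> [[-> h]|->]; rewrite ?orbT // asboolF.
case: b; first by apply: eq_event H => w; rewrite -E.
apply: eq_event (event_not H) => w; rewrite -E; by split=> [/negP/negbTE|->].
Qed.

Lemma event_config (W : T -> config) a b c e E : (forall i s, event (fun w => W w i = s)) ->
  depends_on (rect a b c e) E -> event (fun w => E (W w)).
Proof.
move=> mW HE; have [L HL] := rect_seq a b c e; apply: (event_only (L := L) mW).
by move=> z z' zz; apply/propext; split; apply: HE => i; rewrite HL => /zz.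
Qed.

Lemma event_local (W : T -> config) E : (forall i s, event (fun w => W w i = s)) ->
  local E -> event (fun w => E (W w)).
Proof. by move=> mW [N]; apply: event_config. Qed.

(** For a fixed site, reaching the outside of [box N] without having an infinite path is an event
    that decreases to the empty set as [N] grows; a rectangle has finitely many sites. *)
Lemma sdp_approx a b c e eps : 0 < eps -> exists N0, forall N, (N0 <= N)%N ->
  exists B, [/\ event B, pr P B <= eps & forall w, ~ B w -> forall i, rect a b c e i ->
    sdp (V w) i = sdp_rect (- N%:Z) N%:Z (- N%:Z) N%:Z (V w) i].
Proof.
move=> e0; have [L HL] := rect_seq a b c e; have [M HM] := rect_box a b c e.
pose B N w := exists2 i, i \in L & reach (box N) (occ w) i /\ ~ infinite_path_from (occ w) i.
have mB N : event (B N).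
  apply: event_has => i _; apply: event_and; first exact: event_reach.
  exact/event_not/event_inf.
have dB N w : B N.+1 w -> B N w.
  move=> [i iL [ri ni]]; exists i => //; split=> //.
  by apply: reach_mono ri => j; apply: box_mono.
have dB' N N' w : (N <= N')%N -> B N' w -> B N w.
  move=> /subnKC <-; elim: (N' - N)%N => [|k IH]; rewrite ?addn0 // addnS => /dB; exact: IH.
have eB w : exists N, ~ B N w.
  rewrite /B; elim: (L) => [|i s [N HN]]; first by exists 0%N => -[].
  case: (pselect (infinite_path_from (occ w) i)) => [fi|ni].
    exists N => -[j]; rewrite inE => /orP [/eqP -> [_ //]|js h]; apply: HN; by exists j.
  have [M' HM'] : exists M', ~ reach (box M') (occ w) i.
    by apply: contrapT => nM; apply/ni/infinite_reach => M'; apply: contrapT => h; apply: nM; exists M'.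
  exists (maxn N M') => -[j]; rewrite inE => /orP [/eqP -> [h _]|js [h ni']].
    by apply: HM'; apply: reach_mono h => l; apply: box_mono; lia.
  apply: HN; exists j => //; split=> //; apply: reach_mono h => l; apply: box_mono; lia.
have [N0 HN0] := pr_tends0 P mB dB eB e0.
exists (maxn N0 M) => N; rewrite geq_max => /andP [N0N MN].
exists (B N); split; [exact: mB | exact: HN0 |].
move=> w nB i ri; have Ni : box N i by apply: box_mono MN _; apply: HM.
rewrite sdp_rectE // /sdp /sdp_config /destroy; congr (_ && ~~ _ || _).
apply: asbool_equiv_eq; rewrite -boxE; split=> [/infinite_reach //|h].
by apply: contrapT => ni; apply: nB; exists i => //; rewrite -HL.
Qed.

Lemma sdp_law_approx N0 E eps : depends_on (box N0) E -> 0 < eps -> exists M, forall N, (M <= N)%N ->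
  `|pr P (fun w => E (sdp (V w))) -
    pr P (fun w => E (sdp_rect (- N%:Z) N%:Z (- N%:Z) N%:Z (V w)))| <= eps.
Proof.
move=> HE e0; have [M HM] := sdp_approx (- N0%:Z) N0%:Z (- N0%:Z) N0%:Z e0.
exists (maxn N0 M) => N; rewrite geq_max => /andP [N0N /HM [B [mB pB HB]]].
apply: (pr_close _ _ mB pB).
- exact: event_config event_sdp HE.
- apply: event_rect (depends_sdp_rect _); apply: depends_mono HE => i.
  exact: (box_mono N0N).
by move=> w /HB nB; split; apply: HE => i /nB ->.
Qed.

Lemma sdp_fkg E F : local E -> local F -> increasing E -> increasing F ->
  pr P (fun w => E (sdp (V w))) * pr P (fun w => F (sdp (V w))) <=
  pr P (fun w => E (sdp (V w)) /\ F (sdp (V w))).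
Proof.
move=> lE lF iE iF; have [n [HE HF]] := local2 lE lF.
have HEF := depends_and HE HF.
apply/ler_addgt0Pr => eps' e0'.
have [eps [e0 e1 ee]] : exists eps, [/\ 0 < eps, eps <= 1 & 4 * eps <= eps' :> R].
  exists (Num.min 1 (eps' / 4)); rewrite lt_min ltr01 divr_gt0 //=; split=> //.
    by rewrite ge_min lexx.
  have : Num.min 1 (eps' / 4) <= eps' / 4 by rewrite ge_min lexx orbT.
  lra.
have [M1 H1] := sdp_law_approx HE e0; have [M2 H2] := sdp_law_approx HF e0.
have [M3 H3] := sdp_law_approx HEF e0.
pose N := (n + M1 + M2 + M3)%N.
have {H1} := H1 N ltac:(lia); have {H2} := H2 N ltac:(lia); have {H3} := H3 N ltac:(lia).
set W := sdp_rect _ _ _ _.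
have nN : (n <= N)%N by rewrite /N; lia.
have dep G : depends_on (box n) G -> depends_on (box N) G.
  by apply: depends_mono => i; apply: box_mono.
have [L HL] := rect_seq (- N%:Z - 1) (N%:Z + 1) (- N%:Z - 1) (N%:Z + 1).
have uL := undup_uniq (both L).
have mW G : depends_on (box n) G -> pr P (fun w => G (W (V w))) =
    mean q (undup (both L)) (fun v => indic R (G (W v))) xpred0.
  move=> HG; apply: (pr_mean (E := fun v => G (W v)) bV) => // v v' vv.
  apply: (only_seq HL (depends_sdp_rect (dep _ HG))) => i iL.
  by apply: vv; rewrite mem_undup.
have fkg : pr P (fun w => E (W (V w))) * pr P (fun w => F (W (V w))) <=
    pr P (fun w => E (W (V w)) /\ F (W (V w))).
  rewrite (mW _ HE) (mW _ HF) (mW _ HEF).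
  have sn G : depends_on (box n) G -> seen (window (- N%:Z) N%:Z (- N%:Z) N%:Z) (fun z => indic R (G z)).
    move=> HG z z' zz; rewrite /indic; congr (_%:R); congr nat_of_bool; apply: asbool_equiv_eq.
    by split; apply: HG => i /(box_mono nN)/rect_window /zz.
  have mn G : increasing G -> forall z z' : config, (forall i, z i -> z' i) -> indic R (G z) <= indic R (G z').
    move=> iG z z' zz; rewrite /indic ler_nat; case: asboolP => // /(iG _ _ zz) h.
    by rewrite asboolT.
  have g0 (G : config -> Prop) z : 0 <= indic R (G z) by rewrite /indic ler0n.
  have := @fkg_fin R q (window (- N%:Z) N%:Z (- N%:Z) N%:Z) (rim (- N%:Z) N%:Z (- N%:Z) N%:Z) L q01 HL.
  have rw i : rim (- N%:Z) N%:Z (- N%:Z) N%:Z i -> window (- N%:Z) N%:Z (- N%:Z) N%:Z i by case/andP.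
  move=> /(_ rw (undup (both L)) xpred0 _ _ (sn _ HE) (sn _ HF) (g0 _) (g0 _) (mn _ iE) (mn _ iF)).
  move=> /le_trans; apply; rewrite le_eqVlt; apply/orP; left; apply/eqP; congr mean.
  by apply/funext => v; rewrite /indic asbool_and -mulnb natrM.
move: fkg; have := pr_ge0 P (fun w => E (W (V w))); have := pr_ge0 P (fun w => F (W (V w))).
have ev G : depends_on (box n) G -> event (fun w => G (W (V w))).
  by move=> HG; apply: event_rect (depends_sdp_rect (dep _ HG)).
have := pr_le1 P (ev _ HE); have := pr_le1 P (ev _ HF).
have := pr_ge0 P (fun w => E (sdp (V w))); have := pr_ge0 P (fun w => F (sdp (V w))).
rewrite !ler_norml.
move: (pr P (fun w => E (W (V w)))) (pr P (fun w => F (W (V w)))) (pr P (fun w => E (W (V w)) /\ F (W (V w)))).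
move: (pr P (fun w => E (sdp (V w)))) (pr P (fun w => F (sdp (V w)))) (pr P (fun w => E (sdp (V w)) /\ F (sdp (V w)))).
move=> x y z x' y' z' y0 x0 y1' x1' y0' x0' h /andP [h1 h2] /andP [h3 h4] /andP [h5 h6].
have : x * y <= (x' + eps) * (y' + eps) by apply: ler_pM => //; lra.
have : eps * x' <= eps by rewrite ler_piMr // ltW.
have : eps * y' <= eps by rewrite ler_piMr // ltW.
have : eps * eps <= eps by rewrite ler_piMr // ltW.
lra.
Qed.

End Sdp.

(** * Lattice symmetries, and the laws of a field and of its negation *)

Definition lattice_sym (g : site -> site) : Prop := exists h,
  [/\ cancel g h, cancel h g, forall i j, adj i j -> adj (g i) (g j)
    & forall i j, adj i j -> adj (h i) (h j)].

Lemma sym_translate v : lattice_sym (translate v).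
Proof.
exists (translate (- v.1, - v.2)); split=> [[a b]|[a b]|[a b] [c e]|[a b] [c e]];
  rewrite /translate /adj /= ?addrK ?addrNK //; lia.
Qed.

Lemma sym_flip : lattice_sym flip.
Proof.
exists flip; split=> [[a b]|[a b]|[a b] [c e]|[a b] [c e]]; rewrite /flip /adj /= ?opprK //; lia.
Qed.

Lemma sym_tr : lattice_sym tr.
Proof.
exists tr; split=> [[a b]|[a b]|[a b] [c e]|[a b] [c e]]; rewrite /tr /adj //=; lia.
Qed.

Lemma infinite_map g (x : config) i : lattice_sym g ->
  infinite_path_from (fun l => x (g l)) i <-> infinite_path_from x (g i).
Proof.
move=> [h [gh hg ga ha]]; split=> -[f [f0 fI fA fx]].
  exists (fun n => g (f n)); split=> [|m n|n|n]; rewrite ?f0 //.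
  - by move=> /(can_inj gh) /fI.
  - exact: ga.
exists (fun n => h (f n)); split=> [|m n|n|n]; rewrite ?f0 ?gh ?hg //.
- by move=> /(can_inj hg) /fI.
- exact: ha.
Qed.

Lemma sdp_map g v i : lattice_sym g -> sdp (fun j => v (j.1, g j.2)) i = sdp v (g i).
Proof.
move=> sg; rewrite /sdp /sdp_config /destroy /=; congr (_ && ~~ _ || _).
by apply: asbool_equiv_eq; apply: (infinite_map (fun l => v (false, l))).
Qed.

Section Laws.
Context (d : measure_display) (T : measurableType d) (R : realType) (P : probability T R).

Definition law (W : T -> config) (E : config -> Prop) : R := pr P (fun w => E (W w)).

Definition mixing (mu : (config -> Prop) -> R) : Prop :=
  forall (K : nat) (eps : R), 0 < eps ->
    exists n0 : nat, forall n : nat, (n0 <= n)%N -> forall (x y x' y' : int) E F,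
      depends_on (rect x (x + (K * n)%N%:Z) y (y + (K * n)%N%:Z)) E ->
      depends_on (rect x' (x' + (K * n)%N%:Z) y' (y' + (K * n)%N%:Z)) F ->
      x + (K * n)%N%:Z + (2 * n)%N%:Z <= x' ->
      mu (fun z => E z /\ F z) <= mu E * mu F + eps.

Definition associated (mu : (config -> Prop) -> R) : Prop :=
  forall E F, local E -> local F -> increasing E -> increasing F ->
    mu E * mu F <= mu (fun z => E z /\ F z).

Definition invariant_law (mu : (config -> Prop) -> R) : Prop :=
  forall g E, lattice_sym g -> local E -> mu (fun z => E (fun i => z (g i))) = mu E.

Definition neg (z : config) : config := fun i => ~~ z i.

Lemma depends_neg D E : depends_on D E -> depends_on D (fun z => E (neg z)).
Proof. by move=> HE z z' zz; apply: HE => i Di; rewrite /neg zz. Qed.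

Lemma local_neg E : local E -> local (fun z => E (neg z)).
Proof. by move=> [N HE]; exists N; apply: depends_neg. Qed.

Lemma law_rsw (W : T -> config) : (forall i b, event (fun w => W w i = b)) ->
  associated (law W) -> invariant_law (law W) -> mixing (law W) -> rsw_law (law W).
Proof.
move=> mW aW iW xW; have ev := event_local mW; split.
- by rewrite /law pr0.
- by move=> E _; apply: pr_ge0.
- by move=> E lE; apply/pr_le1/ev.
- by move=> E F lE lF EF; apply: pr_mono (ev _ lE) (ev _ lF) _ => w; apply: EF.
- by move=> E F lE lF; apply: (pr_or P (ev _ lE) (ev _ lF)).
- exact: aW.
- by move=> v E; apply/iW/sym_translate.
- by move=> E; apply/iW/sym_flip.
- by move=> E; apply/iW/sym_tr.
- exact: xW.
Qed.

Section Negation.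
Variables (W : T -> config) (mW : forall i b, event (fun w => W w i = b)).

Lemma event_neg i b : event (fun w => neg (W w) i = b).
Proof. by apply: eq_event (mW i (~~ b)) => w; rewrite /neg; case: (W w i); case: b. Qed.

Lemma invariant_neg : invariant_law (law W) -> invariant_law (law (fun w => neg (W w))).
Proof. by move=> H g E sg lE; apply: (H g (fun z => E (neg z)) sg (local_neg lE)). Qed.

Lemma mixing_neg : mixing (law W) -> mixing (law (fun w => neg (W w))).
Proof.
move=> H K eps e0; have [n0 Hn] := H K eps e0; exists n0 => n n0n x y x' y' E F HE HF.
exact: (Hn n n0n x y x' y' _ _ (depends_neg HE) (depends_neg HF)).
Qed.

(** Two events have the same covariance as their complements, and the complement of an increasing
    event of [neg z] is increasing in [z]. *)
Lemma associated_neg : associated (law W) -> associated (law (fun w => neg (W w))).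
Proof.
move=> H E F lE lF iE iF; pose E' z := ~ E (neg z); pose F' z := ~ F (neg z).
have lE' : local E' by apply/local_not/local_neg.
have lF' : local F' by apply/local_not/local_neg.
have inc G : increasing G -> increasing (fun z => ~ G (neg z)).
  move=> iG z z' zz; apply: contra_not; apply: iG => i; exact/contra/zz.
have := H _ _ lE' lF' (inc _ iE) (inc _ iF).
have ev G (lG : local G) := event_local mW lG.
have eE := ev _ (local_neg lE); have eF := ev _ (local_neg lF).
rewrite /law /E' /F' /= (pr_not P eE) (pr_not P eF).
have := pr_not P (event_or eE eF); have := pr_split P eE eF.
have /= := pr_split P (event_or eE eF) eE.
rewrite [pr P (fun w => ~ (_ \/ _))](eq_pr P (B := fun w => ~ E (neg (W w)) /\ ~ F (neg (W w)))); last by tauto.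
rewrite [pr P (fun w => (_ \/ _) /\ E _)](eq_pr P (B := fun w => E (neg (W w)))); last by tauto.
rewrite [pr P (fun w => (_ \/ _) /\ ~ E _)](eq_pr P (B := fun w => F (neg (W w)) /\ ~ E (neg (W w)))); last by tauto.
have /= := pr_split P eF eE.
rewrite [pr P (fun w => F _ /\ E _)](eq_pr P (B := fun w => E (neg (W w)) /\ F (neg (W w)))); last by tauto.
set x := pr P _; set y := pr P _; set z := pr P _; set u := pr P _; set t := pr P _; set r := pr P _.
nra.
Qed.

End Negation.
End Laws.

Section SdpLaws.
Context (d : measure_display) (T : measurableType d) (R : realType) (P : probability T R).
Variables (q : bool * site -> R) (V : T -> bool * site -> bool) (bV : bernoulli P q V).
Hypotheses (q01 : forall j, 0 <= q j <= 1) (qs : forall b i i', q (b, i) = q (b, i')).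

Lemma bernoulli_sym g : lattice_sym g -> bernoulli P q (fun w j => V w (j.1, g j.2)).
Proof.
move=> [h [gh _ _ _]]; apply: (bernoulli_map (g := fun j => (j.1, g j.2)) _ _ bV) => [|[b i] /=].
  by move=> [b i] [b' i'] /= [-> /(can_inj gh) ->].
exact: qs.
Qed.

(** Having an infinite path is not a local property, so the two laws are compared through a finite
    window, where the variables and their images under [g] have the same distribution. *)
Lemma sdp_invariant : invariant_law (law P (fun w => sdp (V w))).
Proof.
move=> g E sg [n HE]; have bV' := bernoulli_sym sg.
rewrite /law (eq_pr P (B := fun w => E (sdp (fun j => V w (j.1, g j.2))))); last first.
  move=> w; rewrite (_ : (fun i => sdp (V w) (g i)) = sdp (fun j => V w (j.1, g j.2))) //.
  by apply/funext => i; rewrite (sdp_map (V w) i sg).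
apply/eqP; rewrite -subr_eq0 -normr_le0; apply/ler_addgt0Pr => eps e0.
have e2 : 0 < eps / 2 by lra.
have [M HM] := sdp_law_approx bV HE e2; have [M' HM'] := sdp_law_approx bV' HE e2.
pose N := (n + M + M')%N; have {HM} := HM N ltac:(lia); have {HM'} := HM' N ltac:(lia).
have nN : (n <= N)%N by rewrite /N; lia.
have HE' : depends_on (rect (- N%:Z) N%:Z (- N%:Z) N%:Z) E.
  by apply: depends_mono HE => i; apply: box_mono.
have [L HL] := rect_seq (- N%:Z - 1) (N%:Z + 1) (- N%:Z - 1) (N%:Z + 1).
rewrite (pr_transfer bV' bV (only_seq HL (depends_sdp_rect HE'))) !ler_norml; lra.
Qed.

Lemma sdp_rsw : mixing (law P (fun w => sdp (V w))) ->
  rsw_law (law P (fun w => sdp (V w))) /\ rsw_law (law P (fun w => neg (sdp (V w)))).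
Proof.
move=> mx; have mW := event_sdp bV.
have aW : associated (law P (fun w => sdp (V w))) by move=> E F *; apply: (sdp_fkg bV).
split; apply: law_rsw => //.
- exact: sdp_invariant.
- exact: event_neg.
- exact: associated_neg.
- exact/invariant_neg/sdp_invariant.
- exact: mixing_neg.
Qed.

Let vac w : config := neg (fun i => V w (false, i)).

Lemma vac_only (D : pred site) E : depends_on D E ->
  only_on (fun j => ~~ j.1 && D j.2) (fun v : bool * site -> bool => E (neg (fun i => v (false, i)))).
Proof.
by move=> HE v v' vv; apply/propext; split; apply: HE => i Di; rewrite /neg vv //= Di.
Qed.

Lemma vac_indep (D D' : pred site) N E F : (forall i, D i || D' i -> box N i) ->
  (forall i, ~~ (D i && D' i)) -> depends_on D E -> depends_on D' F ->
  pr P (fun w => E (vac w) /\ F (vac w)) = pr P (fun w => E (vac w)) * pr P (fun w => F (vac w)).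
Proof.
move=> DN DD HE HF; have [L HL] := rect_seq (- N%:Z) N%:Z (- N%:Z) N%:Z.
apply: (pr_indep (L := both L) bV _ _ (vac_only HE) (vac_only HF)) => [[b i]|[b i]] /=.
  by rewrite mem_both -HL -andb_orr => /andP [_ /DN].
by have := DD i; case: (D i) => /= [/negbTE ->|_]; rewrite ?andbF.
Qed.

Lemma vac_event i b : event (fun w => vac w i = b).
Proof. by apply: event_neg => j s; apply: (bern_event bV). Qed.

Lemma vac_associated : associated (law P vac).
Proof.
move=> E F lE lF iE iF; have [N [HE HF]] := local2 lE lF.
have [L HL] := rect_seq (- N%:Z) N%:Z (- N%:Z) N%:Z; have uL := undup_uniq (both L).
have mV G : depends_on (box N) G -> law P vac G =
    mean q (undup (both L)) (fun v => indic R (G (neg (fun i => v (false, i))))) xpred0.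
  move=> HG; apply: (pr_mean (E := fun v => G (neg (fun i => v (false, i)))) bV) => // v v' vv.
  apply: (vac_only HG) => -[b i] /= /andP [_ Ni]; apply: vv.
  by rewrite mem_undup mem_both -HL.
rewrite (mV _ HE) (mV _ HF) (mV _ (depends_and HE HF)).
have anti G : increasing G ->
    mono (fun v : bool * site -> bool => - indic R (G (neg (fun i => v (false, i))))).
  move=> iG v v' vv; rewrite lerN2 /indic ler_nat; case: asboolP => // Gv'.
  by rewrite asboolT //; apply: iG Gv' => i; exact/contra/vv.
apply: le_trans (harris_anti q01 _ _ (anti _ iE) (anti _ iF)) _.
rewrite le_eqVlt; apply/orP; left; apply/eqP; congr mean.
by apply/funext => v; rewrite /indic asbool_and -mulnb natrM.
Qed.

Lemma vac_rsw : rsw_law (law P vac).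
Proof.
apply: law_rsw vac_event vac_associated _ _.
  move=> g E sg [n HE].
  have [L HL] := rect_seq (- n%:Z) n%:Z (- n%:Z) n%:Z.
  have bV' := bernoulli_sym sg.
  apply: (pr_transfer (E := fun v => E (neg (fun i => v (false, i)))) (L := both L) bV' bV).
  by move=> v v' vv; apply: (vac_only HE) => j /andP [_ jn]; apply: vv; rewrite mem_both -HL.
move=> K eps e0; exists 1%N => n n1 x y x' y' E F HE HF xx.
have [N HN] := rect_box (- `|x| - `|x'|) (`|x| + `|x'| + (K * n)%N%:Z) (- `|y| - `|y'|) (`|y| + `|y'| + (K * n)%N%:Z).
rewrite /law (vac_indep (N := N) _ _ HE HF) ?lerDl ?ltW // => i.
  by move=> h; apply: HN; move: h; rewrite /rect; lia.
rewrite /rect; lia.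
Qed.

End SdpLaws.

(** * Mixing *)

Definition clus (x : config) (i : site) : config := fun l => `[< conn false x i l >].

Lemma conn_clus x i j : conn false x i j -> conn false (clus x i) i j.
Proof.
move=> [g [L [Hg g0 gL]]]; exists g, L; split=> //; apply: walk_restr (Hg) _ => t tL.
by apply/asboolP; rewrite -g0; apply: walk_conn Hg _ _.
Qed.

Lemma conn_clus_trans (x : config) i (S : pred site) j l : (forall p, S p -> x p) ->
  clus x i j -> conn false S j l -> clus x i l.
Proof. by move=> Sx /asboolP ij jl; apply/asboolP/(conn_trans ij)/(conn_mono Sx jl). Qed.

(** The crossing by the cluster meets every occupied crossing of the rectangle placed across it, and
    that crossing then lies in the cluster as a whole. *)
Lemma absorb_v x i a b c d a' b' c' d' : a <= a' -> b' <= b -> c' <= c -> d <= d' ->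
  hcross false None a b c d (clus x i) -> vcross false None a' b' c' d' x ->
  vcross false None a' b' c' d' (clus x i).
Proof.
move=> aa bb cc dd [g [M [Hg _ g0 gM]]] [h [L [Hh _ h0 hL]]].
have [s [t [sM tL st]]] := walk_touch Hg g0 gM Hh h0 hL aa bb cc dd.
have hx p : rect a' b' c' d' p && x p -> x p by case/andP.
exists h, L; split=> //; apply: walk_restr (Hh) _ => r rL.
have /andP [-> _] := Hh.2 r rL.
have /andP [_ /asboolP gs] := Hg.2 s sM.
have : clus x i (h t).
  apply/asboolP/(conn_step gs _ st); apply: conn_refl; exact: hx (Hh.2 t tL).
by move=> /conn_clus_trans; apply; [exact: hx | apply: walk_conn Hh _ _].
Qed.

Lemma absorb_h x i a b c d a' b' c' d' : a <= a' -> b' <= b -> c' <= c -> d <= d' ->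
  vcross false None a' b' c' d' (clus x i) -> hcross false None a b c d x ->
  hcross false None a b c d (clus x i).
Proof.
move=> aa bb cc dd [h [L [Hh _ h0 hL]]] [g [M [Hg _ g0 gM]]].
have [s [t [sM tL st]]] := walk_touch Hg g0 gM Hh h0 hL aa bb cc dd.
have hx p : rect a b c d p && x p -> x p by case/andP.
exists g, M; split=> //; apply: walk_restr (Hg) _ => r rM.
have /andP [-> _] := Hg.2 r rM.
have /andP [_ /asboolP ht] := Hh.2 t tL.
have : clus x i (g s).
  apply/asboolP/(conn_step ht _ (step_sym st)); apply: conn_refl; exact: hx (Hg.2 s sM).
by move=> /conn_clus_trans; apply; [exact: hx | apply: walk_conn Hg _ _].
Qed.

(** The four bands of width [m] around the rectangle, each crossed the short way. *)
Definition leaves (a b c d m : int) (z : config) : Prop :=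
  [\/ hcross false None b (b + m) (c - m) (d + m) z,
      hcross false None (a - m) a (c - m) (d + m) z,
      vcross false None (a - m) (b + m) d (d + m) z
    | vcross false None (a - m) (b + m) (c - m) c z].

Lemma conn_leaves a b c d m x i j : 0 <= m -> conn false x i j -> rect a b c d i ->
  ~~ rect (a - m) (b + m) (c - m) (d + m) j -> leaves a b c d m x.
Proof.
move=> m0 [g [L [Hg g0 gL]]] ri nj.
pose S p := rect (a - m) (b + m) (c - m) (d + m) p && x p.
have ex : exists t, (t <= L)%N && ~~ rect (a - m) (b + m) (c - m) (d + m) (g t).
  by exists L; rewrite leqnn gL.
have [t /andP [tL nt] tmin] := ex_minnP ex.
case: t tL nt tmin => [|t] tL nt tmin.
  by move: nt; rewrite g0; move: ri; rewrite /rect; lia.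
have Hw : walk false S g t.
  split=> [s st|s st]; first by apply: Hg.1; lia.
  rewrite /S Hg.2 ?andbT; last by lia.
  apply: contraT => ns; have := tmin s; rewrite ns andbT => /(_ ltac:(lia)); lia.
have c1 : conn false S i (g t) by rewrite -g0; apply: walk_conn Hw _ _.
have c2 := conn_sym c1.
have rt : rect (a - m) (b + m) (c - m) (d + m) (g t) by have /andP [] := Hw.2 t (leqnn t).
have st := Hg.1 t tL.
have E : [\/ b + m <= (g t).1, (g t).1 <= a - m, d + m <= (g t).2 | (g t).2 <= c - m].
  have [h|h] := leP (b + m) (g t).1; first by constructor 1.
  have [h2|h2] := leP (g t).1 (a - m); first by constructor 2.
  have [h3|h3] := leP (d + m) (g t).2; first by constructor 3.
  constructor 4; move: nt st rt h h2 h3; rewrite /rect /step; lia.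
have SR p : S p -> (c - m <= p.2 <= d + m) && x p by case/andP => /andP [_ ->].
have SC p : S p -> (a - m <= p.1 <= b + m) && x p by case/andP => /andP [->].
move: ri; rewrite /rect => ri; case: E => E.
- by constructor 1; apply: (conn_hcross c1 SR); lia.
- by constructor 2; apply: (conn_hcross c2 SR); lia.
- by constructor 3; apply: (conn_vcross c1 SC); lia.
- by constructor 4; apply: (conn_vcross c2 SC); lia.
Qed.

Lemma cross_dual_v (a b c d : int) x : a <= b -> c <= d -> ~ hcross true None a b c d (neg x) ->
  vcross false None a b c d x.
Proof.
move=> ab cd nh; rewrite -hcross_tr.
case: (@cross_dual c d a b (fun i => x (tr i)) cd ab) => // v; case: nh.
move/hcross_tr: v; rewrite (_ : (fun i => _) = neg x) //.
by apply/funext => -[].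
Qed.

(** * The ladder of occupied crossings *)

Section Ladder.
Variables (a b c d m : int) (S : nat) (x : config).
Hypotheses (m0 : 0 <= m) (S0 : (0 < S)%N) (ab : a <= b) (cd : c <= d).
Hypotheses (bS : b + m = a - m + S%:Z) (dS : d + m = c - m + S%:Z).

(* Alternately horizontal and vertical rectangles with common lower left corner; each one
   crosses the next lengthwise. *)
Definition rung k (z : config) : Prop :=
  if odd k then hcross true None (a - m) (a - m + (4 ^ k * S)%N%:Z)
                  (c - m) (c - m + (4 ^ k.+1 * S)%N%:Z) z
  else vcross true None (a - m) (a - m + (4 ^ k.+1 * S)%N%:Z)
         (c - m) (c - m + (4 ^ k * S)%N%:Z) z.

Definition bands (z : config) : Prop :=
  hcross true None b (b + m) (c - m) (d + m) z \/
  (hcross true None (a - m) a (c - m) (d + m) z \/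
  (vcross true None (a - m) (b + m) d (d + m) z \/
   vcross true None (a - m) (b + m) (c - m) c z)).

Definition climb k (z : config) : Prop :=
  if odd k then vcross false None (a - m) (a - m + (4 ^ k * S)%N%:Z)
                  (c - m) (c - m + (4 ^ k.+1 * S)%N%:Z) z
  else hcross false None (a - m) (a - m + (4 ^ k.+1 * S)%N%:Z)
         (c - m) (c - m + (4 ^ k * S)%N%:Z) z.

Lemma rung_climb k : ~ rung k (neg x) -> climb k x.
Proof.
have [h1 h2] : (0 < 4 ^ k * S)%N /\ (0 < 4 ^ k.+1 * S)%N.
  by rewrite !muln_gt0 !expn_gt0 S0.
rewrite /rung /climb; case: odd => nh; first by apply: cross_dual_v nh; lia.
by case: (@cross_dual (a - m) (a - m + (4 ^ k.+1 * S)%N%:Z) (c - m) (c - m + (4 ^ k * S)%N%:Z) x) => //; lia.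
Qed.

Lemma climb_next i k : climb k (clus x i) -> climb k.+1 x -> climb k.+1 (clus x i).
Proof.
have [h1 h2] : (4 ^ k * S <= 4 ^ k.+1 * S)%N /\ (4 ^ k.+1 * S <= 4 ^ k.+2 * S)%N.
  by rewrite !leq_mul2r !leq_exp2l ?leqnSn ?orbT.
rewrite /climb /=; case: odd => /= H; first by apply: absorb_h H; lia.
by apply: absorb_v H; lia.
Qed.

(** The cluster crosses one band the short way and absorbs the occupied crossing along that band.
    From the right or left band this reaches the first rectangle of the ladder; from the top or
    bottom band it does so through the right one. *)
Lemma climb_start i : leaves a b c d m (clus x i) -> ~ bands (neg x) -> climb 0 x ->
  climb 0 (clus x i).
Proof.
move=> lv nb; rewrite /climb /= expn0 expn1 mul1n => H0.
have R : vcross false None b (b + m) (c - m) (d + m) x.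
  by apply: cross_dual_v => [||h]; [lia | lia | apply: nb; left].
have L : vcross false None (a - m) a (c - m) (d + m) x.
  by apply: cross_dual_v => [||h]; [lia | lia | apply: nb; right; left].
have U : hcross false None (a - m) (b + m) d (d + m) x.
  case: (@cross_dual (a - m) (b + m) d (d + m) x) => // [||h]; [lia | lia |].
  by case: nb; right; right; left.
have D : hcross false None (a - m) (b + m) (c - m) c x.
  case: (@cross_dual (a - m) (b + m) (c - m) c x) => // [||h]; [lia | lia |].
  by case: nb; right; right; right.
case: lv => H.
- by apply: absorb_h (absorb_v _ _ _ _ H R) H0; lia.
- by apply: absorb_h (absorb_v _ _ _ _ H L) H0; lia.
- by apply: absorb_h (absorb_v _ _ _ _ (absorb_h _ _ _ _ H U) R) H0; lia.
- by apply: absorb_h (absorb_v _ _ _ _ (absorb_h _ _ _ _ H D) R) H0; lia.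
Qed.

Lemma ladder_reach i M N : rect a b c d i ->
  reach (rect (a - m) (b + m) (c - m) (d + m)) x i -> ~ bands (neg x) ->
  (forall k, (k < M.+1)%N -> ~ rung k (neg x)) -> (2 * N < 4 ^ M.+1 * S)%N ->
  reach (box N) x i.
Proof.
move=> ri [j ij nj] nb nr big.
have lv := conn_leaves m0 (conn_clus ij) ri nj.
have cM : climb M (clus x i).
  suff H k : (k < M.+1)%N -> climb k (clus x i) by apply: H.
  elim: k => [|k IH] kM; first exact: climb_start lv nb (rung_climb (nr _ kM)).
  by apply: climb_next (IH _) (rung_climb (nr _ kM)); apply: ltnW.
have [p [p' [h1 h2 h3]]] : exists p p', [/\ clus x i p, clus x i p' & ~~ box N p \/ ~~ box N p'].
  move: cM big; rewrite /climb; case: odd => [/vcross_conn|/hcross_conn] [p [p' [/conn_in [/andP [_ h1] /andP [_ h2]] e1 e2]]] big;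
    exists p, p'; split=> //; apply/orP; rewrite -negb_and; apply/negP; rewrite /box /rect;
    move: e1 e2 big; move: (4 ^ M.+1 * S)%N => B; lia.
case: h3 => h3; [exists p => // | exists p' => //]; exact/asboolP.
Qed.

End Ladder.

Section Mixing.
Context (d : measure_display) (T : measurableType d) (R : realType) (P : probability T R).
Variables (q : bool * site -> R) (V : T -> bool * site -> bool) (bV : bernoulli P q V).
Hypotheses (q01 : forall j, 0 <= q j <= 1) (qs : forall b i i', q (b, i) = q (b, i')).

(* In a square of side [K n] the process coincides, with high probability, with a functional
   of the variables at distance less than [n] from the square. *)
Definition localizable : Prop := forall (K : nat) (eps : R), 0 < eps ->
  exists n0 : nat, forall n : nat, (n0 <= n)%N -> forall x y : int,
  exists (phi : (bool * site -> bool) -> config) (B : T -> Prop),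
  [/\ event B, pr P B <= eps,
    forall i, rect x (x + (K * n)%N%:Z) y (y + (K * n)%N%:Z) i ->
      only_on (fun j => rect (x - n%:Z + 1) (x + (K * n)%N%:Z + n%:Z - 1)
        (y - n%:Z + 1) (y + (K * n)%N%:Z + n%:Z - 1) j.2) (fun v => phi v i)
  & forall w, ~ B w -> forall i, rect x (x + (K * n)%N%:Z) y (y + (K * n)%N%:Z) i ->
      sdp (V w) i = phi (V w) i].

Lemma localizable_mixing : localizable -> mixing (law P (fun w => sdp (V w))).
Proof.
move=> H K eps' e0'.
have [eps [e0 e1 ee]] : exists eps, [/\ 0 < eps, eps <= 1 & 5 * eps <= eps' :> R].
  exists (Num.min 1 (eps' / 5)); rewrite lt_min ltr01 divr_gt0 //=; split=> //.
    by rewrite ge_min lexx.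
  have : Num.min 1 (eps' / 5) <= eps' / 5 by rewrite ge_min lexx orbT.
  lra.
have [n0 Hn0] := H K eps e0; exists n0.+1 => n n0n x y x' y' E F HE HF xx.
have [phi [B [mB pB lB HB]]] := Hn0 n (ltnW n0n) x y.
have [phi' [B' [mB' pB' lB' HB']]] := Hn0 n (ltnW n0n) x' y'.
have lE : only_on (fun j => rect (x - n%:Z + 1) (x + (K * n)%N%:Z + n%:Z - 1)
        (y - n%:Z + 1) (y + (K * n)%N%:Z + n%:Z - 1) j.2) (fun v => E (phi v)).
  move=> v v' vv; apply/propext.
  by split; apply: HE => i ri; rewrite (lB i ri v v').
have lF : only_on (fun j => rect (x' - n%:Z + 1) (x' + (K * n)%N%:Z + n%:Z - 1)
        (y' - n%:Z + 1) (y' + (K * n)%N%:Z + n%:Z - 1) j.2) (fun v => F (phi' v)).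
  move=> v v' vv; apply/propext.
  by split; apply: HF => i ri; rewrite (lB' i ri v v').
have mE := event_rect bV lE; have mF := event_rect bV lF.
have sE := event_config (event_sdp bV) HE; have sF := event_config (event_sdp bV) HF.
have cE := pr_close sE mE mB pB (fun w nB => conj
  (HE _ _ (fun i ri => HB w nB i ri)) (HE _ _ (fun i ri => esym (HB w nB i ri)))).
have cF := pr_close sF mF mB' pB' (fun w nB => conj
  (HF _ _ (fun i ri => HB' w nB i ri)) (HF _ _ (fun i ri => esym (HB' w nB i ri)))).
have cEF : pr P (fun w => E (sdp (V w)) /\ F (sdp (V w))) <=
    pr P (fun w => E (phi (V w)) /\ F (phi' (V w))) + (eps + eps).
  apply: le_trans (pr_mono P (event_and sE sF)
    (event_or (event_and mE mF) (event_or mB mB')) _) _.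
    move=> w [Ew Fw]; case: (pselect (B w)) => Bw; first by right; left.
    case: (pselect (B' w)) => Bw'; first by right; right.
    left; split; first by apply: HE Ew => i; apply: HB.
    by apply: HF Fw => i; apply: HB'.
  apply: le_trans (pr_or P (event_and mE mF) (event_or mB mB')) _; apply: lerD => //.
  by apply: le_trans (pr_or P mB mB') _; apply: lerD.
have ind : pr P (fun w => E (phi (V w)) /\ F (phi' (V w))) =
    pr P (fun w => E (phi (V w))) * pr P (fun w => F (phi' (V w))).
  have [L HL] := rect_seq (- `|x| - `|x'| - n%:Z) (`|x| + `|x'| + (K * n)%N%:Z + n%:Z)
    (- `|y| - `|y'| - n%:Z) (`|y| + `|y'| + (K * n)%N%:Z + n%:Z).
  apply: (pr_indep (L := both L) bV _ _ lE lF) => j.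
    rewrite mem_both -HL /rect; move: j.1 j.2 (K * n)%N xx n0n => j1 j2 k xx n0n.
    by clear -xx n0n; lia.
  rewrite /rect; move: j.1 j.2 (K * n)%N xx n0n => j1 j2 k xx n0n.
  by clear -xx n0n; lia.
move: cE cF cEF; rewrite ind /law.
have := pr_ge0 P (fun w => E (sdp (V w))); have := pr_ge0 P (fun w => F (sdp (V w))).
have := pr_ge0 P (fun w => E (phi (V w))); have := pr_ge0 P (fun w => F (phi' (V w))).
have := pr_le1 P sE; have := pr_le1 P sF; rewrite !ler_norml.
move: (pr P (fun w => E (phi (V w)))) (pr P (fun w => F (phi' (V w)))) => a' b'.
move: (pr P (fun w => E (sdp (V w)) /\ _)) => c.
move: (pr P (fun w => E (sdp (V w)))) (pr P (fun w => F (sdp (V w)))) => a b.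
move=> b1 a1 b0' a0' b0 a0 /andP [h1 h2] /andP [h3 h4] h5.
have : a' * b' <= (a + eps) * (b + eps) by apply: ler_pM => //; lra.
have : eps * a <= eps by rewrite ler_piMr // ltW.
have : eps * b <= eps by rewrite ler_piMr // ltW.
have : eps * eps <= eps by rewrite ler_piMr // ltW.
lra.
Qed.

Let vac w : config := neg (fun i => V w (false, i)).
Let mu := law P vac.
Let lawmu : rsw_law mu := vac_rsw bV q01 qs.

Let u n : R := hprob mu true None n (4 * n).

(** There are 16 cells of height [h] for the starting point. From each, the crossing either stays in
    a range of height [4 * h] or crosses an [h] by [h] square upwards or downwards: three events per
    cell. *)
Lemma strip_bound h x0 : (0 < h)%N ->
  mu (hcross true None x0 (x0 + h%:Z) 0 (16 * h)%N%:Z) <= 48 * u h.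
Proof.
move=> h0; rewrite (mu_hprob lawmu true None (m := h) (n := 16 * h)) ?add0r // /hprob.
pose E (j : nat) (z : config) : Prop :=
  hcross true None 0 h%:Z (j%:Z * h%:Z - h%:Z) (j%:Z * h%:Z + h%:Z *+ 3) z \/
  (vcross true None 0 h%:Z (j%:Z * h%:Z + h%:Z) (j%:Z * h%:Z + h%:Z *+ 2) z \/
   vcross true None 0 h%:Z (j%:Z * h%:Z - h%:Z) (j%:Z * h%:Z) z).
have lE j : local (E j).
  by apply: local_or; [exact: local_hcross | apply: local_or; exact: local_vcross].
have hh : hprob mu true None h h <= u h by rewrite /u; apply: (hprob_mono lawmu); lia.
have eE j : mu (E j) <= 3 * u h.
  apply: le_trans (law_or lawmu (local_hcross _ _ _ _ _ _)
    (local_or (local_vcross _ _ _ _ _ _) (local_vcross _ _ _ _ _ _))) _.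
  rewrite (mu_hprob lawmu true None (m := h) (n := 4 * h)); [|lia|lia].
  have := law_or lawmu (local_vcross true None 0 h%:Z (j%:Z * h%:Z + h%:Z) (j%:Z * h%:Z + h%:Z *+ 2))
    (local_vcross true None 0 h%:Z (j%:Z * h%:Z - h%:Z) (j%:Z * h%:Z)).
  rewrite !(mu_vprob lawmu true None (m := h) (n := h)); try lia.
  by move: hh; rewrite /u; lra.
apply: le_trans (_ : mu (fun z => exists2 j, (j < 16)%N & E j z) <= _); last first.
  apply: le_trans (mu_ex lawmu (c := 3 * u h) _ _) _ => [i _|i _|]; [exact: lE | exact: eE |].
  by rewrite mulrA -natrM.
apply: (law_mono lawmu); [exact: local_hcross | by apply: local_ex => i _; exact: lE |].
move=> z [g [L [Hg _ g0 gL]]].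
have [j j16 Hj] : exists2 j, (j < 16)%N & (j%:Z * h%:Z <= (g 0%N).2 <= j%:Z * h%:Z + h%:Z).
  have := Hg.2 0%N (leq0n L); rewrite /rect => /andP [/andP [_ r0] _].
  have [jl|jl] := ltnP (absz (g 0%N).2 %/ h) 16.
    exists (absz (g 0%N).2 %/ h)%N => //.
    have := divn_eq (absz (g 0%N).2) h; have := ltn_pmod (absz (g 0%N).2) h0.
    by move: r0; lia.
  exists 15 => //; have := leq_trunc_div (absz (g 0%N).2) h; have := leq_mul2r h 16 (absz (g 0%N).2 %/ h)%N; rewrite jl orbT.
  by move: r0; lia.
exists j => //.
have S1 p : rect 0 h%:Z 0 (16 * h)%N%:Z p && z p -> (0 <= p.1 <= h%:Z) && z p.
  by case/andP => /andP [-> _].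
case: (pselect (exists2 s, (s <= L)%N & j%:Z * h%:Z + h%:Z *+ 2 <= (g s).2)) => [[s sL hs]|n1].
  by right; left; apply: (conn_vcross (walk_conn Hg (leq0n L) sL) S1) => //; lia.
case: (pselect (exists2 s, (s <= L)%N & (g s).2 <= j%:Z * h%:Z - h%:Z)) => [[s sL hs]|n2].
  by right; right; apply: (conn_vcross (walk_conn Hg sL (leq0n L)) S1) => //; lia.
left; exists g, L; split=> //; apply: walk_restr (Hg) _ => t tL.
have /andP [] := Hg.2 t tL; rewrite /rect => /andP [-> _] ->.
rewrite andbT /=; apply/andP; split; [move: n2 | move: n1] => nn.
  by have [h1|h1] := leP (g t).2 (j%:Z * h%:Z - h%:Z); [case: nn; exists t | exact: ltW].
by have [h1|h1] := leP (j%:Z * h%:Z + h%:Z *+ 2) (g t).2; [case: nn; exists t | lia].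
Qed.

(** A crossing of width [4 * h] crosses two disjoint strips of width [h], which are exactly
    independent for the field [X]. *)
Lemma quadruple h : (0 < h)%N -> u (4 * h) <= (48 * u h) ^+ 2.
Proof.
move=> h0.
have u0 : 0 <= u h by exact: (hprob_ge0 lawmu).
pose A := hcross true None 0 h%:Z 0 (16 * h)%N%:Z.
pose B := hcross true None (2 * h)%N%:Z ((2 * h)%N%:Z + h%:Z) 0 (16 * h)%N%:Z.
apply: le_trans (_ : mu (fun z => A z /\ B z) <= _).
  apply: (law_mono lawmu); [exact: local_hcross | by apply: local_and; exact: local_hcross |].
  move=> z /hcross_conn [i [j [ij ia jb]]].
  have S1 p : rect 0 (4 * h)%N%:Z 0 (4 * (4 * h))%N%:Z p && z p ->
      (0 <= p.2 <= (16 * h)%N%:Z) && z p.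
    by rewrite /rect => /andP [h1 ->]; lia.
  by split; apply: (conn_hcross ij S1); lia.
have [N HN] := rect_box 0 (4 * h)%N%:Z 0 (16 * h)%N%:Z.
rewrite /mu /law (vac_indep bV (N := N) _ _ (@depends_hcross _ _ _ _ _ _) (@depends_hcross _ _ _ _ _ _)); first last.
- by move=> i; rewrite /rect; lia.
- by move=> i hi; apply: HN; move: hi; rewrite /rect; lia.
rewrite expr2; apply: ler_pM; try exact: pr_ge0.
  by have := strip_bound 0 h0; rewrite add0r.
exact: strip_bound.
Qed.

Hypothesis rare : forall K, tends0 (fun n => hprob mu true None n (K * n)).

(** With [C = 48 ^+ 2] the previous bound reads [C * u (4 * h) <= (C * u h) ^+ 2]. Once below
    [1 / 2] the decay is faster than geometric; a geometric bound is all that is kept. *)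
Lemma summable eps : 0 < eps -> exists2 n1, (0 < n1)%N & forall n, (n1 <= n)%N -> forall k,
  u (4 ^ k * n) <= eps / 2 ^+ k.
Proof.
move=> e0; pose C : R := 48 ^+ 2.
have C1 : 1 <= C by rewrite /C; lra.
have [e [ep e1 ee]] : exists e, [/\ 0 < e, e <= 1 / 2 & e <= eps :> R].
  exists (Num.min (1 / 2) eps); split; [by rewrite lt_min e0 andbT; lra | |];
    by rewrite ge_min lexx ?orbT.
have eC : 0 < e / C by apply: divr_gt0 => //; lra.
have [n0 Hn0] := rare 4 eC; exists n0.+1 => // n n0n k.
have n_gt0 : (0 < n)%N by lia.
have u0 m : 0 <= u m by exact: (hprob_ge0 lawmu).
suff H : C * u (4 ^ k * n) <= e / 2 ^+ k.
  apply: le_trans (_ : C * u (4 ^ k * n) <= _); first by apply: ler_peMl.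
  apply: le_trans H _; apply: ler_wpM2r => //; by rewrite invr_ge0 exprn_ge0.
elim: k => [|k IH].
  rewrite expn0 mul1n expr0 divr1 mulrC -ler_pdivlMr; last by lra.
  exact/Hn0/ltnW.
have h0 : (0 < 4 ^ k * n)%N by rewrite muln_gt0 expn_gt0.
apply: le_trans (_ : (C * u (4 ^ k * n)) ^+ 2 <= _).
  rewrite expnS -mulnA; apply: le_trans (ler_wpM2l _ (quadruple h0)) _; first lra.
  by rewrite le_eqVlt; apply/orP; left; apply/eqP; rewrite /C; ring.
apply: le_trans (_ : (e / 2 ^+ k) ^+ 2 <= _).
  by rewrite !expr2; apply: ler_pM => //; apply: mulr_ge0 => //; lra.
have k2 : 1 <= 2 ^+ k :> R by apply: exprn_ege1; lra.
rewrite expr2 exprS invfM; set y := (2 ^+ k)^-1.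
have y1 : y <= 1 by rewrite /y invf_le1 //; lra.
have y0 : 0 < y by rewrite /y invr_gt0; lra.
have : (e * y) * (e * y) <= (1 / 2) * (1 * y * e).
  rewrite (_ : e * y * (e * y) = e * (y * y * e)); last by ring.
  apply: ler_pM => //; [exact: ltW | by rewrite !mulr_ge0 // ltW |].
  by apply: ler_wpM2r; [exact: ltW | apply: ler_wpM2r => //; exact: ltW].
lra.
Qed.

Lemma rungs_bound a c m S M eps : (forall k, u (4 ^ k * S) <= eps / 2 ^+ k) ->
  mu (fun z => exists2 k, (k < M)%N & rung a c m S k z) <= 2 * eps * (1 - (2 ^+ M)^-1).
Proof.
move=> H.
have lr k : local (rung a c m S k).
  rewrite /rung; case: (odd k); [exact: local_hcross | exact: local_vcross].
have mr k : mu (rung a c m S k) <= eps / 2 ^+ k.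
  rewrite /rung (_ : (4 ^ k.+1 * S)%N = (4 * (4 ^ k * S))%N); last by rewrite expnS mulnA.
  case: (odd k).
    by rewrite (mu_hprob lawmu true None (m := 4 ^ k * S) (n := 4 * (4 ^ k * S))) //; exact: H.
  by rewrite (mu_vprob lawmu true None (m := 4 * (4 ^ k * S)) (n := 4 ^ k * S)) //; exact: H.
elim: M => [|M IH].
  rewrite expr0 invr1 subrr mulr0 (_ : (fun z => _) = fun=> False); first exact: law0 lawmu.
  by apply/funext => z; apply/propext; split=> // -[].
rewrite (_ : (fun z => _) = fun z => (exists2 k, (k < M)%N & rung a c m S k z) \/ rung a c m S M z); last first.
  apply/funext => z; apply/propext; split.
    move=> [i im Ei]; case: (ltngtP i M) => im'; [left; by exists i | lia |].
    by right; rewrite -im'.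
  by move=> [[i im Ei]|Em]; [exists i => //; lia | exists M].
apply: le_trans (law_or lawmu (local_ex (fun k _ => lr k)) (lr M)) _.
have := mr M; rewrite exprS invfM; move: IH; set y := (2 ^+ M)^-1; move: (mu _) (mu _) => s t.
lra.
Qed.

(** Off the bad event, leaving the enlarged square already means reaching the outside of [box N], so
    the two finite-volume destructions coincide, and the one in [box N] is the true one.
    Approximation, bands and rungs contribute [eps / 4] each. *)
Lemma rare_localizable : localizable.
Proof.
move=> K eps e0; have e8 : 0 < eps / 8 by lra.
have e16 : 0 < eps / 16 by lra.
(* The bands have width [m] and length [S = K * n + 2 * m], at most [(3 * K + 2) * m] because
   [n <= 3 * m]. *)
have [n1 n1_0 Hn1] := summable e8; have [n2 Hn2] := rare (3 * K + 2) e16.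
exists (n1 + n2 + 5)%N => n n0n x y.
(* The window is one site wider than the enlarged square, so [m = n - 2] keeps it at distance at
   most [n - 1]. *)
pose m := (n - 2)%N; pose S := (K * n + 2 * m)%N.
pose a := x; pose b := x + (K * n)%N%:Z; pose c := y; pose e := y + (K * n)%N%:Z.
have [N0 HN0] := sdp_approx bV a b c e (ltac:(lra) : 0 < eps / 4).
have [N1 HN1] := rect_box (a - m%:Z) (b + m%:Z) (c - m%:Z) (e + m%:Z).
pose N := maxn N0 N1; have [B [mB pB HB]] := HN0 N (leq_maxl _ _).
pose M := N.+1.
have S0 : (0 < S)%N by rewrite /S /m; lia.
pose F1 (z : config) := bands a b c e m z.
pose F2 (z : config) := exists2 k, (k < M.+1)%N & rung a c m S k z.
have l1 : local F1.
  by do !(apply: local_or; try exact: local_hcross; try exact: local_vcross).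
have lr k : local (rung a c m S k).
  rewrite /rung; case: (odd k); [exact: local_hcross | exact: local_vcross].
have l2 : local F2 by apply: local_ex => k _; exact: lr.
have bS : b + m%:Z = a - m%:Z + S%:Z by rewrite /a /b /S; move: (K * n)%N => k; lia.
have eS : e + m%:Z = c - m%:Z + S%:Z by rewrite /c /e /S; move: (K * n)%N => k; lia.
have p1 : mu F1 <= eps / 4.
  have hm : hprob mu true None m S <= eps / 16.
    apply: le_trans (Hn2 m _); last by rewrite /m; lia.
    apply: (hprob_mono lawmu) => //; rewrite /S /m; nia.
  have pH x0 y0 y1 : y1 = y0 + S%:Z -> mu (hcross true None x0 (x0 + m%:Z) y0 y1) <= eps / 16.
    by move=> ->; rewrite (mu_hprob lawmu true None (m := m) (n := S)).
  have pV x0 x1 y0 : x1 = x0 + S%:Z -> mu (vcross true None x0 x1 y0 (y0 + m%:Z)) <= eps / 16.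
    by move=> ->; rewrite (mu_vprob lawmu true None (m := S) (n := m)).
  apply: le_trans (law_or lawmu _ _) _; try exact: local_hcross.
    by do !(apply: local_or; try exact: local_hcross; try exact: local_vcross).
  apply: le_trans (lerD (lexx _) (law_or lawmu _ _)) _; try exact: local_hcross.
    by do !(apply: local_or; try exact: local_hcross; try exact: local_vcross).
  apply: le_trans (lerD (lexx _) (lerD (lexx _) (law_or lawmu _ _))) _; try exact: local_vcross.
  have h1 := pH b _ _ eS; have h3 := pV _ _ e bS.
  have h2 := pH (a - m%:Z) _ _ eS; have h4 := pV _ _ (c - m%:Z) bS.
  rewrite subrK in h2; rewrite subrK in h4; lra.
have p2 : mu F2 <= eps / 4.
  apply: le_trans (@rungs_bound a c m S M.+1 (eps / 8) _) _.
    by move=> k; apply: Hn1; rewrite /S /m; lia.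
  have : 0 <= (2 ^+ M.+1)^-1 :> R by rewrite invr_ge0 exprn_ge0.
  move: (_^-1) => t t0; have : 0 <= t * eps by rewrite mulr_ge0 // ltW.
  lra.
have ev1 := event_local (vac_event bV) l1; have ev2 := event_local (vac_event bV) l2.
exists (sdp_rect (a - m%:Z) (b + m%:Z) (c - m%:Z) (e + m%:Z)).
exists (fun w => B w \/ (F1 (vac w) \/ F2 (vac w))); split.
- by apply: event_or mB _; apply: event_or.
- apply: le_trans (pr_or P mB (event_or ev1 ev2)) _.
  have := pr_or P ev1 ev2; move: p1 p2 pB; rewrite /mu /law /vac; lra.
- move=> i ri v v' vv; apply: (@sdp_rect_only (a - m%:Z) (b + m%:Z) (c - m%:Z) (e + m%:Z)).
    by move: ri; rewrite /window /rect /a /b /c /e; lia.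
  move=> j wj; apply: vv; move: wj; rewrite /window /a /b /c /e /m.
  rewrite (_ : x - (n - 2)%N%:Z - 1 = x - n%:Z + 1); last by clear -n0n; lia.
  rewrite (_ : y - (n - 2)%N%:Z - 1 = y - n%:Z + 1); last by clear -n0n; lia.
  rewrite (_ : x + (K * n)%N%:Z + (n - 2)%N%:Z + 1 = x + (K * n)%N%:Z + n%:Z - 1); last by clear -n0n; lia.
  by rewrite (_ : y + (K * n)%N%:Z + (n - 2)%N%:Z + 1 = y + (K * n)%N%:Z + n%:Z - 1); last by clear -n0n; lia.
move=> w nB i ri.
have ri' : rect (a - m%:Z) (b + m%:Z) (c - m%:Z) (e + m%:Z) i.
  by move: ri; rewrite /rect /a /b /c /e; lia.
have Ni : box N i by apply: box_mono (HN1 i ri'); exact: leq_maxr.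
rewrite (HB w _ i ri); last by move=> Bw; apply: nB; left.
rewrite !sdp_rectE //; congr (_ && ~~ _ || _); apply: asbool_equiv_eq; rewrite -boxE; split.
  by apply: reach_mono => j rj; apply: box_mono (HN1 j rj); exact: leq_maxr.
move=> rG; apply: (@ladder_reach a b c e m S (fun l => V w (false, l)) _ _ _ _ bS eS i M N) => //.
- by rewrite /a /b; lia.
- by rewrite /c /e; lia.
- by move=> h; apply: nB; right; left.
- by move=> k kM h; apply: nB; right; right; exists k.
have := @ltn_expl 4 N isT; rewrite /M !expnS; move: (4 ^ N)%N => X; nia.
Qed.

End Mixing.

(** * Vacant circuits at infinitely many scales *)

Lemma cross_disjoint_v (a b c d : int) x : vcross false None a b c d x ->
  hcross true None a b c d (neg x) -> False.
Proof.
rewrite -hcross_tr => v h; apply: (cross_disjoint (ell' := None) v).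
apply/(hcross_tr true None a b c d (fun i => ~~ x (tr i))).
by rewrite (_ : (fun i => _) = neg x) //; apply/funext => -[].
Qed.

(** The four crossings need not be joined into a closed curve: by [conn_leaves] any exit crosses one
    of the four rectangles the short way. *)
Definition circuit (n : nat) (z : config) : Prop :=
  (vcross true None n%:Z (n%:Z + n%:Z) (- n%:Z - n%:Z) (n%:Z + n%:Z) z /\
   vcross true None (- n%:Z - n%:Z) (- n%:Z) (- n%:Z - n%:Z) (n%:Z + n%:Z) z) /\
  (hcross true None (- n%:Z - n%:Z) (n%:Z + n%:Z) n%:Z (n%:Z + n%:Z) z /\
   hcross true None (- n%:Z - n%:Z) (n%:Z + n%:Z) (- n%:Z - n%:Z) (- n%:Z) z).

Lemma circuit_blocks n x i : box n i -> circuit n (neg x) -> ~ reach (box (2 * n)) x i.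
Proof.
move=> ri [[R L] [U D]] [j ij nj].
have nj' : ~~ rect (- n%:Z - n%:Z) (n%:Z + n%:Z) (- n%:Z - n%:Z) (n%:Z + n%:Z) j.
  by move: nj; rewrite /box /rect; lia.
case: (conn_leaves (m := n%:Z) _ ij ri nj') => [//|h|h|h|h].
- exact: cross_disjoint h R.
- exact: cross_disjoint h L.
- exact: cross_disjoint_v h U.
- exact: cross_disjoint_v h D.
Qed.

Lemma circuit_depends n : (0 < n)%N ->
  depends_on (fun i => box (2 * n) i && ~~ box n.-1 i) (circuit n).
Proof.
move=> n0; do !apply: depends_and;
  apply: depends_mono (@depends_hcross _ _ _ _ _ _) || apply: depends_mono (@depends_vcross _ _ _ _ _ _);
  by move=> i; rewrite /box /rect; lia.
Qed.

Section Blocked.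
Context (d : measure_display) (T : measurableType d) (R : realType) (P : probability T R).
Variables (q : bool * site -> R) (V : T -> bool * site -> bool) (bV : bernoulli P q V).
Hypotheses (q01 : forall j, 0 <= q j <= 1) (qs : forall b i i', q (b, i) = q (b, i')).

Let vac w : config := neg (fun i => V w (false, i)).
Let mu := law P vac.
Let lawmu : rsw_law mu := vac_rsw bV q01 qs.

Variable (c : R).
Hypotheses (c0 : 0 < c) (frequent : forall n0, exists2 n, (n0 <= n)%N & c < hprob mu true None (4 * n) n).

Lemma circuit_bound n : c < hprob mu true None (4 * n) n -> c ^+ 4 <= mu (circuit n).
Proof.
move=> cn; have C0 := ltW c0.
have V1 x0 x1 : x1 = x0 + n%:Z ->
    c <= mu (vcross true None x0 x1 (- n%:Z - n%:Z) (n%:Z + n%:Z)).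
  move=> ->; rewrite (mu_vprob lawmu true None (m := n) (n := 4 * n)) ?ltW //; lia.
have H1 y0 y1 : y1 = y0 + n%:Z ->
    c <= mu (hcross true None (- n%:Z - n%:Z) (n%:Z + n%:Z) y0 y1).
  move=> ->; rewrite (mu_hprob lawmu true None (m := 4 * n) (n := n)) ?ltW //; lia.
have E : - n%:Z = - n%:Z - n%:Z + n%:Z by lia.
have lh := local_hcross; have lv := local_vcross.
rewrite (_ : c ^+ 4 = (c * c) * (c * c)); last by ring.
apply: le_trans (law_fkg lawmu (local_and (lv _ _ _ _ _ _) (lv _ _ _ _ _ _))
  (local_and (lh _ _ _ _ _ _) (lh _ _ _ _ _ _))
  (increasing_and (@increasing_vcross _ _ _ _ _ _) (@increasing_vcross _ _ _ _ _ _))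
  (increasing_and (@increasing_hcross _ _ _ _ _ _) (@increasing_hcross _ _ _ _ _ _))).
apply: ler_pM; rewrite ?mulr_ge0 //.
  apply: le_trans (law_fkg lawmu (lv _ _ _ _ _ _) (lv _ _ _ _ _ _)
    (@increasing_vcross _ _ _ _ _ _) (@increasing_vcross _ _ _ _ _ _)).
  by apply: ler_pM => //; apply: V1.
apply: le_trans (law_fkg lawmu (lh _ _ _ _ _ _) (lh _ _ _ _ _ _)
  (@increasing_hcross _ _ _ _ _ _) (@increasing_hcross _ _ _ _ _ _)).
by apply: ler_pM => //; apply: H1.
Qed.

(** The next good scale is chosen beyond [N], so its annulus is disjoint from [box N] and
    contributes an independent factor [1 - c ^+ 4]. *)
Lemma blocked_bound n0 m : exists N (E : config -> Prop), [/\ (n0 <= N)%N, depends_on (box N) E,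
  mu E <= (1 - c ^+ 4) ^+ m
  & forall x i, box n0 i -> infinite_path_from x i -> E (neg x)].
Proof.
elim: m => [|m [N [E [n0N HE pE eE]]]].
  exists n0, (fun=> True); split=> //.
  exact/(law_le1 lawmu)/local_const.
have [n Nn cn] := frequent N.+1; have n_gt0 : (0 < n)%N by lia.
have Hc := circuit_depends n_gt0.
exists (2 * n)%N, (fun z => E z /\ ~ circuit n z); split.
- by lia.
- apply: depends_and; first by apply: depends_mono HE => i; apply: box_mono; lia.
  by apply: depends_not; apply: depends_mono Hc => i /andP [].
- rewrite /mu /law (vac_indep bV (N := 2 * n) _ _ HE (depends_not Hc)); first last.
  + move=> i; rewrite negb_and negb_and negbK; have := @box_mono N n.-1 i.
    by case: (box N i) => //= /(_ ltac:(lia) isT) ->; rewrite orbT.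
  + by move=> i /orP [|/andP [//]]; apply: box_mono; lia.
  have ec : event (fun w => circuit n (vac w)).
    apply: (event_local (vac_event bV)); exists (2 * n)%N.
    by apply: depends_mono Hc => i /andP [].
  rewrite exprSr; apply: ler_pM; try exact: pr_ge0; first exact: pE.
  rewrite (pr_not P ec); have := circuit_bound cn; rewrite /mu /law; lra.
move=> x i ri fi; split; first exact: eE fi.
have rn : box n i by apply: box_mono ri; lia.
by move=> /(circuit_blocks rn); apply; move/infinite_reach: fi; apply.
Qed.

Lemma no_infinite_path i : pr P (fun w => infinite_path_from (fun l => V w (false, l)) i) <= 0.
Proof.
have [n0 Hn0] := rect_box i.1 i.1 i.2 i.2.
have ri : box n0 i by apply: Hn0; rewrite /rect !lexx.
set s := pr P _.
have c1 : c <= 1.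
  by have [n _ cn] := frequent 0; apply: le_trans (ltW cn) (hprob_le1 lawmu _ _ _ _).
have sm m : s <= (1 - c ^+ 4) ^+ m.
  have [N [E [_ HE pE eE]]] := blocked_bound n0 m.
  apply: le_trans pE; apply: pr_mono => [||w]; last exact: eE.
    exact: event_inf bV i.
  by apply: (event_local (vac_event bV)); exists N.
have r1 : `|1 - c ^+ 4| < 1.
  have c4 : 0 < c ^+ 4 by rewrite exprn_gt0.
  have : c ^+ 4 <= 1 by rewrite exprn_ile1 // ltW.
  by rewrite ltr_norml; lra.
apply/ler_addgt0Pr => eps e0; rewrite add0r.
have /cvgr0Pnorm_le/(_ _ e0) [m _ /(_ m (leqnn m)) Hm] := cvg_expr r1.
by apply: le_trans (sm m) (le_trans (ler_norm _) Hm).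
Qed.

Lemma blocked_localizable : localizable P V.
Proof.
move=> K eps e0; exists 1%N => n n1 x y.
have [L HL] := rect_seq x (x + (K * n)%N%:Z) y (y + (K * n)%N%:Z).
exists (fun v i => v (false, i) || v (true, i)).
exists (fun w => exists2 i, i \in L & infinite_path_from (fun l => V w (false, l)) i); split.
- by apply: event_has => i _; apply: event_inf bV i.
- apply: le_trans (_ : 0 <= _); last exact: ltW.
  rewrite -(mulr0 (size L)%:R); apply: pr_has => i _; first exact: event_inf bV i.
  exact: no_infinite_path.
- move=> i ri v v' vv; rewrite !(vv (_, i)) //=; move: ri; rewrite /rect; lia.
move=> w nB i ri; rewrite /sdp /sdp_config /destroy asboolF ?andbT // => fi.
by apply: nB; exists i => //; rewrite -HL.
Qed.

End Blocked.

Section Dichotomy.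
Context (d : measure_display) (T : measurableType d) (R : realType) (P : probability T R).
Variables (q : bool * site -> R) (V : T -> bool * site -> bool) (bV : bernoulli P q V).
Hypotheses (q01 : forall j, 0 <= q j <= 1) (qs : forall b i i', q (b, i) = q (b, i')).

(* Either vacant circuits block every infinite path, and nothing is destroyed, or vacant
   crossings are so rare that a cluster of macroscopic size is infinite. *)
Lemma sdp_mixing : mixing (law P (fun w => sdp (V w))).
Proof.
apply: (localizable_mixing bV).
pose mu := law P (fun w => neg (fun i => V w (false, i))).
have lawmu : rsw_law mu := vac_rsw bV q01 qs.
case: (pselect (tends0 (fun n => hprob mu true None (4 * n) n))) => [t0|nt0].
  by apply: (rare_localizable bV q01 qs); apply: (rsw lawmu); exists 4.
have [c c0 Hc] : exists2 c, 0 < c & forall n0, exists2 n, (n0 <= n)%N & c < hprob mu true None (4 * n) n.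
  apply: contrapT => nc; apply: nt0 => eps e0; apply: contrapT => nn; apply: nc; exists eps => // n0.
  apply: contrapT => nn0; apply: nn; exists n0 => n n0n; rewrite leNgt; apply/negP => h.
  by apply: nn0; exists n.
exact: (blocked_localizable bV q01 qs c0 Hc).
Qed.

Lemma sdp_rsw_law : rsw_law (law P (fun w => sdp (V w))) /\ rsw_law (law P (fun w => neg (sdp (V w)))).
Proof. exact/(sdp_rsw bV q01 qs)/sdp_mixing. Qed.

End Dichotomy.

(** * Crossing probabilities *)

Section Marginals.
Context (d : measure_display) (T : measurableType d) (R : realType) (P : probability T R).

Lemma event_rv (X : {RV P >-> bool}) b : event (fun w => X w = b).
Proof. exact: (measurable_funPTI X (Y := [set b])). Qed.

Lemma independent_cyl (X : site -> {RV P >-> bool}) (r : R) (L : seq site) (a : config) :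
  (forall i, P [set w | X i w = true] = r%:E) -> independent_RVs X -> uniq L ->
  pr P (fun w => forall i, i \in L -> X i w = a i) = \prod_(i <- L) (if a i then r else 1 - r).
Proof.
move=> lX iX uL.
have val i b : P (X i @^-1` [set b])%classic = (if b then r else 1 - r)%:E.
  rewrite -[RHS]/((if b then r else 1 - r)%:E); case: b; first exact: lX.
  have := probability_setC P (event_rv (X i) true); rewrite lX EFinB => <-; congr (P _).
  by apply/seteqP; split => w /=; case: (X i w).
pose J := seq_fset tt L.
have JL (i : site) : (i \in J) = (i \in L) by rewrite seq_fsetE.
have := iX J (fun i => [set a i])%classic (fun _ _ => I).
rewrite (_ : (\bigcap_(i in _) _)%classic = (fun w => forall i, i \in L -> X i w = a i)); last first.
  apply/funext => w; apply/propext; split=> h i; first by rewrite -JL; apply: h.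
  by move=> /= iJ; apply: h; rewrite -JL.
rewrite prE; last first.
  apply: (event_only (V := fun w i => X i w) (E := fun v => forall i, i \in L -> v i = a i) (L := L)).
    by move=> i b; apply: event_rv.
  by move=> v v' vv; apply/propext; split=> h i iL; rewrite -h // vv.
rewrite (eq_bigr (fun i => (if a i then r else 1 - r)%:E)) => [|i _]; last exact: val.
rewrite -(big_morph EFin (@EFinM R) erefl) => -[->].
apply: perm_big; apply: uniq_perm => //; exact: (fset_uniq J).
Qed.

(** The generated sigma-algebra is itself taken as the measurable structure, so that [event_only]
    applies to it. *)
Lemma sigma_cyl (X : site -> {RV P >-> bool}) (L : seq site) (a : config) :
  sigma_RVs X (fun w => forall i, i \in L -> X i w = a i).
Proof.
pose G : set (set T) := (\bigcup_i preimage_set_system setT (X i) measurable)%classic.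
apply: (@event_only _ (g_sigma_algebraType G) _ (fun w i => X i w) L
  (fun v => forall i, i \in L -> v i = a i)).
  move=> i b; apply: sub_sigma_algebra; exists i => //.
  by exists [set b]%classic => //; rewrite setTI.
by move=> v v' vv; apply/propext; split=> h i iL; rewrite -h // vv.
Qed.

Lemma bernoulli_pair (X Y : site -> {RV P >-> bool}) (p delta : R) :
  (forall i, P [set w | X i w = true] = p%:E) ->
  (forall i, P [set w | Y i w = true] = delta%:E) ->
  independent_RVs X -> independent_RVs Y -> independent_collections X Y ->
  bernoulli P (fun j : bool * site => if j.1 then delta else p)
    (fun w j => if j.1 then Y j.2 w else X j.2 w).
Proof.
move=> lX lY iX iY iXY; split=> [[b i] s|L a uL]; first by case: b; apply: event_rv.
pose LX := [seq j.2 | j <- L & ~~ j.1]; pose LY := [seq j.2 | j <- L & j.1].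
have uLX : uniq LX.
  rewrite map_inj_in_uniq ?filter_uniq // => -[b i] [b' i'].
  by rewrite !mem_filter /= => /andP [/negbTE -> _] /andP [/negbTE -> _] ->.
have uLY : uniq LY.
  rewrite map_inj_in_uniq ?filter_uniq // => -[b i] [b' i'].
  by rewrite !mem_filter /= => /andP [-> _] /andP [-> _] ->.
have mX i : (i \in LX) = ((false, i) \in L).
  apply/mapP/idP => [[[[] j]]|iL]; rewrite ?mem_filter //=; first by move=> h ->.
  by exists (false, i); rewrite ?mem_filter.
have mY i : (i \in LY) = ((true, i) \in L).
  apply/mapP/idP => [[[[] j]]|iL]; rewrite ?mem_filter //=; first by move=> h ->.
  by exists (true, i); rewrite ?mem_filter.
pose A w := forall i, i \in LX -> X i w = a (false, i).
pose B w := forall i, i \in LY -> Y i w = a (true, i).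
have mA : event A.
  apply: (event_only (V := fun w i => X i w) (E := fun v => forall i, i \in LX -> v i = a (false, i)) (L := LX)).
    by move=> i b; apply: event_rv.
  by move=> v v' vv; apply/propext; split=> h i iL; rewrite -h // vv.
have mB : event B.
  apply: (event_only (V := fun w i => Y i w) (E := fun v => forall i, i \in LY -> v i = a (true, i)) (L := LY)).
    by move=> i b; apply: event_rv.
  by move=> v v' vv; apply/propext; split=> h i iL; rewrite -h // vv.
rewrite (eq_pr P (B := fun w => A w /\ B w)); last first.
  move=> w; split=> [h|[hA hB] [[] i] jL /=].
  - split=> i; rewrite ?mX ?mY => iL; [exact: (h (false, i)) | exact: (h (true, i))].
  - by apply: hB; rewrite mY.
  - by apply: hA; rewrite mX.
have -> : pr P (fun w => A w /\ B w) = pr P A * pr P B.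
  apply/EFin_inj; rewrite EFinM -!prE //; last exact: event_and.
  by apply: iXY; apply: sigma_cyl.
rewrite (independent_cyl (fun i => a (false, i)) lX iX uLX).
rewrite (independent_cyl (fun i => a (true, i)) lY iY uLY).
rewrite (bigID (fun j => j.1)) /= mulrC !big_map !big_filter.
by congr (_ * _); apply: eq_bigr => -[[] i].
Qed.

End Marginals.

Lemma walk_path (S : pred site) L g : walk false S g L ->
  exists l, [/\ path adj (g 0%N) l, all S (g 0%N :: l) & last (g 0%N) l = g L].
Proof.
elim: L g => [|L IH] g Hg.
  by exists [::]; split=> //=; rewrite (Hg.2 0%N).
have [|l [pl al ll]] := IH (fun t => g t.+1).
  by split=> t tL; [exact: (Hg.1 t.+1) | exact: (Hg.2 t.+1)].
have [e|ad] := step_adj (Hg.1 0%N isT); first by exists l; rewrite e.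
exists (g 1%N :: l); split=> //=; first by rewrite ad.
by rewrite (Hg.2 0%N isT).
Qed.

Lemma path_conn (S : pred site) i l : path adj i l -> all S (i :: l) ->
  conn false S i (last i l).
Proof.
elim: l i => [|j l IH] i /=; first by rewrite andbT => _; apply: conn_refl.
move=> /andP [ij pl] /andP [Si al]; apply: conn_step (conn_refl false Si) (IH j pl al) _.
exact: adj_step.
Qed.

(** * From integer scales to real ones *)

Section Limits.
Variable R : realType.

Lemma crossing_hcross (rho s : R) z : 0 <= rho * s -> 0 <= s ->
  horizontal_crossing rho s z <->
  hcross false None 0 (Num.truncn (rho * s))%:Z 0 (Num.truncn s)%:Z z.
Proof.
move=> rs0 s0.
have fl (u : R) : 0 <= u -> Num.floor u = (Num.truncn u)%:Z.
  move=> u0; rewrite truncn_floor u0 gez0_abs //; by rewrite floor_ge_int.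
have inr i : in_rect rho s i = rect 0 (Num.truncn (rho * s))%:Z 0 (Num.truncn s)%:Z i.
  by rewrite /in_rect /rect -!fl // !floor_ge_int !ler0z.
split=> [[i [l [pl al i0 il]]]|[g [L [Hg _ g0 gL]]]].
  rewrite (eq_all (a2 := fun j => rect 0 (Num.truncn (rho * s))%:Z 0 (Num.truncn s)%:Z j && z j)) in al; last first.
    by move=> j /=; rewrite inr.
  have [g [L [Hg gi gl]]] := path_conn pl al.
  by exists g, L; split=> //; rewrite ?gi ?gl // -fl.
have [l [pl al ll]] := walk_path Hg.
exists (g 0%N), l; split=> //; last by rewrite ll gL fl.
by rewrite (eq_all (a2 := fun j => rect 0 (Num.truncn (rho * s))%:Z 0 (Num.truncn s)%:Z j && z j)) // => j /=; rewrite inr.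
Qed.

Variables (mu : (config -> Prop) -> R) (lawmu : rsw_law mu) (k : bool).

Definition vanish (alpha beta : R) : Prop := forall eps, 0 < eps ->
  exists M : R, forall s, M < s ->
    hprob mu k None (Num.truncn (alpha * s)) (Num.truncn (beta * s)) <= eps.

Lemma vanish_any (alpha beta alpha' beta' : R) :
  0 < alpha -> 0 < beta -> 0 < alpha' -> 0 < beta' ->
  vanish alpha beta -> vanish alpha' beta'.
Proof.
move=> a0 b0 a0' b0' H.
have K0 : exists2 K, (0 < K)%N & tends0 (fun n => hprob mu k None (K * n) n).
  (* At [s = n / beta] the height is exactly [n] and the width is at most [K * n], so a crossing of
     a [K * n] by [n] rectangle is no more likely. *)
  exists (Num.truncn (alpha / beta)).+1 => // eps e0; have [M HM] := H eps e0.
  exists (Num.truncn (beta * M)).+1 => n Mn; set K := (Num.truncn _).+1.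
  have Mb : M < n%:R / beta.
    rewrite ltr_pdivlMr // mulrC.
    have [bM|bM] := leP 0 (beta * M); last by apply: lt_le_trans bM (ler0n _ _).
    have /andP [_] := truncn_itv bM; move/lt_le_trans; apply; by rewrite ler_nat.
  have := HM _ Mb; rewrite [beta * _]mulrCA divff ?gt_eqF // mulr1 natrK; apply: le_trans.
  apply: (hprob_mono lawmu) => //.
  rewrite mulrCA mulrC -[leqRHS](@natrK R) natrM; apply: le_truncn; apply: ler_wpM2r => //.
  by have /andP [_ /ltW] := truncn_itv (ltW (divr_gt0 a0 b0)).
have F := rsw lawmu K0.
(* The factor 2 absorbs the rounding of the width: [alpha' * s < n + 1 <= 2 * n]. *)
pose K := (Num.truncn (2 * beta' / alpha')).+1.
move=> eps e0; have [n0 Hn0] := F K eps e0.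
exists (n0.+1%:R / alpha') => s hs.
have s0 : 0 < s by apply: lt_trans hs; rewrite divr_gt0.
have as0 : 0 <= alpha' * s by rewrite mulr_ge0 ?ltW.
have bs0 : 0 <= beta' * s by rewrite mulr_ge0 ?ltW.
pose n := Num.truncn (alpha' * s).
have n0n : (n0.+1 <= n)%N.
  by rewrite truncn_ge_nat // mulrC -ler_pdivrMr // ltW.
apply: le_trans (Hn0 n (ltnW n0n)); apply: (hprob_mono lawmu) => //.
have nK : beta' * s <= (K * n)%:R.
  have /andP [_ h1] := truncn_itv as0.
  have /andP [_ h2] := truncn_itv (ltW (divr_gt0 (mulr_gt0 (ltr0Sn R 1) b0') a0')).
  have h3 : s <= (2 * n)%:R / alpha'.
    rewrite ler_pdivlMr // mulrC; apply: ltW; apply: lt_le_trans h1 _.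
    by rewrite ler_nat -/n; lia.
  rewrite natrM; apply: le_trans (_ : 2 * beta' / alpha' * n%:R <= _).
    apply: le_trans (ler_wpM2l (ltW b0') h3) _.
    by rewrite natrM le_eqVlt; apply/orP; left; apply/eqP; ring.
  by apply: ler_wpM2r => //; exact: ltW.
by rewrite -[leqRHS](@natrK R); apply: le_truncn.
Qed.

Lemma limf_esup_vanish (f : R -> \bar R) (g : R -> R) :
  (forall s, 0 < s -> f s = (g s)%:E) ->
  ((limf_esup f (pinfty_nbhs R) <= 0)%E <->
   forall eps, 0 < eps -> exists M, forall s, M < s -> g s <= eps).
Proof.
move=> fg; split=> [H eps e0|H].
  have : (limf_esup f (pinfty_nbhs R) < eps%:E)%E by apply: le_lt_trans H _; rewrite lte_fin.
  move=> /ereal_inf_lt [_ [A [M [_ AM]] <-] sup]; exists (Num.max M 0) => s.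
  rewrite gt_max => /andP [Ms s0]; rewrite -lee_fin -fg //; apply: le_trans (ltW sup).
  by apply: ereal_sup_ubound; exists s => //; apply: AM.
apply/lee_addgt0Pr => eps e0; rewrite add0e; have [M HM] := H eps e0.
apply: ereal_inf_le.
exists (ereal_sup [set f s | s in [set s | Num.max M 0 < s]]).
  by exists [set s | Num.max M 0 < s] => //; exists (Num.max M 0); split; rewrite ?num_real.
apply: ge_ereal_sup => _ [s + <-]; rewrite /= gt_max => /andP [Ms s0].
by rewrite fg // lee_fin HM.
Qed.

Lemma cvg1_vanish (f : R -> \bar R) (g : R -> R) :
  (forall s, 0 < s -> f s = (1 - g s)%:E) -> (forall s, 0 <= g s) ->
  (f s @[s --> +oo] --> 1%E <->
   forall eps, 0 < eps -> exists M, forall s, M < s -> g s <= eps).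
Proof.
move=> fg g0.
have N : \forall s \near +oo, 0 < s :> R by exists 0; split.
split=> [/fine_cvg /cvgrPdist_le H eps e0|H].
  have [M [_ HM]] := H eps e0; exists (Num.max M 0) => s.
  rewrite gt_max => /andP [Ms s0]; have := HM s Ms; rewrite /= fg //= opprB addrCA subrr addr0.
  by move=> /(le_trans (ler_norm _)).
apply/fine_cvgP; split.
  by exists 0; split=> // s s0; rewrite fg.
apply/cvgrPdist_le => eps e0; have [M HM] := H eps e0.
exists (Num.max M 0); split; first exact: num_real.
move=> s; rewrite gt_max => /andP [Ms s0]; rewrite /= fg //= opprB addrCA subrr addr0.
by rewrite ger0_norm // HM.
Qed.

End Limits.

Section Crossings.
Context (d : measure_display) (T : measurableType d) (R : realType) (P : probability T R).
Variables (W : T -> config) (mW : forall i b, event (fun w => W w i = b)).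

Lemma crossing_prob (rho s : R) : 0 < rho -> 0 < s ->
  P [set w | horizontal_crossing rho s (W w)] =
  (hprob (law P W) false None (Num.truncn (rho * s)) (Num.truncn (1 * s)))%:E.
Proof.
move=> r0 s0; rewrite mul1r /hprob /law -prE; last exact: event_local mW (local_hcross _ _ _ _ _ _).
congr (P _); apply/funext => w; apply/propext.
by rewrite -(crossing_hcross (R := R)) // ?ltW // mulr_gt0.
Qed.

(** The dual crossing is vertical; invariance under transposition makes it horizontal, which
    exchanges [m] and [n]. *)
Lemma hprob_dual (m n : nat) : rsw_law (law P (fun w => neg (W w))) ->
  hprob (law P W) false None m n = 1 - hprob (law P (fun w => neg (W w))) true None n m.
Proof.
move=> lv; have ev := event_local mW (local_hcross false None 0 m%:Z 0 n%:Z).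
rewrite -(mu_vprob lv true None (a := 0) (b := m%:Z) (c := 0) (d := n%:Z)) ?add0r //.
rewrite /hprob /law -[LHS](subKr 1) -(pr_not P ev); congr (_ - _).
apply: eq_pr => w; split=> [nh|v h]; last exact: cross_disjoint h v.
by case: (@cross_dual 0 m%:Z 0 n%:Z (W w)).
Qed.

End Crossings.

Unset Implicit Arguments.
Set Strict Implicit.
Set Printing Implicit Defensive.

Theorem theorem4p8 (R : realType) (d : measure_display) (T : measurableType d)
    (P : probability T R) (p delta : R)
    (hp : 0 <= p <= 1) (hdelta : 0 <= delta <= 1)
    (X Y : site -> {RV P >-> bool})
    (lawX : forall i, P [set w | X i w = true] = p%:E)
    (lawY : forall i, P [set w | Y i w = true] = delta%:E)
    (indepX : independent_RVs X)
    (indepY : independent_RVs Y)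
    (indepXY : independent_collections X Y) :
  let f := crossing_probability X Y in
  [/\ (exists rho : R, 0 < rho /\ (0 < limf_esup (f rho) (pinfty_nbhs R))%E) ->
        forall rho : R, 0 < rho -> (0 < limf_esup (f rho) (pinfty_nbhs R))%E,
      (exists rho : R, 0 < rho /\ limf_esup (f rho) (pinfty_nbhs R) = 0%E) ->
        forall rho : R, 0 < rho -> limf_esup (f rho) (pinfty_nbhs R) = 0%E
    & (exists rho : R, 0 < rho /\ f rho s @[s --> +oo] --> 1%E) ->
        forall rho : R, 0 < rho -> f rho s @[s --> +oo] --> 1%E].
Proof.
set q := fun j : bool * site => if j.1 then delta else p.
have bV : bernoulli P q (fun w j => if j.1 then Y j.2 w else X j.2 w).
  exact: bernoulli_pair lawX lawY indepX indepY indepXY.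
have q01 j : 0 <= q j <= 1 by rewrite /q; case: j.1.
have [lo lv] := sdp_rsw_law bV q01 (fun _ _ _ => erefl).
have mW := event_sdp bV; move=> f.
pose W w := sdp (fun j => if j.1 then Y j.2 w else X j.2 w).
have fE rho : 0 < rho -> forall s, 0 < s -> f rho s =
    (hprob (law P W) false None (Num.truncn (rho * s)) (Num.truncn (1 * s)))%:E.
  by move=> r0 s; apply: (crossing_prob P mW).
(* The form [<= 0] serves both parts: its negation is the hypothesis of the first, and nonnegativity
   of [f] turns it into the equality of the second. *)
have limE rho : 0 < rho ->
    (limf_esup (f rho) (pinfty_nbhs R) <= 0)%E <-> vanish (law P W) false rho 1.
  by move=> r0; exact: (limf_esup_vanish (fE rho r0)).
have cvgE rho : 0 < rho -> f rho s @[s --> +oo] --> 1%E <-> vanish (law P (fun w => neg (W w))) true 1 rho.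
  move=> r0; apply: cvg1_vanish => s; last exact: hprob_ge0 lv _ _ _ _.
  by move=> s0; rewrite fE // (hprob_dual mW).
have lim_any rho rho' : 0 < rho -> 0 < rho' ->
    (limf_esup (f rho) (pinfty_nbhs R) <= 0)%E -> (limf_esup (f rho') (pinfty_nbhs R) <= 0)%E.
  move=> r0 r0' /(limE _ r0) H.
  exact: (proj2 (limE _ r0') (vanish_any lo r0 ltr01 r0' ltr01 H)).
split=> [[rho [r0 H]] rho' r0'|[rho [r0 H]] rho' r0'|[rho [r0 H]] rho' r0'].
- by move: H; rewrite !ltNge; apply: contra; apply: lim_any.
- apply/eqP; rewrite eq_le (lim_any rho) ?H //=; apply: limf_esup_ge0 => [[M [_ /(_ (M + 1))]]|s].
    by apply; rewrite ltrDl.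
  exact: measure_ge0.
- exact: (proj2 (cvgE _ r0') (vanish_any lv ltr01 r0 ltr01 r0' (proj1 (cvgE _ r0) H))).
Qed.
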